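(* Let $X$ be a compact metrizable space, let $\alpha\colon X\to X$ be a minimal homeomorphism, and let $U$ be an infinite dimensional UHF algebra. Then $(C(X)\rtimes_\alpha\mathbb Z)\otimes U$ is locally subhomogeneous.
   Context: A homeomorphism is minimal if every orbit is dense. $C(X)\rtimes_\alpha\mathbb Z$ is the crossed product $\mathrm C^*$-algebra of the induced action on $C(X)$. A $\mathrm C^*$-algebra is subhomogeneous if there is a finite upper bound on the dimension of its irreducible representations. A $\mathrm C^*$-algebra $A$ is locally subhomogeneous if for every finite $\mathcal F\subset A$ and $\epsilon>0$ there is a subhomogeneous $\mathrm C^*$-subalgebra $C\subseteq A$ with $\mathrm{dist}(a,C)<\epsilon$ for all $a\in\mathcal F$. *)

(* Defs.v *)
From HB Require Import structures.
From mathcomp Require Import all_boot all_order all_algebra.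
From mathcomp Require Import all_classical all_reals all_analysis.
From mathcomp Require Import complex.

Set Implicit Arguments.
Unset Strict Implicit.
Unset Printing Implicit Defensive.

Import Order.TTheory GRing.Theory Num.Theory.
Import numFieldNormedType.Exports.

Local Open Scope classical_set_scope.
Local Open Scope ring_scope.
Local Open Scope complex_scope.

Definition metrizable (R : realType) (X : topologicalType) : Prop :=
  exists d : X -> X -> R,
    [/\ forall x y, d x y = 0 <-> x = y,
        forall x y, d x y = d y x,
        forall x y z, d x z <= d x y + d y z &
        forall (x : X) (V : set X),
          nbhs x V <-> exists2 e : R, 0 < e & [set y | d x y < e] `<=` V].

Definition homeomorphism (X Y : topologicalType) (f : X -> Y) : Prop :=
  continuous f /\
  exists g : Y -> X, [/\ continuous g, cancel f g & cancel g f].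

(* The orbit under all integer powers, for injective [f]. *)
Definition full_orbit (X : Type) (f : X -> X) (x : X) : set X :=
  [set y | exists n : nat, y = iter n f x \/ x = iter n f y].

Definition minimal (X : topologicalType) (f : X -> X) : Prop :=
  forall x : X, closure (full_orbit f x) = [set: X].

(* Unital C*-algebras: scalars are [R[i]]; a norm is valued in the nonnegative
   real elements of [R[i]].  The zero algebra is allowed, being C(X) for empty X.  The product
   is part of the mixin because the hierarchy builder rejects a join of ring and
   normed module structures not below [numDomainType]; the ring structure is
   then recovered as an instance. *)

HB.mixin Record isCStarAlgebra (R : realType) A
    of CompleteNormedModule R[i] A := {
  cone : A;
  cmul : A -> A -> A;
  cstar : A -> A;
  cmulA : associative cmul;
  cmul1 : left_id cone cmul;
  cmulr1 : right_id cone cmul;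
  cmulDl : left_distributive cmul +%R;
  cmulDr : right_distributive cmul +%R;
  cscalerAl : forall (a : R[i]) (x y : A), a *: cmul x y = cmul (a *: x) y;
  cscalerAr : forall (a : R[i]) (x y : A), a *: cmul x y = cmul x (a *: y);
  cstarK : involutive cstar;
  cstar_linear : forall (a : R[i]) (x y : A),
    cstar (a *: x + y) = Num.conj a *: cstar x + cstar y;
  cstarM : forall x y : A, cstar (cmul x y) = cmul (cstar y) (cstar x);
  cnorm_mul : forall x y : A, `|cmul x y| <= `|x| * `|y|;
  cnorm_star : forall x : A, `|cmul (cstar x) x| = `|x| ^+ 2
}.

#[short(type="cstarType")]
HB.structure Definition CStarAlgebra (R : realType) :=
  {A of isCStarAlgebra R A & CompleteNormedModule R[i] A}.

HB.instance Definition _ (R : realType) (A : cstarType R) :=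
  GRing.Zmodule_isPzRing.Build A
    (@cmulA R A) (@cmul1 R A) (@cmulr1 R A) (@cmulDl R A) (@cmulDr R A).

Definition unital_star_hom (R : realType) (A B : cstarType R) (f : A -> B) :
    Prop :=
  [/\ linear f, monoid_morphism f & forall x, f (cstar x) = cstar (f x)].

Definition closed_subspace (R : realType) (V : normedModType R[i])
    (S : set V) : Prop :=
  [/\ closed S, S 0 &
      forall (a : R[i]) x y, S x -> S y -> S (a *: x + y)].

(* C*-subalgebras need not contain the unit of the ambient algebra. *)
Definition cstar_subalgebra (R : realType) (A : cstarType R) (S : set A) :
    Prop :=
  [/\ closed_subspace S,
      forall x y, S x -> S y -> S (x * y) &
      forall x, S x -> S (cstar x)].

(* Equivalently, the linear span of [S] is dense. *)
Definition total_set (R : realType) (V : normedModType R[i]) (S : set V) :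
    Prop :=
  forall W : set V, closed_subspace W -> S `<=` W -> W = [set: V].

Definition dim_le (R : realType) (V : lmodType R[i]) (n : nat) : Prop :=
  exists v : 'I_n -> V, forall x : V,
    exists c : 'I_n -> R[i], x = \sum_(i < n) c i *: v i.

Definition infinite_dimensional (R : realType) (V : lmodType R[i]) : Prop :=
  forall n, ~ dim_le V n.

Record hilbertType (R : realType) := Hilbert {
  hilbert_sort :> completeNormedModType R[i];
  dotp : {dot hilbert_sort for (@Num.conj R[i])};
  dotp_norm : forall x : hilbert_sort, `|x| ^+ 2 = dotp x x
}.

Arguments dotp {R h}.

(* A representation on [H] of the C*-subalgebra [S] of [A]; the values of [pi]
   outside [S] are irrelevant. *)
Definition representation (R : realType) (A : cstarType R) (S : set A)
    (H : hilbertType R) (pi : A -> H -> H) : Prop :=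
  [/\ forall a, S a -> linear (pi a) /\ continuous (pi a),
      forall (c : R[i]) a b x, S a -> S b ->
        pi (c *: a + b) x = c *: pi a x + pi b x,
      forall a b x, S a -> S b -> pi (a * b) x = pi a (pi b x) &
      forall a x y, S a -> dotp (pi a x) y = dotp x (pi (cstar a) y)].

Definition faithful_representation (R : realType) (A : cstarType R)
    (H : hilbertType R) (pi : A -> H -> H) : Prop :=
  representation [set: A] pi /\ injective pi.

Definition irreducible_representation (R : realType) (A : cstarType R)
    (S : set A) (H : hilbertType R) (pi : A -> H -> H) : Prop :=
  [/\ representation S pi,
      exists2 a, S a & exists x, pi a x != 0 &
      forall W : set H, closed_subspace W ->
        (forall a x, S a -> W x -> W (pi a x)) ->
        W = [set 0] \/ W = [set: H]].

Definition subhomogeneous (R : realType) (A : cstarType R) (S : set A) :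
    Prop :=
  exists n : nat, forall (H : hilbertType R) (pi : A -> H -> H),
    irreducible_representation S pi -> dim_le H n.

Definition locally_subhomogeneous (R : realType) (A : cstarType R) : Prop :=
  forall (F : set A) (e : R), finite_set F -> 0 < e ->
    exists S : set A, [/\ cstar_subalgebra S, subhomogeneous S &
      forall a, F a -> exists2 c, S c & `|a - c| < e%:C].

(* [(phi, u)] is a covariant pair in [A]: a unital *-homomorphism from C(X) to
   [A], given by the values of [phi] on continuous functions, and a unitary
   implementing the induced automorphism [f |-> f \o alpha^-1] of C(X); to
   avoid naming [alpha^-1], covariance is written for [f \o alpha]. *)
Definition covariant_pair (R : realType) (X : topologicalType)
    (alpha : X -> X) (A : cstarType R) (phi : (X -> R[i]^o) -> A) (u : A) :
    Prop :=
  [/\ [/\ forall (a : R[i]) (f g : X -> R[i]^o), continuous f -> continuous g ->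
            phi (fun x => a * f x + g x) = a *: phi f + phi g,
          forall f g : X -> R[i]^o, continuous f -> continuous g ->
            phi (fun x => f x * g x) = phi f * phi g,
          phi (fun=> 1) = 1 &
          forall f : X -> R[i]^o, continuous f ->
            phi (fun x => Num.conj (f x)) = cstar (phi f)],
      cstar u * u = 1 /\ u * cstar u = 1 &
      forall f : X -> R[i]^o, continuous f ->
        u * phi (f \o alpha) * cstar u = phi f].

(* [A], with its canonical copy of C(X) and canonical unitary, is the universal
   C*-algebra generated by a covariant pair. *)
Definition is_crossed_product (R : realType) (X : topologicalType)
    (alpha : X -> X) (A : cstarType R) (phi : (X -> R[i]^o) -> A) (u : A) :
    Prop :=
  [/\ covariant_pair alpha phi u,
      forall S : set A, cstar_subalgebra S ->
        (forall f, continuous f -> S (phi f)) -> S u -> S = [set: A] &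
      forall (B : cstarType R) (psi : (X -> R[i]^o) -> B) (v : B),
        covariant_pair alpha psi v ->
        exists2 F : A -> B, unital_star_hom F &
          (forall f, continuous f -> F (phi f) = psi f) /\ F u = v].

(* [U] is the closure of an increasing union of unital subalgebras isomorphic
   to full matrix algebras. *)
Definition is_UHF (R : realType) (U : cstarType R) : Prop :=
  exists (k : nat -> nat) (phi : forall m, 'M[R[i]]_(k m) -> U),
    [/\ forall m, (0 < k m)%N,
        forall m, [/\ linear (phi m), monoid_morphism (phi m),
                      injective (phi m) &
                      forall M, phi m (map_mx Num.conj M^T) = cstar (phi m M)],
        forall m, range (phi m) `<=` range (phi m.+1) &
        closure (\bigcup_m range (phi m)) = [set: U]].

(* [L] is the Hilbert space tensor product of [H] and [K], with elementary
   tensors [ten]. *)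
Definition is_hilbert_tensor (R : realType) (H K L : hilbertType R)
    (ten : H -> K -> L) : Prop :=
  [/\ forall y, linear (ten^~ y), forall x, linear (ten x),
      forall x x' y y',
        dotp (ten x y) (ten x' y') = dotp x x' * dotp y y' &
      total_set [set z | exists x y, z = ten x y]].

(* [T], with elementary tensors [t], is the spatial tensor product of [A] and
   [B]: up to a faithful representation of [T], the closed span of the operators
   [pi a (x) rho b] for some faithful representations [pi] and [rho]. *)
Definition is_tensor_product (R : realType) (A B T : cstarType R)
    (t : A -> B -> T) : Prop :=
  exists (H K L : hilbertType R) (ten : H -> K -> L)
    (pi : A -> H -> H) (rho : B -> K -> K) (sigma : T -> L -> L),
    [/\ is_hilbert_tensor ten,
        [/\ faithful_representation pi, faithful_representation rho &
            faithful_representation sigma],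
        forall a b x y, sigma (t a b) (ten x y) = ten (pi a x) (rho b y) &
        total_set [set z | exists a b, z = t a b]].

(* Main.v *)
(* Let [T] be the tensor product. Only the images of C(X), of the canonical unitary
   [u] and of [U] in [T] matter: it suffices to find, for finitely many continuous
   functions and a matrix algebra G inside [U], a subhomogeneous C*-algebra that
   contains G and almost contains the functions and [u].

   Cut the orbits of [alpha] at a small ball around a point q. The span D of the
   monomials [u^j f c], with c in a matrix algebra and f vanishing on the pieces of
   orbit of length j that are cut, has bounded degree, since by minimality every
   piece is cut within a bounded time: an irreducible representation either is a
   bounded number of point evaluations or vanishes. D does not contain [u], but it
   contains [u x] for a unitary [x] with [x - 1] supported near q.

   In [U], choose many matrix units commuting with G. They make room for a partial
   isometry z = sum_j E_{j0} u^j mu_j in D with z^* z = E_{00} and range near a point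
   x0, and for the isometric copies z_i = u^i z, i <= N, where alpha^N x0 is close to
   x0. The same trick moves the defect [x - 1] into the corner E_{00}. There it
   generates, together with E_{00}, a commutative algebra, which costs nothing as a
   coefficient algebra for the tower of matrix units z_i z_j^*. Exchanging z_0, z_N
   and the defect by rotations spread over M steps of the orbit (Berg's technique)
   conjugates [u] into the resulting subhomogeneous algebra up to O(1/sqrt M). If
   [X] has a periodic point, it is a single finite orbit, and the tower alone
   suffices. *)

Require Import Defs.
From HB Require Import structures.
From mathcomp Require Import all_boot all_order all_algebra.
From mathcomp Require Import all_classical all_reals all_analysis.
From mathcomp Require Import complex.
From mathcomp Require Import ring lra zify.

Set Implicit Arguments.
Unset Strict Implicit.
Unset Printing Implicit Defensive.

Import Order.TTheory GRing.Theory Num.Theory.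
Import numFieldNormedType.Exports.

Local Open Scope classical_set_scope.
Local Open Scope ring_scope.
Local Open Scope complex_scope.

(** The constants are chosen in a forced order. The tolerance fixes [M], and then [del]. Next come
    the height [N] of the tower and the bound [n] on the paths into its base, and only then the
    number [l + 1] of sheets in the UHF algebra. The cut must be shrunk after that, since its
    translates by up to [l] steps have to be disjoint for the defect to fit into one corner. This is
    harmless: the paths keep a definite distance from the point q itself, so they miss every smaller
    cut.

    Berg's technique needs a path of unitaries that ends at 1, but the defect alone offers none. The
    exchange therefore multiplies by the defect unitary and by its inverse: they cancel at one end
    of the path, and at the other the inverse has been carried into the top of the tower, where it
    becomes a unitary of the corner.

    Dimensions are bounded crudely, by counting scalars that determine an operator in an irreducible
    representation. Functional calculus is replaced by one square root, obtained by iteration, and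
    by the fact that a self-adjoint contraction is the real part of a unitary. *)

(** * Identities in noncommutative rings, decided by reflection *)

Inductive ncexpr :=
  | NcVar of nat | NcZero | NcOne | NcAdd of ncexpr & ncexpr
  | NcMul of ncexpr & ncexpr | NcOpp of ncexpr.

Fixpoint nc_insert (c : int) (w : seq nat) (l : seq (int * seq nat)) :=
  if l is (d, v) :: l' then
    if w == v then (c + d, v) :: l' else (d, v) :: nc_insert c w l'
  else [:: (c, w)].

Definition nc_add (l k : seq (int * seq nat)) :=
  foldr (fun p => nc_insert p.1 p.2) k l.

Definition nc_mul (l k : seq (int * seq nat)) :=
  foldr (fun p acc => nc_add [seq (p.1 * q.1, p.2 ++ q.2) | q <- k] acc) [::] l.

Fixpoint nc_norm (e : ncexpr) : seq (int * seq nat) :=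
  match e with
  | NcVar n => [:: (1, [:: n])]
  | NcZero => [::]
  | NcOne => [:: (1, [::])]
  | NcAdd a b => nc_add (nc_norm a) (nc_norm b)
  | NcMul a b => nc_mul (nc_norm a) (nc_norm b)
  | NcOpp a => [seq (- p.1, p.2) | p <- nc_norm a]
  end.

Section NcEval.
Variables (T : pzRingType) (env : seq T).

Fixpoint nc_eval (e : ncexpr) : T :=
  match e with
  | NcVar n => nth 0 env n
  | NcZero => 0
  | NcOne => 1
  | NcAdd a b => nc_eval a + nc_eval b
  | NcMul a b => nc_eval a * nc_eval b
  | NcOpp a => - nc_eval a
  end.

Definition nc_word (w : seq nat) : T := \prod_(i <- w) nth 0 env i.

Definition nc_sum (l : seq (int * seq nat)) : T :=
  \sum_(p <- l) nc_word p.2 *~ p.1.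

Lemma nc_insertE c w l : nc_sum (nc_insert c w l) = nc_word w *~ c + nc_sum l.
Proof.
rewrite /nc_sum; elim: l => [|[d v] l ih] /=; first by rewrite big_seq1 big_nil addr0.
case: eqP => [->|_]; rewrite !big_cons /=; first by rewrite mulrzDr addrA.
by rewrite ih addrCA.
Qed.

Lemma nc_addE l k : nc_sum (nc_add l k) = nc_sum l + nc_sum k.
Proof.
elim: l => [|p l ih] /=; first by rewrite /nc_sum big_nil add0r.
by rewrite nc_insertE ih {3}/nc_sum big_cons addrA.
Qed.

Lemma nc_mulE l k : nc_sum (nc_mul l k) = nc_sum l * nc_sum k.
Proof.
elim: l => [|p l ih] /=; first by rewrite /nc_sum !big_nil mul0r.
rewrite nc_addE ih [nc_sum (p :: l)]/nc_sum big_cons mulrDl; congr (_ + _).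
rewrite /nc_sum big_map /= mulr_sumr; apply: eq_bigr => q _.
by rewrite /nc_word big_cat /= mulrzAl mulrzAr mulrC mulrzA.
Qed.

Lemma nc_normE e : nc_eval e = nc_sum (nc_norm e).
Proof.
elim: e => /= [n|||a -> b ->|a -> b ->|a ->].
- by rewrite /nc_sum big_seq1 /nc_word big_seq1.
- by rewrite /nc_sum big_nil.
- by rewrite /nc_sum big_seq1 /nc_word big_nil.
- by rewrite nc_addE.
- by rewrite nc_mulE.
- by rewrite /nc_sum big_map raddf_sum; apply: eq_bigr => p _ /=; rewrite mulrNz.
Qed.

(** Cancelled words stay in the list with coefficient 0, so the test asks that every coefficient of
    the normalized difference vanish. *)
Lemma nc_ringP a b :
  all (fun p => p.1 == 0) (nc_norm (NcAdd a (NcOpp b))) -> nc_eval a = nc_eval b.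
Proof.
move=> h; apply/eqP; rewrite -subr_eq0 -/(nc_eval (NcAdd a (NcOpp b))) nc_normE.
apply/eqP; rewrite /nc_sum big_seq big1// => p /(allP h)/eqP ->.
by rewrite mulr0z.
Qed.

End NcEval.

Ltac nc_index x l :=
  lazymatch l with
  | x :: _ => constr:(0%N)
  | _ :: ?l' => let n := nc_index x l' in constr:(S n)
  end.

Ltac nc_mem x l :=
  lazymatch l with
  | x :: _ => constr:(true)
  | _ :: ?l' => nc_mem x l'
  | _ => constr:(false)
  end.

Ltac nc_atoms t l :=
  lazymatch t with
  | GRing.add ?x ?y => let l := nc_atoms x l in nc_atoms y l
  | GRing.mul ?x ?y => let l := nc_atoms x l in nc_atoms y l
  | GRing.opp ?x => nc_atoms x l
  | 0 => l
  | 1 => l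
  | _ => lazymatch nc_mem t l with true => l | false => constr:(t :: l) end
  end.

Ltac nc_reify t l :=
  lazymatch t with
  | GRing.add ?x ?y => let a := nc_reify x l in let b := nc_reify y l in
      constr:(NcAdd a b)
  | GRing.mul ?x ?y => let a := nc_reify x l in let b := nc_reify y l in
      constr:(NcMul a b)
  | GRing.opp ?x => let a := nc_reify x l in constr:(NcOpp a)
  | 0 => constr:(NcZero)
  | 1 => constr:(NcOne)
  | _ => let n := nc_index t l in constr:(NcVar n)
  end.

Ltac ncring :=
  lazymatch goal with
  | |- @eq ?T ?x ?y =>
    let l := nc_atoms x (@nil T) in
    let l := nc_atoms y l in
    let a := nc_reify x l in
    let b := nc_reify y l in
    refine (@nc_ringP _ l a b _); vm_compute; reflexivity
  end.

(** * C*-algebras and their representations *)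

Section RealNorm.
Variables (R : realType) (V : normedModType R[i]).
Implicit Types (x y : V).

(** Norms take values in [R[i]], out of reach of [lra] and [nra]; the estimates go through this real
    version. *)
Definition nrm x : R := complex.Re `|x|.

Lemma nrmE x : `|x| = (nrm x)%:C.
Proof. by rewrite /nrm RRe_real. Qed.

Lemma nrm_ge0 x : 0 <= nrm x.
Proof. rewrite -lecR -nrmE; exact: normr_ge0. Qed.

Lemma nrm0 : nrm 0 = 0.
Proof. by rewrite /nrm normr0. Qed.

Lemma nrm_eq0 x : nrm x = 0 -> x = 0.
Proof. by move=> h; apply/eqP; rewrite -normr_eq0 nrmE h. Qed.

Lemma nrmD x y : nrm (x + y) <= nrm x + nrm y.
Proof. by rewrite -lecR raddfD /= -!nrmE ler_normD. Qed.

Lemma nrmN x : nrm (- x) = nrm x.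
Proof. by rewrite /nrm normrN. Qed.

Lemma nrmBC x y : nrm (x - y) = nrm (y - x).
Proof. by rewrite -nrmN opprB. Qed.

Lemma nrmB x y : nrm (x - y) <= nrm x + nrm y.
Proof. by rewrite -(nrmN y) nrmD. Qed.

Lemma nrm_tri x y z : nrm (x - z) <= nrm (x - y) + nrm (y - z).
Proof. by rewrite -[x - z](subrKA y) nrmD. Qed.

Lemma nrmZ (a : R[i]) x : nrm (a *: x) = complex.Re `|a| * nrm x.
Proof.
by apply: complexI; rewrite rmorphM /= -!nrmE normrZ; congr (_ * _).
Qed.

Lemma nrmZ_real (k : R) x : nrm (k%:C *: x) = `|k| * nrm x.
Proof. by rewrite nrmZ normc_def /= expr0n addr0 sqrtr_sqr. Qed.

Lemma nrm_sum (I : Type) (r : seq I) (P : pred I) (F : I -> V) :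
  nrm (\sum_(i <- r | P i) F i) <= \sum_(i <- r | P i) nrm (F i).
Proof.
elim/big_rec2: _ => [|i y x _ h]; first by rewrite nrm0.
by apply: le_trans (nrmD _ _) _; rewrite lerD2l.
Qed.

Lemma nbhs_nrm x (A : set V) :
  nbhs x A <-> exists2 e : R, 0 < e & forall y, nrm (x - y) < e -> A y.
Proof.
split.
  rewrite -nbhs_ballE => -[e /= e0 eA].
  exists (complex.Re e).
    by move: e0; rewrite ltcE => /andP[_].
  move=> y xy; apply: eA; rewrite -ball_normE /= nrmE.
  by rewrite ltcE /= xy andbT; move: e0; rewrite ltcE => /andP[].
move=> [e e0 eA]; rewrite -nbhs_ballE; exists e%:C => /=.
  by rewrite ltcR.
by move=> y; rewrite -ball_normE /= nrmE ltcR => /eA.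
Qed.

Lemma closureE (S : set V) x :
  closure S x <-> forall e : R, 0 < e -> exists2 y, S y & nrm (x - y) < e.
Proof.
split=> [cl e e0|h B /nbhs_nrm[e /h[y Sy xy] eB]].
  have /cl[y [Sy xy]] : nbhs x [set y | nrm (x - y) < e].
    by apply/nbhs_nrm; exists e.
  by exists y.
by exists y; split => //; apply: eB.
Qed.

Lemma closedE (S : set V) : closed S <->
  forall x, (forall e : R, 0 < e -> exists2 y, S y & nrm (x - y) < e) -> S x.
Proof.
by split=> h x; [move=> /closureE/h|move=> /closureE]; last exact: h.
Qed.

End RealNorm.

Lemma continuous_nrm (R : realType) (V W : normedModType R[i]) (f : V -> W) :
  continuous f -> forall x (e : R), 0 < e ->
  exists2 d : R, 0 < d & forall y, nrm (x - y) < d -> nrm (f x - f y) < e.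
Proof.
move=> cf x e e0.
have /cf : nbhs (f x) [set y | nrm (f x - y) < e] by apply/nbhs_nrm; exists e.
by move=> /nbhs_nrm.
Qed.

Section Complete.
Variables (R : realType) (V : completeNormedModType R[i]).

(** The majorant principle: the increments of [u] are dominated by those of a bounded monotone
    sequence. It serves an iteration that is not a strict contraction. *)
Lemma cauchy_nrm (u : nat -> V) (r : nat -> R) (b : R) :
  (forall n, nrm (u n.+1 - u n) <= r n.+1 - r n) -> (forall n, r n <= b) ->
  exists l, forall e : R, 0 < e ->
    exists N, forall n, (N <= n)%N -> nrm (l - u n) < e.
Proof.
move=> ur rb.
have rS n : r n <= r n.+1 by rewrite -subr_ge0; apply: le_trans (ur n); exact: nrm_ge0.
have umn n m : nrm (u (n + m)%N - u n) <= r (n + m)%N - r n.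
  elim: m => [|m ih]; first by rewrite addn0 !subrr nrm0.
  apply: le_trans (nrm_tri _ (u (n + m)%N) _) _.
  rewrite addnS; have := ur (n + m)%N; lra.
have rnd : nondecreasing_seq r by apply/nondecreasing_seqP.
have rub : has_ubound (range r) by exists b => _ [n _ <-].
have rcv := nondecreasing_cvgn rnd rub.
set s := sup _ in rcv.
have rs n : r n <= s by apply: ub_le_sup => //; exists n.
have r_close (e : R) : 0 < e -> exists N, s - r N < e.
  move=> e0; have := @sup_adherent _ (range r) e e0.
  case; first by split => //; exists (r 0%N); exists 0%N.
  by move=> _ [N _ <-]; exists N; rewrite ltrBlDr addrC -ltrBlDr.
have cu : cauchy (u @ \oo).
  apply/cauchyP => /= e e0.
  have e0' : 0 < complex.Re e by move: e0; rewrite ltcE => /andP[].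
  have [N sN] := r_close _ e0'.
  exists (u N); exists N => //= n /= Nn.
  rewrite -ball_normE /= nrmE ltcE /=; apply/andP; split.
    by move: e0; rewrite ltcE => /andP[].
  rewrite nrmBC -(subnKC Nn); apply: le_lt_trans (umn _ _) _.
  by apply: le_lt_trans sN; rewrite lerD2r.
have /cauchy_cvgP cvu := cu.
exists (lim (u @ \oo)) => e e0.
have : nbhs (lim (u @ \oo)) [set y | nrm (lim (u @ \oo) - y) < e].
  by apply/nbhs_nrm; exists e.
by move=> /cvu [N _ h]; exists N.
Qed.

End Complete.

Section CStarBasics.
Variables (R : realType) (T : cstarType R).
Implicit Types (x y z : T) (a : R[i]).

Lemma scAl a x y : (a *: x) * y = a *: (x * y).
Proof. by rewrite [RHS]cscalerAl. Qed.

Lemma scAr a x y : x * (a *: y) = a *: (x * y).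
Proof. by rewrite [RHS]cscalerAr. Qed.

Lemma starD x y : cstar (x + y) = cstar x + cstar y.
Proof. by rewrite -{1}[x]scale1r cstar_linear rmorph1 scale1r. Qed.

Lemma star0 : cstar (0 : T) = 0.
Proof. by apply: (@addrI _ (cstar 0)); rewrite -starD !addr0. Qed.

Lemma starZ a x : cstar (a *: x) = Num.conj a *: cstar x.
Proof. by rewrite -[a *: x]addr0 cstar_linear star0 addr0. Qed.

Lemma starN x : cstar (- x) = - cstar x.
Proof. by rewrite -scaleN1r starZ rmorphN rmorph1 scaleN1r. Qed.

Lemma starB x y : cstar (x - y) = cstar x - cstar y.
Proof. by rewrite starD starN. Qed.

Lemma starM x y : cstar (x * y) = cstar y * cstar x.
Proof. exact: cstarM. Qed.

Lemma starK x : cstar (cstar x) = x.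
Proof. exact: cstarK. Qed.

Lemma star1 : cstar (1 : T) = 1.
Proof. by rewrite -[LHS]mulr1 -[X in _ * X]starK -starM mulr1 starK. Qed.

Lemma star_sum (I : Type) (r : seq I) (P : pred I) (F : I -> T) :
  cstar (\sum_(i <- r | P i) F i) = \sum_(i <- r | P i) cstar (F i).
Proof.
by elim/big_rec2: _ => [|i y x _ <-]; rewrite ?star0 ?starD.
Qed.

Lemma nrmM x y : nrm (x * y) <= nrm x * nrm y.
Proof. by rewrite -lecR rmorphM /= -!nrmE; exact: cnorm_mul. Qed.

Lemma nrm_starM x : nrm (cstar x * x) = nrm x ^+ 2.
Proof. by apply: complexI; rewrite rmorphXn /= -!nrmE; exact: cnorm_star. Qed.

Lemma nrm_star x : nrm (cstar x) = nrm x.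
Proof.
suff le y : nrm y <= nrm (cstar y).
  by apply/eqP; rewrite eq_le le andbT -{2}[x]starK le.
have := nrmM (cstar y) y; rewrite nrm_starM expr2 => h.
have := nrm_ge0 y; rewrite le_eqVlt => /orP[/eqP <-|y0]; first exact: nrm_ge0.
by move: h; rewrite ler_pM2r.
Qed.

Lemma nrm1_le1 : nrm (1 : T) <= 1.
Proof.
have := nrm_starM 1; rewrite star1 mulr1 => h.
have := nrm_ge0 (1 : T); nra.
Qed.

Lemma nrm_isometry (u : T) : cstar u * u = 1 -> nrm u <= 1.
Proof.
move=> uu; have := nrm_starM u; rewrite uu => h.
have := nrm1_le1; have := nrm_ge0 u; nra.
Qed.

Lemma nrm_proj (p : T) : cstar p = p -> p * p = p -> nrm p <= 1.
Proof. by move=> sp pp; have := nrm_starM p; rewrite sp pp; have := nrm_ge0 p; nra. Qed.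

Lemma nrm_partial (v p : T) : cstar p = p -> p * p = p -> cstar v * v = p -> nrm v <= 1.
Proof.
move=> sp pp vv; have := nrm_starM v; rewrite vv.
by have := nrm_proj sp pp; have := nrm_ge0 v; nra.
Qed.

Lemma closedZ (S : set T) a x : closed_subspace S -> S x -> S (a *: x).
Proof. by move=> [_ S0 SL] Sx; rewrite -[_ *: _]addr0; exact: SL. Qed.

Lemma closedD (S : set T) x y : closed_subspace S -> S x -> S y -> S (x + y).
Proof. by move=> [_ S0 SL] Sx Sy; rewrite -[x]scale1r; exact: SL. Qed.

Lemma halves : 2^-1 + 2^-1 = 1 :> R[i].
Proof. by rewrite -mulr2n -[_ *+ 2]mulr_natr mulVf ?pnatr_eq0. Qed.

Lemma Re_norm_half : complex.Re `|2^-1 : R[i]| = 2^-1.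
Proof. by rewrite normfV normr_nat -(rmorph_nat (real_complex R)) -fmorphV. Qed.

(** A fixed point of [y |-> (x + y ^ 2) / 2] satisfies [(1 - y) ^ 2 = 1 - x]. On the unit ball this
    map is only Lipschitz with constant 1, so convergence is read off the scalar majorant
    [s |-> (1 + s ^ 2) / 2], whose iterates from 0 increase and stay below 1. *)
Lemma sqrt_iter (S : set T) x : closed S -> S 0 ->
  (forall y, S y -> S (2^-1 *: (x + y * y))) -> nrm x <= 1 ->
  exists y, [/\ S y, nrm y <= 1 & x = y + y - y * y].
Proof.
move=> /closedE Scl S0 SI x1.
pose F y := 2^-1 *: (x + y * y).
pose f (s : R) := 2^-1 * (1 + s * s).
pose u n := iter n F 0; pose r n := iter n f 0.
have half := Re_norm_half.
have nF y z : nrm (F y - F z) <= 2^-1 * (nrm (y - z) * (nrm y + nrm z)).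
  rewrite /F -scalerBr nrmZ half ler_pM2l ?invr_gt0//.
  have -> : x + y * y - (x + z * z) = y * (y - z) + (y - z) * z.
    by rewrite mulrBr mulrBl addrA subrK opprD addrACA subrr add0r.
  apply: le_trans (nrmD _ _) _.
  have := nrmM y (y - z); have := nrmM (y - z) z; lra.
have r0 n : 0 <= r n <= 1.
  by elim: n => [|n /andP[h1 h2]] /=; rewrite /f; apply/andP; split; nra.
have ur n : nrm (u n) <= r n.
  elim: n => [|n ih]; first by rewrite nrm0.
  rewrite /= /F nrmZ half; apply: ler_wpM2l; first lra.
  apply: le_trans (nrmD _ _) _; have := nrmM (u n) (u n).
  have := nrm_ge0 (u n); move: ih (r0 n) => /=; rewrite -/(u n) -/(r n); nra.
have uS n : nrm (u n.+1 - u n) <= r n.+1 - r n.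
  elim: n => [|n ih].
    by rewrite subr0 /r /= subr0; exact: (ur 1%N).
  apply: le_trans (nF _ _) _.
  have -> : r n.+2 - r n.+1 = 2^-1 * ((r n.+1 - r n) * (r n.+1 + r n)).
    rewrite /r /= /f; ring.
  rewrite ler_pM2l ?invr_gt0//; apply: ler_pM => //; first exact: nrm_ge0.
    by apply: addr_ge0; exact: nrm_ge0.
  by apply: lerD; [exact: (ur n.+1)|exact: (ur n)].
have [] := @cauchy_nrm _ _ u r 1 uS; first by move=> n; case/andP: (r0 n).
move=> y yl; exists y.
have Su n : S (u n) by elim: n => //= n; exact: SI.
have y1 : nrm y <= 1.
  apply/ler_addgt0Pr => e /yl[n /(_ n (leqnn n)) h].
  have := nrm_tri y (u n) 0; rewrite !subr0 => h1.
  have := ur n; have := r0 n; lra.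
split => //; first by apply: Scl => e /yl[n /(_ n (leqnn n))]; exists (u n).
suff: y = F y.
  move=> /(congr1 (fun z => z + z)); rewrite /F -scalerDl halves scale1r => ->.
  by rewrite addrK.
apply/eqP; rewrite -subr_eq0; apply/eqP/nrm_eq0/eqP.
rewrite eq_le nrm_ge0 andbT; apply/ler_addgt0Pr => e e0; rewrite add0r.
have [|n h] := yl (e / 2%:R); first by lra.
have h1 := h n (leqnn n); have h2 := h n.+1 (leqnSn n).
apply: le_trans (nrm_tri _ (u n.+1) _) _.
have := nF (u n) y; have := ur n; have := r0 n; rewrite (nrmBC (u n)).
have := nrm_ge0 (y - u n).
rewrite -/(u n.+1). nra.
Qed.

Lemma closed_star_eq : closed [set y : T | cstar y = y].
Proof.
apply/closedE => x h; apply/eqP; rewrite -subr_eq0; apply/eqP/nrm_eq0/eqP.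
rewrite eq_le nrm_ge0 andbT; apply/ler_addgt0Pr => e e0; rewrite add0r.
have [|y /= ys xy] := h (e / 2%:R); first lra.
apply: le_trans (nrm_tri _ y _) _.
by rewrite -{1}ys -starB nrm_star (nrmBC y); lra.
Qed.

Lemma closed_comm t : closed_subspace [set y : T | t * y = y * t].
Proof.
split; last first.
- by move=> a x y /= hx hy; rewrite mulrDr mulrDl scAl scAr hx hy.
- by rewrite /= mulr0 mul0r.
apply/closedE => x h; apply/eqP; rewrite -subr_eq0; apply/eqP/nrm_eq0/eqP.
rewrite eq_le nrm_ge0 andbT; apply/ler_addgt0Pr => e e0; rewrite add0r.
have t0 := nrm_ge0 t.
have [|y /= ys xy] := h (e / (2%:R * (nrm t + 1))).
  by apply: divr_gt0 => //; apply: mulr_gt0 => //; lra.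
have -> : t * x - x * t = t * (x - y) - (x - y) * t.
  by rewrite mulrBr mulrBl ys opprB addrA subrK.
apply: le_trans (nrmB _ _) _.
have h1 := nrmM t (x - y); have h2 := nrmM (x - y) t.
move: xy; rewrite ltr_pdivlMr; last by apply: mulr_gt0 => //; lra.
have := nrm_ge0 (x - y); nra.
Qed.

Lemma closed_subspaceI (V : normedModType R[i]) (S1 S2 : set V) :
  closed_subspace S1 -> closed_subspace S2 -> closed_subspace (S1 `&` S2).
Proof.
move=> [c1 z1 l1] [c2 z2 l2]; split; first exact: closedI.
  by split.
by move=> a x y [] x1 x2 [y1 y2]; split; [apply: l1|apply: l2].
Qed.

(* With [b = 1 - y], this reads [b ^+ 2 = 1 - x]. *)
Lemma sa_sqrt (S : set T) x : closed_subspace S ->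
  (forall y z, S y -> S z -> S (y * z)) -> S x -> cstar x = x -> nrm x <= 1 ->
  exists y, [/\ S y, cstar y = y, nrm y <= 1 & x = y + y - y * y].
Proof.
move=> Scl SM Sx xs x1; have [clS S0 SL] := Scl.
have [||||y [[Sy ys] y1 xy]] := @sqrt_iter (S `&` [set y | cstar y = y]) x.
- by apply: closedI => //; exact: closed_star_eq.
- by split=> //=; rewrite star0.
- move=> y [Sy /= ys]; split.
    by apply: closedZ => //; apply: closedD => //; apply: SM.
  rewrite /= starZ starD starM xs ys; congr (_ *: _).
  by rewrite fmorphV rmorph_nat.
- by [].
- by exists y.
Qed.

(** The square root is taken inside the commutant of [a], so that it commutes with [a]. Then
    [a + i b] is an isometry with imaginary part [b], which bounds the norm of [b]. *)
Lemma sa_complement (S : set T) (a : T) : closed_subspace S ->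
  (forall y z, S y -> S z -> S (y * z)) -> S 1 -> S a -> cstar a = a ->
  nrm a <= 1 ->
  exists b, [/\ S b, cstar b = b, b * b = 1 - a * a, a * b = b * a & nrm b <= 1].
Proof.
move=> Scl SM S1 Sa sa a1.
pose S' := S `&` [set y : T | a * y = y * a].
have [|||||y [[Sy /= cy] sy y1 ay]] := @sa_sqrt S' (a * a).
- by apply: closed_subspaceI => //; exact: closed_comm.
- move=> y z [Sy /= cy] [Sz /= cz]; split; first exact: SM.
  by rewrite /= mulrA cy -mulrA cz mulrA.
- by split; [apply: SM|rewrite /= mulrA].
- by rewrite starM sa.
- apply: le_trans (nrmM _ _) _; have := nrm_ge0 a; nra.
have [_ S0 SL] := Scl.
pose b := 1 - y; have sb : cstar b = b by rewrite starB star1 sy.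
have bb : b * b = 1 - a * a by rewrite ay /b; ncring.
have ab : a * b = b * a by rewrite mulrBr mulrBl mulr1 mul1r cy.
have Sb : S b.
  by rewrite /b -[1 - y]addrC -scaleN1r; apply: SL.
exists b; split => //.
pose c : T := 'i%C *: b.
have cc : c * c = - (b * b).
  by rewrite /c scAl scAr scalerA -expr2 sqr_i scaleN1r.
have ac : a * c = c * a by rewrite /c scAl scAr ab.
have sc : cstar c = - c.
  by rewrite starZ sb -scaleNr; congr (_ *: _); rewrite complexiE conjCi.
have se : cstar (a + c) = a - c by rewrite starD sa sc.
have ee : cstar (a + c) * (a + c) = 1.
  rewrite se; transitivity (a * a - c * c + (a * c - c * a)); first by ncring.
  by rewrite ac subrr addr0 cc bb; ncring.
have e1 := nrm_isometry ee.
have -> : nrm b = nrm c.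
  by rewrite /c nrmZ complexiE normCi /= mul1r.
have -> : c = 2^-1 *: ((a + c) - cstar (a + c)).
  rewrite se; have -> : a + c - (a - c) = c + c by ncring.
  by rewrite scalerDr -scalerDl halves scale1r.
rewrite nrmZ Re_norm_half; have := nrmB (a + c) (cstar (a + c)).
rewrite nrm_star; lra.
Qed.

(** Here [d] stands for the square root of the absolute value of [a]. It comes from three nested
    square roots: [b ^ 2 = 1 - a ^ 2], then [(1 - y) ^ 2 = 1 - b ^ 2], then [(1 - d') ^ 2 = 1 - y].
    Writing the absolute value as [d * d] with [d] self-adjoint records its positivity
    algebraically. *)
Lemma sa_abs (S : set T) (a : T) : closed_subspace S ->
  (forall y z, S y -> S z -> S (y * z)) -> S 1 -> S a -> cstar a = a ->
  nrm a <= 1 ->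
  exists d, [/\ S d, cstar d = d, d * d * (d * d) = a * a & a * d = d * a].
Proof.
move=> Scl SM S1 Sa sa a1.
pose S' := S `&` [set y : T | a * y = y * a].
have S'cl : closed_subspace S' by apply: closed_subspaceI => //; exact: closed_comm.
have S'M y z : S' y -> S' z -> S' (y * z).
  move=> [Sy /= cy] [Sz /= cz]; split; first exact: SM.
  by rewrite /= mulrA cy -mulrA cz mulrA.
have S'1 : S' 1 by split => //=; rewrite mulr1 mul1r.
have S'a : S' a by split.
have [b [S'b sb bb ab b1]] := sa_complement S'cl S'M S'1 S'a sa a1.
have S'bb : S' (b * b) by exact: S'M.
have sbb : cstar (b * b) = b * b by rewrite starM sb.
have bb1 : nrm (b * b) <= 1.
  by apply: le_trans (nrmM _ _) _; have := nrm_ge0 b; nra.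
have [y [S'y sy y1 by_]] := sa_sqrt S'cl S'M S'bb sbb bb1.
have [d' [S'd' sd' d'1 yd']] := sa_sqrt S'cl S'M S'y sy y1.
have [Sd /= ad] : S' (1 - d').
  by rewrite addrC -scaleN1r; case: S'cl => _ _; apply.
exists (1 - d'); split => //; first by rewrite starB star1 sd'.
have -> : (1 - d') * (1 - d') = 1 - y by rewrite yd'; ncring.
have -> : (1 - y) * (1 - y) = 1 - b * b by rewrite by_; ncring.
by rewrite bb; ncring.
Qed.

End CStarBasics.

(** A self-adjoint contraction [a] is the real part of the unitary [a + i b], where
    [b ^ 2 = 1 - a ^ 2], and [f] carries this unitary to an isometry. The C*-identity reduces the
    general case to this one. *)
Lemma star_hom_contract (R : realType) (A B : cstarType R) (f : A -> B) :
  unital_star_hom f -> forall x, nrm (f x) <= nrm x.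
Proof.
move=> [flin [f1 fM] fstar].
have fD x y : f (x + y) = f x + f y by rewrite -[x]scale1r flin !scale1r.
have f0 : f 0 = 0 by apply: (@addrI _ (f 0)); rewrite -fD !addr0.
have fZ a x : f (a *: x) = a *: f x by rewrite -[a *: x]addr0 flin f0 addr0.
have fsa a : cstar a = a -> nrm a <= 1 -> nrm (f a) <= 1.
  move=> sa a1.
  have clT : closed_subspace [set: A] by split.
  have [b [_ sb bb ab _]] := sa_complement clT (fun _ _ _ _ => I) I I sa a1.
  have sfa : cstar (f a) = f a by rewrite -fstar sa.
  have sfb : cstar (f b) = f b by rewrite -fstar sb.
  have : f a * f a + f b * f b = 1.
    by rewrite -!fM bb -fD addrC subrK f1.
  have := fM a b; rewrite ab fM => fab fabs.
  pose c : B := 'i%C *: f b.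
  have cc : c * c = - (f b * f b).
    by rewrite /c scAl scAr scalerA -expr2 sqr_i scaleN1r.
  have ac : f a * c = c * f a by rewrite /c scAl scAr fab.
  have sc : cstar c = - c.
    by rewrite starZ sfb -scaleNr; congr (_ *: _); rewrite complexiE conjCi.
  have se : cstar (f a + c) = f a - c by rewrite starD sfa sc.
  have ee : cstar (f a + c) * (f a + c) = 1.
    rewrite se; transitivity (f a * f a - c * c + (f a * c - c * f a)).
      by ncring.
    by rewrite ac subrr addr0 cc opprK.
  have e1 := nrm_isometry ee.
  have -> : f a = 2^-1 *: ((f a + c) + cstar (f a + c)).
    rewrite se; have -> : f a + c + (f a - c) = f a + f a by ncring.
    by rewrite scalerDr -scalerDl halves scale1r.
  rewrite nrmZ Re_norm_half; have := nrmD (f a + c) (cstar (f a + c)).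
  rewrite nrm_star; lra.
move=> x.
have := nrm_ge0 x; rewrite le_eqVlt => /orP[/eqP/esym/nrm_eq0 ->|x0].
  by rewrite f0 !nrm0.
pose a := (nrm x)^-1%:C *: x.
have na : nrm a = 1.
  rewrite nrmZ ger0_norm ?lecR ?invr_ge0 ?nrm_ge0//= mulVf//.
  by rewrite gt_eqF.
have aa1 : nrm (cstar a * a) <= 1 by rewrite nrm_starM na expr1n.
have := fsa (cstar a * a); rewrite starM starK => /(_ erefl aa1).
rewrite fM fstar nrm_starM => h.
have : nrm (f a) <= 1 by have := nrm_ge0 (f a); nra.
rewrite /a fZ nrmZ ger0_norm ?lecR ?invr_ge0 ?nrm_ge0//=.
by rewrite mulrC ler_pdivrMr// mul1r.
Qed.

Section HilbertBasics.
Variables (R : realType) (H : hilbertType R).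
Implicit Types x y : H.

Definition rdot x y : R := complex.Re (dotp x y).

Lemma ReD (a b : R[i]) : complex.Re (a + b) = complex.Re a + complex.Re b.
Proof. by case: a => a1 a2; case: b. Qed.

Lemma rdotDl x y z : rdot (x + y) z = rdot x z + rdot y z.
Proof. by rewrite /rdot linearDl ReD. Qed.

Lemma rdotDr x y z : rdot z (x + y) = rdot z x + rdot z y.
Proof. by rewrite /rdot linearDr ReD. Qed.

Lemma rdotNl x z : rdot (- x) z = - rdot x z.
Proof. by apply/eqP; rewrite -addr_eq0 -rdotDl addNr /rdot linear0l. Qed.

Lemma rdotNr x z : rdot z (- x) = - rdot z x.
Proof. by apply/eqP; rewrite -addr_eq0 -rdotDr addNr /rdot linear0r. Qed.

Lemma rdotZl (k : R) x z : rdot (k%:C *: x) z = k * rdot x z.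
Proof.
rewrite /rdot linearZl_LR /=; case: (dotp x z) => a b /=.
by rewrite mul0r subr0.
Qed.

Lemma rdot0r z : rdot z 0 = 0.
Proof. by rewrite /rdot linear0r. Qed.

Lemma rdot_nrm x : rdot x x = nrm x ^+ 2.
Proof. by rewrite /rdot -dotp_norm nrmE -rmorphXn. Qed.

End HilbertBasics.

Section Irreducible.
Variables (R : realType) (T : cstarType R) (S : set T).
Hypothesis Salg : cstar_subalgebra S.
Variables (H : hilbertType R) (pi : T -> H -> H).
Hypothesis pi_irr : irreducible_representation S pi.

Let Scl : closed_subspace S. Proof. by case: Salg. Qed.
Let SM x y : S x -> S y -> S (x * y). Proof. by case: Salg => _ h _; exact: h. Qed.
Let Sstar x : S x -> S (cstar x). Proof. by case: Salg => _ _; exact. Qed.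
Let S0 : S 0. Proof. by case: Scl. Qed.
Let SZ k x : S x -> S (k *: x). Proof. by move=> ?; exact: closedZ. Qed.
Let SD x y : S x -> S y -> S (x + y). Proof. by move=> ? ?; exact: closedD. Qed.
Let SN x : S x -> S (- x). Proof. by move=> ?; rewrite -scaleN1r; exact: SZ. Qed.

Lemma repD a b x : S a -> S b -> pi (a + b) x = pi a x + pi b x.
Proof.
move=> Sa Sb; case: pi_irr => [[_ lin _ _] _ _].
by rewrite -[a]scale1r lin// !scale1r.
Qed.

Lemma rep0 x : pi 0 x = 0.
Proof. by apply: (@addrI _ (pi 0 x)); rewrite -repD// !addr0. Qed.

Lemma repZ k a x : S a -> pi (k *: a) x = k *: pi a x.
Proof.
move=> Sa; case: pi_irr => [[_ lin _ _] _ _].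
by rewrite -[k *: a]addr0 lin// rep0 addr0.
Qed.

Lemma repN a x : S a -> pi (- a) x = - pi a x.
Proof. by move=> Sa; rewrite -scaleN1r repZ// scaleN1r. Qed.

Lemma repM a b x : S a -> S b -> pi (a * b) x = pi a (pi b x).
Proof. by move=> Sa Sb; case: pi_irr => [[_ _ h _] _ _]; exact: h. Qed.

Lemma rep_sum n (F : 'I_n -> T) x : (forall i, S (F i)) ->
  S (\sum_i F i) /\ pi (\sum_i F i) x = \sum_i pi (F i) x.
Proof.
move=> SF; elim: n F SF => [|n ih] F SF; first by rewrite !big_ord0 rep0.
rewrite !big_ord_recl; have [h1 h2] := ih _ (fun i => SF (lift ord0 i)).
by split; [apply: SD|rewrite repD// h2].
Qed.

Lemma rep_addr a x y : S a -> pi a (x + y) = pi a x + pi a y.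
Proof.
move=> Sa; case: pi_irr => [[/(_ a Sa)[lin _] _ _ _] _ _].
by rewrite -[x]scale1r lin !scale1r.
Qed.

Lemma rep_scale a k x : S a -> pi a (k *: x) = k *: pi a x.
Proof.
move=> Sa; case: pi_irr => [[/(_ a Sa)[lin _] _ _ _] _ _].
have p0 : pi a 0 = 0 by apply: (@addrI _ (pi a 0)); rewrite -rep_addr// !addr0.
by rewrite -[k *: x]addr0 lin p0 addr0.
Qed.

Lemma rep_adj a x y : S a -> rdot (pi a x) y = rdot x (pi (cstar a) y).
Proof. by move=> Sa; case: pi_irr => [[_ _ _ h] _ _]; rewrite /rdot h. Qed.

(** For [y] with [(1 - y) ^ 2 = 1 - cstar a * a], the squared norm of [x - pi y x] is the difference
    of the squared norms of [x] and [pi a x]. Only [y] is put under [pi], since [S] may have no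
    unit. *)
Lemma rep_contract1 a x : S a -> nrm a <= 1 -> nrm (pi a x) <= nrm x.
Proof.
move=> Sa a1.
have [|||y [Sy sy y1 ay]] := @sa_sqrt _ _ S (cstar a * a) Scl SM.
- by apply: SM => //; exact: Sstar.
- by rewrite starM starK.
- by rewrite nrm_starM; have := nrm_ge0 a; nra.
have := rdot_nrm (x - pi y x).
rewrite rdotDl !rdotDr !rdotNl !rdotNr rdot_nrm.
rewrite [X in _ = X -> _]/= !rep_adj// sy -repM//.
have := rdot_nrm (pi a x); rewrite rep_adj// -repM//; last exact: Sstar.
rewrite ay repD//; last by apply/SN/SM.
  rewrite repD// repN//; last exact: SM.
  rewrite !rdotDr rdotNr => h1 h2.
  have := nrm_ge0 (pi a x); have := nrm_ge0 x.
  have := sqr_ge0 (nrm (x - pi y x)); nra.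
exact: SD.
Qed.

Lemma rep_contract a x : S a -> nrm (pi a x) <= nrm a * nrm x.
Proof.
move=> Sa; have := nrm_ge0 a; rewrite le_eqVlt => /orP[/eqP/esym/nrm_eq0 ->|a0].
  by rewrite rep0 !nrm0 mul0r.
have := @rep_contract1 ((nrm a)^-1%:C *: a) x (SZ _ Sa).
rewrite repZ// !nrmZ ger0_norm ?lecR ?invr_ge0 ?nrm_ge0//=.
rewrite mulVf ?gt_eqF// => /(_ (lexx _)).
by rewrite mulrC ler_pdivrMr// mulrC.
Qed.

Lemma closed_rep_ker (P : T -> Prop) : (forall a, P a -> S a) ->
  closed_subspace [set x | forall a, P a -> pi a x = 0].
Proof.
move=> PS; split.
- apply/closedE => x h a Pa; apply/nrm_eq0/eqP; rewrite eq_le nrm_ge0 andbT.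
  apply/ler_addgt0Pr => e e0; rewrite add0r.
  have a0 := nrm_ge0 a.
  have [|y /= hy xy] := h (e / (nrm a + 1)); first by apply: divr_gt0; lra.
  have Sa := PS a Pa.
  have -> : pi a x = pi a (x - y).
    by rewrite rep_addr// -scaleN1r rep_scale// hy// scaler0 addr0.
  apply: le_trans (rep_contract _ Sa) _.
  by move: xy; rewrite ltr_pdivlMr; [have := nrm_ge0 (x - y); nra|lra].
- by move=> a Pa; have := rep_scale 0 0 (PS a Pa); rewrite !scale0r.
- move=> k x y /= hx hy a Pa; have Sa := PS a Pa.
  by rewrite rep_addr// rep_scale// hx// hy// scaler0 addr0.
Qed.

(** Kernels of irreducible representations are prime ideals: the vectors killed by all [pi (a * s)]
    form a closed invariant subspace that contains the range of [pi b]. *)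
Lemma rep_prime a b : S a -> S b -> (forall s, S s -> a * s * b = 0) ->
  (forall x, pi a x = 0) \/ (forall x, pi b x = 0).
Proof.
move=> Sa Sb asb.
pose W := [set x | forall c, (exists2 s, S s & c = a * s) -> pi c x = 0].
have Wcl : closed_subspace W.
  by apply: closed_rep_ker => c [s Ss ->]; exact: SM.
case: (pi_irr) => _ _ /(_ W Wcl)[].
- move=> t x St Wx c [s Ss ->]; rewrite -repM//; last exact: SM.
  by rewrite -mulrA; apply: Wx; exists (s * t) => //; exact: SM.
- move=> W0; right => x; have : W (pi b x).
    by move=> c [s Ss ->]; rewrite -repM ?asb ?rep0//; exact: SM.
  by rewrite W0.
- move=> WT; left => x.
  have Wall y : W y by rewrite WT.
  (* Without a unit in [S], [a] itself need not be of the form [a * s]. It is reached from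
     [a * cstar a], by way of its adjoint. *)
  have ss0 y : pi (cstar a) y = 0.
    apply/nrm_eq0/eqP; rewrite -sqrf_eq0 -rdot_nrm rep_adj; last exact: Sstar.
    rewrite starK -repM//; last exact: Sstar.
    by rewrite (Wall y) ?rdot0r//; exists (cstar a) => //; exact: Sstar.
  apply/nrm_eq0/eqP; rewrite -sqrf_eq0 -rdot_nrm rep_adj// -repM//; last exact: Sstar.
  by rewrite repM// ?ss0 ?rdot0r//; exact: Sstar.
Qed.

(** Taken in the ambient algebra and not in [S], so that 1 is included and [z - l] is again of this
    kind even when [S] has no unit. *)
Definition central_multiplier (z : T) := forall s, S s -> S (z * s) /\ z * s = s * z.

Lemma central_closed : closed_subspace central_multiplier.
Proof.
split.
- apply/closedE => x h s Ss; split.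
    have [/closedE clS _ _] := Scl; apply: clS => e e0.
    have s0 := nrm_ge0 s.
    have [|y hy xy] := h (e / (nrm s + 1)); first by apply: divr_gt0; lra.
    exists (y * s); first by case: (hy s Ss).
    rewrite -mulrBl; apply: le_lt_trans (nrmM _ _) _.
    by move: xy; rewrite ltr_pdivlMr; [have := nrm_ge0 (x - y); nra|lra].
  apply/esym; have [/closedE cl _ _] := closed_comm s; apply: cl => e /h[y hy xy].
  by exists y => //=; case: (hy s Ss).
- by move=> s Ss; rewrite mul0r mulr0.
- move=> k x y hx hy s Ss; have [x1 x2] := hx s Ss; have [y1 y2] := hy s Ss.
  by rewrite mulrDl mulrDr scAl scAr x2 y2; split=> //; rewrite -x2 -y2; apply: SD => //; exact: SZ.
Qed.

Lemma centralM (y z : T) : central_multiplier y -> central_multiplier z ->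
  central_multiplier (y * z).
Proof.
move=> hy hz s Ss; have [h1 h2] := hz s Ss; have [h3 h4] := hy _ h1.
split; first by rewrite -mulrA.
by rewrite -mulrA h2 mulrA; have [_ ->] := hy s Ss; rewrite mulrA.
Qed.

Lemma central1 : central_multiplier 1.
Proof. by move=> s Ss; rewrite mul1r mulr1. Qed.

Lemma central_prime (z w : T) : central_multiplier z -> central_multiplier w ->
  w * z = 0 ->
  (forall s x, S s -> pi (w * s) x = 0) \/ (forall s x, S s -> pi (z * s) x = 0).
Proof.
move=> hz hw wz.
have [h|/existsNP[s /existsNP[x /not_implyP[Ss nz]]]] :=
  pselect (forall s x, S s -> pi (z * s) x = 0); [by right|left].
move=> t y St; have [zs _] := hz s Ss; have [wt wtc] := hw t St.
case: (rep_prime wt zs) => [r Sr|->//|/(_ x)//].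
have [_ zr] := hz (t * r) (SM St Sr).
by rewrite -!mulrA [t * _]mulrA [t * r * _]mulrA -zr -mulrA !mulrA wz !mul0r.
Qed.

(** With [d * d] the absolute value of the normalized [a'], the elements [d * d - a'] and
    [d * d + a'] have product zero, so by primeness one of them acts as zero and [a] acts with a
    definite sign. Sign and norm are absorbed in [k]. *)
Lemma central_sign (a : T) : central_multiplier a -> cstar a = a ->
  exists (d : T) (k : R), [/\ central_multiplier d, cstar d = d &
    (forall s x, S s -> pi (a * s) x = k%:C *: pi (d * d * s) x)] /\ k != 0.
Proof.
move=> ha sa; have := nrm_ge0 a; rewrite le_eqVlt => /orP[/eqP/esym/nrm_eq0 ->|a0].
  exists 0, 1; split; last by rewrite oner_eq0.
  split; rewrite ?star0//; first by case: central_closed.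
  by move=> s x Ss; rewrite !mul0r rep0 scaler0.
pose a' := (nrm a)^-1%:C *: a.
have na' : nrm a' <= 1.
  by rewrite nrmZ ger0_norm ?lecR ?invr_ge0 ?nrm_ge0//= mulVf ?gt_eqF.
have sa' : cstar a' = a'.
  by rewrite starZ sa; congr (_ *: _); apply/CrealP; rewrite complex_real.
have ha' : central_multiplier a' by exact: (closedZ _ central_closed ha).
have [d [hd sd dd ad]] := sa_abs central_closed centralM central1 ha' sa' na'.
have hdd := centralM hd hd.
have aE s x : S s -> pi (a * s) x = (nrm a)%:C *: pi (a' * s) x.
  move=> Ss; rewrite -repZ; last by case: (ha' s Ss).
  by rewrite scAl scalerA -rmorphM mulfV ?gt_eqF// scale1r.
have hN z : central_multiplier z -> central_multiplier (- z).
  by move=> hz; rewrite -scaleN1r; exact: (closedZ _ central_closed hz).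
have h1 : central_multiplier (d * d - a').
  exact: (closedD central_closed hdd (hN _ ha')).
have h2 : central_multiplier (d * d + a').
  exact: (closedD central_closed hdd ha').
have /(central_prime h1 h2) : (d * d + a') * (d * d - a') = 0.
  transitivity (d * d * (d * d) - a' * a' + (a' * (d * d) - d * d * a')).
    by ncring.
  by rewrite dd subrr add0r mulrA ad -mulrA ad mulrA subrr.
case=> h; [exists d, (- nrm a)|exists d, (nrm a)]; split;
    rewrite ?oppr_eq0 ?gt_eqF//; split=> // s x Ss; rewrite aE//.
  rewrite rmorphN scaleNr -scalerN; congr (_ *: _); apply/eqP.
  rewrite -subr_eq0 opprK -repD; [|by case: (ha' s Ss)|by case: (hdd s Ss)].
  by rewrite addrC -mulrDl h.
congr (_ *: _); apply/eqP; rewrite eq_sym -subr_eq0 -repN; last by case: (ha' s Ss).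
rewrite -repD; [|by case: (hdd s Ss)|by apply: SN; case: (ha' s Ss)].
by rewrite -mulrBl h.
Qed.

(** Schur's lemma without spectral theory. Each [z - l] with [l] real acts with a definite sign, so
    every [l] is a lower or an upper bound of the quadratic form of [z]. At the supremum of the
    lower bounds the form of [z - l] vanishes, and a form with a sign vanishes only if the operator
    does. *)
Lemma central_scalar (z : T) : central_multiplier z -> cstar z = z ->
  exists l : R, forall s x, S s -> pi (z * s) x = l%:C *: pi s x.
Proof.
move=> hz sz.
pose q (s : T) x := rdot (pi (z * s) x) (pi s x).
pose n (s : T) x := nrm (pi s x) ^+ 2.
have n0 s x : 0 <= n s x by exact: sqr_ge0.
have qn s x : n s x = 0 -> q s x = 0.
  by move=> /eqP; rewrite sqrf_eq0 => /eqP/nrm_eq0 h; rewrite /q h rdot0r.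
have sgn (l : R) : exists (d : T) (k : R), [/\ k != 0, central_multiplier d,
    forall s x, S s -> pi (z * s) x - l%:C *: pi s x = k%:C *: pi (d * (d * s)) x &
    forall s x, S s -> q s x - l * n s x = k * nrm (pi (d * s) x) ^+ 2].
  have hl : central_multiplier (z - l%:C *: (1 : T)).
    rewrite addrC -scaleNr; case: central_closed => _ _; apply => //.
    exact: central1.
  have [|d [k [[hd sd hdk] k0]]] := central_sign hl.
    rewrite starB starZ star1 sz; congr (_ - _ *: _).
    by apply/CrealP; rewrite complex_real.
  have hE s x : S s -> pi (z * s) x - l%:C *: pi s x = k%:C *: pi (d * (d * s)) x.
    move=> Ss; have [zs _] := hz s Ss.
    rewrite mulrA -hdk// mulrBl scAl mul1r repD//; last exact/SN/SZ.
    by rewrite repN ?repZ//; exact: SZ.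
  exists d, k; split => // s x Ss.
  have [ds _] := hd s Ss; have [dds _] := hd _ ds.
  have /(congr1 (fun y => rdot y (pi s x))) := hE s x Ss.
  rewrite rdotDl rdotNl !rdotZl rdot_nrm -/(q s x) -/(n s x) => ->.
  congr (_ * _); rewrite -rdot_nrm !rep_adj// -!repM//; [|exact: Sstar..].
  by rewrite !starM sd !mulrA.
pose P := [set l : R | forall s x, S s -> l * n s x <= q s x].
have PN l : ~ P l -> forall s x, S s -> q s x <= l * n s x.
  move=> nP s x Ss; have [d [k [k0 hd _ hk]]] := sgn l.
  have k1 : k <= 0.
    rewrite leNgt; apply/negP => k1; apply: nP => t y St.
    by rewrite -subr_ge0 hk// mulr_ge0 ?sqr_ge0// ltW.
  by rewrite -subr_le0 hk// mulr_le0_ge0 ?sqr_ge0.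
have [s0 [x0 [Ss0 n00]]] : exists s x, S s /\ 0 < n s x.
  case: pi_irr => _ [s Ss [x sx]] _; exists s, x; split => //.
  rewrite lt_def n0 andbT sqrf_eq0; apply: contra_neq sx; exact: nrm_eq0.
have P0 : P !=set0.
  apply: contrapT => /forallNP nP.
  have := PN _ (nP (q s0 x0 / n s0 x0 - 1)) s0 x0 Ss0.
  by rewrite mulrBl mul1r divfK ?gt_eqF//; lra.
have Pub : has_ubound P.
  exists (q s0 x0 / n s0 x0) => l /(_ s0 x0 Ss0) h.
  by rewrite ler_pdivlMr.
have Psup l : P l -> l <= sup P by move=> Pl; exact: ub_le_sup.
have supP : P (sup P).
  move=> s x Ss; have := n0 s x; rewrite le_eqVlt => /orP[/eqP/esym h|h].
    by rewrite h mulr0 qn.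
  rewrite -ler_pdivlMr//; apply: ge_sup => // l /(_ s x Ss) hl.
  by rewrite ler_pdivlMr.
have supN s x : S s -> q s x <= sup P * n s x.
  move=> Ss; apply/ler_addgt0Pr => e e0.
  have nn : 0 < n s x + 1 by have := n0 s x; lra.
  have : ~ P (sup P + e / (n s x + 1)).
    move=> /Psup; have : 0 < e / (n s x + 1) by exact: divr_gt0.
    lra.
  move=> /PN/(_ s x Ss); move=> /le_trans; apply; rewrite mulrDl lerD2l.
  rewrite mulrAC ler_pdivrMr//; nra.
exists (sup P) => s x Ss.
have [d [k [k0 hd hE hk]]] := sgn (sup P).
have ds0 t y : S t -> pi (d * t) y = 0.
  move=> St; apply/nrm_eq0/eqP; rewrite -sqrf_eq0.
  have /eqP : k * nrm (pi (d * t) y) ^+ 2 = 0.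
    rewrite -hk//; apply/eqP; rewrite subr_eq0 eq_le supN//=.
    exact: supP.
  by rewrite mulf_eq0 (negPf k0).
apply/eqP; rewrite -subr_eq0 hE// ds0 ?scaler0//.
by case: (hd s Ss).
Qed.

Lemma central_scalar_complex (z : T) :
  central_multiplier z -> central_multiplier (cstar z) ->
  exists l : R[i], forall s x, S s -> pi (z * s) x = l *: pi s x.
Proof.
move=> hz hsz; have lin := central_closed.
have h1 := closedD lin hz hsz.
have h2 : central_multiplier ('i%C *: (z - cstar z)).
  apply: (closedZ _ lin); apply: (closedD lin hz).
  by rewrite -scaleN1r; exact: (closedZ _ lin hsz).
have [|l1 hl1] := central_scalar h1; first by rewrite starD starK addrC.
have [|l2 hl2] := central_scalar h2.
  rewrite starZ starB starK complexiE conjCi scaleNr -scalerN opprB.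
  by rewrite -complexiE.
have zE : z = 2^-1 *: (z + cstar z) + (- 'i%C / 2) *: ('i%C *: (z - cstar z)).
  rewrite scalerA mulrAC mulNr -expr2 sqr_i opprK mul1r -scalerDr.
  by rewrite addrACA subrr addr0 scalerDr -scalerDl halves scale1r.
exists (2^-1 * l1%:C + (- 'i%C / 2) * l2%:C) => s x Ss.
have [S1 _] := h1 s Ss; have [S2 _] := h2 s Ss.
rewrite {1}zE mulrDl !(scAl 2^-1) (scAl (- 'i%C / 2)) repD; [|exact: SZ..].
by rewrite !repZ// hl1// hl2// !scalerA -scalerDl.
Qed.

End Irreducible.

(** * Finite-dimensional subspaces and the dimension of irreducible representations *)

Section FiniteSpan.
Variable R : realType.

Lemma half_pow_lt (e : R) : 0 < e -> exists n, 2^-1 ^+ n < e.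
Proof.
move=> e0; exists (Num.bound e^-1); rewrite exprVn invf_plt ?posrE ?exprn_gt0//.
apply: lt_trans (archi_boundP _) _; first by rewrite invr_ge0 ltW.
by rewrite -natrX ltr_nat ltn_expl.
Qed.

Lemma mono_lim (r : nat -> R) (b : R) :
  (forall n, r n <= r n.+1) -> (forall n, r n <= b) ->
  exists s, forall e : R, 0 < e ->
    exists N, forall n, (N <= n)%N -> r n <= s /\ s - r n < e.
Proof.
move=> rS rb; exists (sup (range r)) => e e0.
have rub : has_ubound (range r) by exists b => _ [n _ <-].
have rnd : nondecreasing_seq r by apply/nondecreasing_seqP.
have [|_ [N _ <-] h] := @sup_adherent _ (range r) e e0.
  by split => //; exists (r 0%N); exists 0%N.
exists N => n Nn; have := rnd _ _ Nn => h2.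
have : r n <= sup (range r) by apply: ub_le_sup => //; exists n.
by split => //; lra.
Qed.

(** Both [r] and [r + c] are nondecreasing and bounded, and [c] is their difference. *)
Lemma cauchy_real (c r : nat -> R) (b : R) :
  (forall n, `|c n.+1 - c n| <= r n.+1 - r n) -> (forall n, r n <= b) ->
  exists l, forall e : R, 0 < e ->
    exists N, forall n, (N <= n)%N -> `|l - c n| < e.
Proof.
move=> cr rb.
have crb n : `|c n - c 0%N| <= r n - r 0%N.
  elim: n => [|n ih]; first by rewrite !subrr normr0.
  rewrite -(subrKA (c n)) -(subrKA (r n) (r n.+1)).
  apply: le_trans (ler_normD _ _) _.
  by apply: lerD.
have [|s hs] := @mono_lim r b _ rb.
  by move=> n; have := cr n; have := normr_ge0 (c n.+1 - c n); lra.
have [||t ht] := @mono_lim (fun n => r n + c n) (b + b - r 0%N + c 0%N).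
- by move=> n; have := cr n; have := ler_norm (- (c n.+1 - c n)); rewrite normrN; lra.
- move=> n; have := crb n; have := ler_norm (c n - c 0%N); have := rb n; lra.
exists (t - s) => e e0.
have [N1 h1] := hs e e0; have [N2 h2] := ht e e0.
exists (maxn N1 N2) => n; rewrite geq_max => /andP[/h1[? ?] /h2[? ?]].
by rewrite ltr_norml; apply/andP; split; lra.
Qed.

Lemma Re_norm_le (z : R[i]) : `|complex.Re z| <= complex.Re `|z|.
Proof.
by rewrite -lecR (le_trans (normc_ge_Re z))// RRe_real// ger0_real.
Qed.

Lemma Re_norm_ge0 (z : R[i]) : 0 <= complex.Re `|z|.
Proof. exact: le_trans (normr_ge0 _) (Re_norm_le z). Qed.

Lemma Im_norm_le (z : R[i]) : `|complex.Im z| <= complex.Re `|z|.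
Proof.
have := Re_norm_le (z * 'i%C); rewrite ReiNIm normrN => /le_trans; apply.
by rewrite normrM complexiE normCi mulr1.
Qed.

Lemma norm_ReIm_le (z : R[i]) :
  complex.Re `|z| <= `|complex.Re z| + `|complex.Im z|.
Proof.
case: z => a b; rewrite normc_def /=.
rewrite -[leRHS]ger0_norm ?addr_ge0// -sqrtr_sqr ler_wsqrtr//.
rewrite sqrrD !real_normK ?num_real//.
by rewrite lerD2r lerDl mulrn_wge0// mulr_ge0.
Qed.

Lemma cauchy_complex (c : nat -> R[i]) (r : nat -> R) (b : R) :
  (forall n, complex.Re `|c n.+1 - c n| <= r n.+1 - r n) ->
  (forall n, r n <= b) ->
  exists l : R[i], forall e : R, 0 < e ->
    exists N, forall n, (N <= n)%N -> complex.Re `|l - c n| < e.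
Proof.
move=> cr rb.
have ImD (x y : R[i]) : complex.Im (x - y) = complex.Im x - complex.Im y.
  by case: x => ? ?; case: y.
have ReB (x y : R[i]) : complex.Re (x - y) = complex.Re x - complex.Re y.
  by case: x => ? ?; case: y.
have [|l1 h1] := @cauchy_real (fun n => complex.Re (c n)) r b _ rb.
  by move=> n; rewrite -ReB; apply: le_trans (Re_norm_le _) (cr n).
have [|l2 h2] := @cauchy_real (fun n => complex.Im (c n)) r b _ rb.
  by move=> n; rewrite -ImD; apply: le_trans (Im_norm_le _) (cr n).
exists (l1 +i* l2) => e e0; have e2 : 0 < e / 2%:R by lra.
have [N1 {}h1] := h1 _ e2; have [N2 {}h2] := h2 _ e2.
exists (maxn N1 N2) => n; rewrite geq_max => /andP[/h1 ? /h2 ?].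
apply: le_lt_trans (norm_ReIm_le _) _; rewrite ReB ImD /=; lra.
Qed.

Definition span_set (V : lmodType R[i]) n (v : 'I_n -> V) : set V :=
  [set x | exists c : 'I_n -> R[i], x = \sum_(i < n) c i *: v i].

Lemma span_lin (V : lmodType R[i]) n (v : 'I_n -> V) (a : R[i]) x y :
  span_set v x -> span_set v y -> span_set v (a *: x + y).
Proof.
move=> [c ->] [d ->]; exists (fun i => a * c i + d i).
rewrite scaler_sumr -big_split; apply: eq_bigr => i _.
by rewrite scalerDl scalerA.
Qed.

Lemma span0 (V : lmodType R[i]) n (v : 'I_n -> V) : span_set v 0.
Proof. by exists (fun=> 0); rewrite big1// => i _; rewrite scale0r. Qed.

Lemma span_mem (V : lmodType R[i]) n (v : 'I_n -> V) i : span_set v (v i).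
Proof.
exists (fun j => (j == i)%:R); rewrite (bigD1 i)//= eqxx scale1r big1 ?addr0//.
by move=> j /negPf ->; rewrite scale0r.
Qed.

(** By induction on [n]. If the last vector is not in the span of the others, it has a positive
    distance [d] from it; this controls the last coefficient, so the last coefficients of a sequence
    of approximations converge. *)
Lemma span_closed (V : normedModType R[i]) n (v : 'I_n -> V) :
  closed_subspace (span_set v).
Proof.
split; [|exact: span0|by move=> *; exact: span_lin].
elim: n v => [|n ih] v.
  apply/closedE => x h; exists (fun=> 0); rewrite big_ord0.
  apply/nrm_eq0/eqP; rewrite eq_le nrm_ge0 andbT.
  apply/ler_addgt0Pr => e /h[_ [c ->]]; rewrite big_ord0 subr0 add0r.
  exact: ltW.
pose v' i := v (widen_ord (leqnSn n) i); pose w := v ord_max.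
have spanE x : span_set v x <-> exists k y, span_set v' y /\ x = y + k *: w.
  split=> [[c ->]|[k [y [[c ->] ->]]]].
    rewrite big_ord_recr /=; exists (c ord_max); eexists; split; last by [].
    by exists (fun i => c (widen_ord (leqnSn n) i)).
  exists (fun i => if unlift ord_max i is Some j then c j else k).
  rewrite big_ord_recr /= unlift_none; congr (_ + _).
  apply: eq_bigr => i _; have -> : widen_ord (leqnSn n) i = lift ord_max i.
    by apply: val_inj; rewrite /= /bump leqNgt ltn_ord.
  rewrite liftK; congr (_ *: v _); apply: val_inj => /=.
  by rewrite /bump leqNgt ltn_ord.
have cl' := ih v'.
have [wW|wW] := pselect (span_set v' w).
  have -> : span_set v = span_set v'; last exact: cl'.
  apply/seteqP; split => x.
    move=> /spanE[k [y [Wy ->]]]; rewrite addrC; exact: span_lin.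
  by move=> Wx; apply/spanE; exists 0, x; rewrite scale0r addr0.
have [d d0 wd] : exists2 d : R, 0 < d & forall y, span_set v' y -> d <= nrm (w - y).
  apply: contrapT => nd; apply: wW; apply: (closedE _).1 => // e e0.
  apply: contrapT => ne; apply: nd; exists e => // y Wy.
  by rewrite leNgt; apply/negP => h; apply: ne; exists y.
have wd' k y : span_set v' y -> complex.Re `|k| * d <= nrm (y + k *: w).
  move=> Wy; have [->|k0] := eqVneq k 0; first by rewrite normr0 mul0r nrm_ge0.
  have -> : y + k *: w = k *: (w - (- k^-1) *: y).
    by rewrite scalerBr scalerA mulrN mulfV// scaleN1r opprK addrC.
  rewrite nrmZ; apply: ler_wpM2l; first exact: Re_norm_ge0.
  apply: wd; rewrite -[_ *: y]addr0; apply: span_lin => //; exact: span0.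
apply/closedE => x h.
have p2 k : 0 < (2^-1 : R) ^+ k by rewrite exprn_gt0// invr_gt0.
have /choice[f hf] k : exists p : R[i] * V, span_set v' p.2 /\
    nrm (x - (p.2 + p.1 *: w)) < 2^-1 ^+ k.
  by have [y /spanE[c [y' [Wy' ->]]] hy] := h _ (p2 k); exists (c, y').
(* Consecutive approximations differ by at most twice [2^-1 ^+ k], hence their last coefficients by
   [2 / d] times that power, which is the increment of [r]. *)
pose c k := (f k).1; pose r k : R := - (4%:R / d) * 2^-1 ^+ k.
have [||l hl] := @cauchy_complex c r 0.
- move=> k; rewrite -(ler_pM2r d0).
  have [Wk hk] := hf k; have [Wk1 hk1] := hf k.+1.
  have Wd : span_set v' ((f k.+1).2 - (f k).2).
    by rewrite addrC -scaleN1r; exact: span_lin.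
  apply: le_trans (wd' _ _ Wd) _.
  have -> : (f k.+1).2 - (f k).2 + (c k.+1 - c k) *: w =
      (x - ((f k).2 + c k *: w)) - (x - ((f k.+1).2 + c k.+1 *: w)).
    by rewrite opprB [RHS]addrC addrA subrK scalerBl opprD addrACA.
  apply: le_trans (nrmB _ _) _.
  have -> : (r k.+1 - r k) * d = 2%:R * 2^-1 ^+ k.
    by rewrite /r exprS; field; rewrite gt_eqF.
  have := p2 k; move: hk hk1; rewrite exprS -/(c k) -/(c k.+1); lra.
- move=> k; rewrite /r mulNr oppr_le0 mulr_ge0// ?ltW//.
  by apply: divr_gt0.
apply/spanE; exists l, (x - l *: w); split; last by rewrite subrK.
apply: (closedE _).1 => // e e0.
have w0 := nrm_ge0 w.
have [|N hN] := hl (e / 2%:R / (nrm w + 1)).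
  by apply: divr_gt0; lra.
have [M hM] : exists M, (2^-1 : R) ^+ M < e / 2%:R.
  by apply: half_pow_lt; lra.
pose k := maxn N M; have [Wk hk] := hf k.
exists (f k).2 => //.
have -> : x - l *: w - (f k).2 = (x - ((f k).2 + (f k).1 *: w)) - (l - c k) *: w.
  by rewrite scalerBl opprB opprD !addrA subrK addrAC.
apply: le_lt_trans (nrmB _ _) _.
rewrite nrmZ.
have := hN k (leq_maxl _ _); rewrite ltr_pdivlMr; last lra.
have : (2^-1 : R) ^+ k <= 2^-1 ^+ M.
  by apply: ler_wiXn2l; rewrite ?leq_maxr ?invr_ge0// invf_le1// ler1n.
have := Re_norm_ge0 (l - c k).
nra.
Qed.

Lemma max_indep (V : lmodType R[i]) (W : set V) n :
  (forall v : 'I_n -> V, (forall i, W (v i)) ->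
     exists c : 'I_n -> R[i], (exists i, c i != 0) /\ \sum_i c i *: v i = 0) ->
  exists m (v : 'I_m -> V), [/\ (m < n)%N, forall i, W (v i) &
    forall x, W x -> span_set v x].
Proof.
elim: n => [|n ih] dep.
  by have [|c [[[]]]] := dep (fun=> 0) => //; case.
have [d|/existsNP[v /not_implyP[Wv nd]]] := pselect (forall v : 'I_n -> V,
    (forall i, W (v i)) ->
    exists c : 'I_n -> R[i], (exists i, c i != 0) /\ \sum_i c i *: v i = 0).
  by have [m [v [mn Wv sp]]] := ih d; exists m, v; split => //; exact: leqW.
exists n, v; split => // x Wx.
have [|c [[i ci] h]] := dep (fun i => if unlift ord_max i is Some j then v j else x).
  by move=> i; case: unliftP.
move: h; rewrite big_ord_recr /= unlift_none.
under eq_bigr => j _.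
  have -> : widen_ord (leqnSn n) j = lift ord_max j.
    by apply: val_inj; rewrite /= /bump leqNgt ltn_ord.
  rewrite liftK; over.
move=> h; have [cm|cm] := eqVneq (c ord_max) 0.
  case: nd; exists (fun j => c (lift ord_max j)); split; last first.
    by move: h; rewrite cm scale0r addr0.
  case: (unliftP ord_max i) ci => [j ->|->]; first by exists j.
  by rewrite cm eqxx.
exists (fun j => - (c ord_max)^-1 * c (lift ord_max j)).
under eq_bigr do rewrite -scalerA.
rewrite -scaler_sumr; apply: (scalerI cm).
rewrite scalerA mulrN mulfV// scaleN1r.
by apply/eqP; rewrite -addr_eq0 addrC h.
Qed.

End FiniteSpan.

Section IrreducibleDim.
Variables (R : realType) (T : cstarType R) (S S0 : set T).
Hypotheses (Salg : cstar_subalgebra S) (S0S : S0 `<=` S)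
  (S0dense : S `<=` closure S0).
Variables (H : hilbertType R) (pi : T -> H -> H).
Hypothesis pi_irr : irreducible_representation S pi.

(** The vectors [pi s x0] with [s] in the dense part [S0] span a space of dimension at most [n].
    Being finite-dimensional it is closed, so it is invariant under all of [S], and it is
    everything. This bounds [H] by the dimension of the image of [S0], which is crude but
    sufficient. *)
Lemma irreducible_dim n :
  (forall s : 'I_n.+1 -> T, (forall i, S0 (s i)) ->
    exists c : 'I_n.+1 -> R[i], (exists i, c i != 0) /\
      forall x, pi (\sum_i c i *: s i) x = 0) ->
  dim_le H n.
Proof.
move=> dep; have [_ [a Sa [x0 ax0]] inv] := pi_irr.
have [Scl SM _] := Salg.
have dense s x (e : R) : S s -> 0 < e -> exists2 t, S0 t & nrm (pi s x - pi t x) < e.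
  move=> Ss e0; have x1 := nrm_ge0 x.
  have /closureE/(_ (e / (nrm x + 1)))[|t S0t st] := S0dense Ss.
    by apply: divr_gt0; lra.
  exists t => //; have St := S0S S0t.
  have SN : S (- t) by rewrite -scaleN1r; exact: closedZ.
  rewrite -(repN Salg pi_irr)// -(repD pi_irr)//.
  apply: le_lt_trans (rep_contract Salg pi_irr _ _) _; first exact: closedD.
  by move: st; rewrite ltr_pdivlMr; [have := nrm_ge0 (s - t); nra|lra].
pose W := [set y | exists2 s, S0 s & y = pi s x0].
have [|m [v [mn Wv spv]]] := @max_indep R H W n.+1.
  move=> v Wv; have /choice[s hs] i : exists s, S0 s /\ v i = pi s x0.
    by have [s S0s ->] := Wv i; exists s.
  have [|c [nz h]] := dep s; first by move=> i; case: (hs i).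
  exists c; split => //; rewrite -[RHS](h x0).
  have [|_ ->] := @rep_sum _ _ _ Salg _ _ pi_irr _ (fun i => c i *: s i) x0.
    by move=> i; apply: closedZ => //; apply: S0S; case: (hs i).
  apply: eq_bigr => i _; have [S0i ->] := hs i.
  by rewrite (repZ Salg pi_irr)//; exact: S0S.
have Wcl := span_closed v.
have SW s : S s -> span_set v (pi s x0).
  move=> Ss; have [/closedE cl _ _] := Wcl; apply: cl => e e0.
  have [t S0t st] := dense s x0 e Ss e0.
  by exists (pi t x0) => //; apply: spv; exists t.
have WT : span_set v = [set: H].
  have [//||//] := inv (span_set v) Wcl.
    move=> s _ Ss [c ->].
    have [_ _ lin] := Wcl.
    have pi_sum k (f : 'I_k -> H) : pi s (\sum_i f i) = \sum_i pi s (f i).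
      elim: k f => [|k ih] f; last by rewrite !big_ord_recl (rep_addr pi_irr)// ih.
      by rewrite !big_ord0; have := rep_scale pi_irr 0 0 Ss; rewrite !scale0r.
    rewrite pi_sum; elim/big_ind: _ => [|x y hx hy|i _].
    - exact: span0.
    - by rewrite -[x]scale1r; exact: lin.
    - rewrite (rep_scale pi_irr)// -[_ *: _]addr0; apply: lin; last exact: span0.
      have [t S0t ->] := Wv i; rewrite -(repM pi_irr)//; last exact: S0S.
      by apply: SW; apply: SM => //; exact: S0S.
  move=> W0; have := SW a Sa; rewrite W0 /= => h.
  by rewrite h eqxx in ax0.
have mn' : (m <= n)%N by [].
(* [dim_le] asks for exactly [n] vectors; the [m] vectors found are padded with zeros. *)
exists (fun i : 'I_n => if insub (val i) is Some j then v j else 0) => x.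
have [c ->] : span_set v x by rewrite WT.
exists (fun i : 'I_n => if insub (val i) is Some j then c j else 0).
rewrite -(big_mkord predT (fun i =>
    (if insub i is Some j then c j else 0) *: (if insub i is Some j then v j else 0))).
rewrite (big_cat_nat _ (n := m))//= [X in _ = _ + X]big_nat_cond [X in _ = _ + X]big1.
  rewrite addr0 big_mkord; apply: eq_bigr => i _.
  by rewrite valK.
by move=> i /andP[/andP[mi _] _]; rewrite insubF ?scale0r// ltnNge mi.
Qed.

End IrreducibleDim.

Lemma kernel_vector (F : fieldType) (J : finType) (k : 'I_(#|J|.+1) -> J -> F) :
  exists c : 'I_(#|J|.+1) -> F, (exists i, c i != 0) /\
    forall t, \sum_i c i * k i t = 0.
Proof.
pose M : 'M[F]_(#|J|.+1, #|J|) := \matrix_(i, j) k i (enum_val j).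
have : kermx M != 0.
  rewrite -mxrank_eq0 mxrank_ker subn_eq0 -ltnNge ltnS.
  exact: rank_leq_col.
case/rowV0Pn => v /sub_kermxP vM v0.
exists (fun i => v 0 i); split.
  by move/rV0Pn: v0.
move=> t; move/matrixP/(_ 0 (enum_rank t)): vM; rewrite !mxE => vM.
rewrite -[RHS]vM; apply: eq_bigr => i _; by rewrite mxE enum_rankK.
Qed.

Section StarAlgebra.
Variables (R : realType) (T : cstarType R).

Definition star_algebra (S : set T) := [/\ S 0,
  forall (a : R[i]) x y, S x -> S y -> S (a *: x + y),
  forall x y, S x -> S y -> S (x * y) & forall x, S x -> S (cstar x)].

Lemma closure_star_algebra S : star_algebra S -> cstar_subalgebra (closure S).
Proof.
move=> [S0 SL SM SS]; split; first split.
- exact: closed_closure.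
- exact: subset_closure.
- move=> a x y /closureE hx /closureE hy; apply/closureE => e e0.
  have a0 := Re_norm_ge0 a.
  have [|x' Sx xx] := hx (e / 2%:R / (complex.Re `|a| + 1)).
    by apply: divr_gt0; lra.
  have [|y' Sy yy] := hy (e / 2%:R); first lra.
  exists (a *: x' + y'); first exact: SL.
  rewrite opprD addrACA -scalerBr; apply: le_lt_trans (nrmD _ _) _.
  rewrite nrmZ; move: xx; rewrite ltr_pdivlMr; last lra.
  have := nrm_ge0 (x - x'); nra.
- move=> x y /closureE hx /closureE hy; apply/closureE => e e0.
  have y0 := nrm_ge0 y.
  have [|x' Sx xx] := hx (e / 2%:R / (nrm y + 1)).
    by apply: divr_gt0; lra.
  have x0 := nrm_ge0 x'.
  have [|y' Sy yy] := hy (e / 2%:R / (nrm x' + 1)).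
    by apply: divr_gt0; lra.
  exists (x' * y'); first exact: SM.
  have -> : x * y - x' * y' = (x - x') * y + x' * (y - y') by ncring.
  apply: le_lt_trans (nrmD _ _) _.
  have := nrmM (x - x') y; have := nrmM x' (y - y').
  move: xx yy; rewrite !ltr_pdivlMr; [|lra..].
  have := nrm_ge0 (x - x'); have := nrm_ge0 (y - y'); nra.
- move=> x /closureE hx; apply/closureE => e /hx[y Sy xy].
  by exists (cstar y); [exact: SS|rewrite -starB nrm_star].
Qed.

Lemma star_algebraD (S : set T) x y : star_algebra S -> S x -> S y -> S (x + y).
Proof. by move=> [_ SL _ _] Sx Sy; rewrite -[x]scale1r; exact: SL. Qed.

Lemma star_algebraZ (S : set T) (a : R[i]) x : star_algebra S -> S x -> S (a *: x).
Proof. by move=> [S0 SL _ _] Sx; rewrite -[a *: x]addr0; exact: SL. Qed.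

Lemma star_algebra_sum (S : set T) (I : Type) (r : seq I) (P : pred I) (F : I -> T) :
  star_algebra S -> (forall i, S (F i)) -> S (\sum_(i <- r | P i) F i).
Proof.
move=> SA SF; elim/big_ind: _ => [|x y Sx Sy|//]; first by case: SA.
exact: star_algebraD.
Qed.

Lemma central_closure S z : star_algebra S ->
  (forall s, S s -> S (z * s) /\ z * s = s * z) -> central_multiplier (closure S) z.
Proof.
move=> SA h s /closureE hs; have z0 := nrm_ge0 z; split.
  apply/closureE => e e0.
  have [|t St st] := hs (e / (nrm z + 1)); first by apply: divr_gt0; lra.
  exists (z * t); first by case: (h t St).
  rewrite -mulrBr; apply: le_lt_trans (nrmM _ _) _.
  by move: st; rewrite ltr_pdivlMr; [have := nrm_ge0 (s - t); nra|lra].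
have [/closedE cl _ _] := closed_comm z; apply: cl => e /hs[t St st].
by exists t => //=; case: (h t St).
Qed.

End StarAlgebra.

(** * Towers of matrix units *)

Section Tower.
Variables (R : realType) (T : cstarType R).
Variables (e : T) (N : nat) (z : 'I_N -> T).
Hypotheses (ee : e * e = e) (se : cstar e = e) (ze : forall i, z i * e = z i)
  (zz : forall i j, cstar (z i) * z j = if i == j then e else 0).

(** A matrix over the corner of [e], transported by the [z i], which are partial isometries with
    common source [e] and orthogonal ranges. *)
Definition tower (q : 'I_N -> 'I_N -> T) : T :=
  \sum_i \sum_j z i * q i j * cstar (z j).

Definition tower_diag (c : T) : T := tower (fun i j => if i == j then c else 0).

Lemma towerE q x : tower q * x = \sum_i \sum_j z i * q i j * (cstar (z j) * x).
Proof.
rewrite mulr_suml; apply: eq_bigr => i _; rewrite mulr_suml.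
by apply: eq_bigr => j _; rewrite !mulrA.
Qed.

Lemma tower_mulz q k : tower q * z k = \sum_i z i * q i k * e.
Proof.
rewrite towerE; apply: eq_bigr => i _; rewrite (bigD1 k)//= zz eqxx big1 ?addr0//.
by move=> j /negPf jk; rewrite zz jk mulr0.
Qed.

Lemma towerM q q' : (forall i j, e * q' i j = q' i j) ->
  tower q * tower q' = tower (fun i l => \sum_j q i j * q' j l).
Proof.
move=> eq'; rewrite {2}/tower mulr_sumr.
under eq_bigr => k _.
  rewrite mulr_sumr; under eq_bigr => l _.
    rewrite !mulrA tower_mulz !mulr_suml.
    under eq_bigr => i _ do rewrite -[_ * e * _]mulrA eq' -[z i * _ * _]mulrA.
    over.
  rewrite exchange_big /=; over.
rewrite exchange_big /=; apply: eq_bigr => i _; rewrite exchange_big /=.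
apply: eq_bigr => l _; rewrite mulr_sumr mulr_suml.
by apply: eq_bigr => j _; rewrite !mulrA.
Qed.

Lemma tower_star q : cstar (tower q) = tower (fun i j => cstar (q j i)).
Proof.
rewrite /tower star_sum; under eq_bigr do rewrite star_sum.
rewrite exchange_big /=; apply: eq_bigr => i _; apply: eq_bigr => j _.
by rewrite !starM starK mulrA.
Qed.

Lemma tower_lin (a : R[i]) q q' :
  a *: tower q + tower q' = tower (fun i j => a *: q i j + q' i j).
Proof.
rewrite scaler_sumr -big_split; apply: eq_bigr => i _ /=.
rewrite scaler_sumr -big_split; apply: eq_bigr => j _ /=.
by rewrite mulrDr mulrDl scAr scAl.
Qed.

Lemma eq_tower q q' : (forall i j, q i j = q' i j) -> tower q = tower q'.
Proof. by move=> h; apply: eq_bigr => i _; apply: eq_bigr => j _; rewrite h. Qed.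

Lemma tower_diagM c q : (forall i j, e * q i j = q i j) ->
  tower_diag c * tower q = tower (fun i j => c * q i j).
Proof.
move=> eq; rewrite towerM//; apply: eq_tower => i l.
rewrite (bigD1 i)//= eqxx big1 ?addr0// => j /negPf ji.
by rewrite eq_sym ji mul0r.
Qed.

Lemma tower_Mdiag c q : e * c = c ->
  tower q * tower_diag c = tower (fun i j => q i j * c).
Proof.
move=> ec; rewrite towerM; last by move=> i j; case: eqP => _; rewrite ?mulr0.
apply: eq_tower => i l.
by rewrite (bigD1 l)//= eqxx big1 ?addr0// => j /negPf ->; rewrite mulr0.
Qed.

Lemma tower_diag_star c : cstar (tower_diag c) = tower_diag (cstar c).
Proof.
rewrite tower_star; apply: eq_tower => i j; rewrite eq_sym.
by case: eqP; rewrite ?star0.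
Qed.

Lemma tower_diagz c i : e * c = c -> tower_diag c * z i = z i * c * e.
Proof.
move=> ec; rewrite tower_mulz (bigD1 i)//= eqxx big1 ?addr0// => j /negPf ->.
by rewrite mulr0 mul0r.
Qed.

Lemma tower_comm (g : T) q : (forall i, g * z i = z i * g) ->
  (forall i, g * cstar (z i) = cstar (z i) * g) ->
  g * tower q = tower (fun i j => g * q i j) /\
  tower q * g = tower (fun i j => q i j * g).
Proof.
move=> gz gsz; rewrite /tower mulr_sumr mulr_suml; split; apply: eq_bigr => i _.
  by rewrite mulr_sumr; apply: eq_bigr => j _; rewrite !mulrA gz.
by rewrite mulr_suml; apply: eq_bigr => j _; rewrite -!mulrA -gsz.
Qed.

Section Subhomogeneous.
Variables (Cc : set T) (d : nat) (g : 'I_d -> T) (D : set T).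
Hypotheses (Cstar : star_algebra Cc) (Ce : Cc e)
  (eC : forall c, Cc c -> e * c = c) (CC : forall c c', Cc c -> Cc c' -> c * c' = c' * c).
Hypotheses (Gstar : star_algebra (span_set g)) (G1 : span_set g 1)
  (Ge : forall x, span_set g x -> x * e = e * x)
  (Gz : forall x i, span_set g x -> x * z i = z i * x)
  (GC : forall x c, span_set g x -> Cc c -> x * c = c * x).

Let L := tower_diag e.

(** As [Cc] and the span of [g] commute, this is their product algebra, spanned by [d] elements over
    the commutative [Cc]. *)
Definition tower_coef : set T :=
  [set q | exists2 c : 'I_d -> T, forall r, Cc (c r) & q = \sum_r c r * g r].

(** The two summands are orthogonal, and [L] commutes with both. [L] need not commute with [D], so
    the compression is closed under products only because [DL] lets [D] absorb the factor
    [1 - L]. *)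
Definition tower_algebra : set T := [set s | exists2 y, D y &
  exists2 q : 'I_N -> 'I_N -> T, forall i j, tower_coef (q i j) &
    s = (1 - L) * y * (1 - L) + tower q].

Hypotheses (Dstar : star_algebra D)
  (DL : forall y y', D y -> D y' -> D (y * (1 - L) * y')).

Lemma coefC c x : Cc c -> span_set g x -> tower_coef (c * x).
Proof.
move=> hc [k ->]; exists (fun r => k r *: c).
  by move=> r; exact: star_algebraZ.
by rewrite mulr_sumr; apply: eq_bigr => r _; rewrite scAl scAr.
Qed.

Lemma coef_lin (a : R[i]) p q : tower_coef p -> tower_coef q -> tower_coef (a *: p + q).
Proof.
move=> [c hc ->] [c' hc' ->]; exists (fun r => a *: c r + c' r).
  by case: Cstar => _ lin _ _ r; exact: lin.
rewrite scaler_sumr -big_split; apply: eq_bigr => r _ /=.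
by rewrite mulrDl scAl.
Qed.

Lemma coef0 : tower_coef 0.
Proof.
exists (fun=> 0); first by case: Cstar.
by rewrite big1// => r _; rewrite mul0r.
Qed.

Lemma coef_sum (I : Type) (r : seq I) (P : pred I) F :
  (forall i : I, tower_coef (F i)) -> tower_coef (\sum_(i <- r | P i) F i).
Proof.
move=> h; elim/big_ind: _ => [|x y hx hy|//]; first exact: coef0.
by rewrite -[x]scale1r; exact: coef_lin.
Qed.

Lemma coefM p q : tower_coef p -> tower_coef q -> tower_coef (p * q).
Proof.
move=> [c hc ->] [c' hc' ->]; rewrite mulr_suml; apply: coef_sum => r.
rewrite mulr_sumr; apply: coef_sum => s.
have -> : c r * g r * (c' s * g s) = c r * c' s * (g r * g s).
  rewrite -!mulrA; congr (_ * _); rewrite !mulrA (GC (span_mem g r))//.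
apply: coefC; first by case: Cstar => _ _ m _; exact: m.
by case: Gstar => _ _ m _; apply: m; exact: span_mem.
Qed.

Lemma coef_star p : tower_coef p -> tower_coef (cstar p).
Proof.
move=> [c hc ->]; rewrite star_sum; apply: coef_sum => r.
have Gr : span_set g (cstar (g r)).
  by case: Gstar => _ _ _; apply; exact: span_mem.
have Cr : Cc (cstar (c r)) by case: Cstar => _ _ _; exact.
by rewrite starM (GC Gr Cr); exact: coefC.
Qed.

Lemma e_coef p : tower_coef p -> e * p = p.
Proof.
move=> [c hc ->]; rewrite mulr_sumr; apply: eq_bigr => r _.
by rewrite mulrA eC.
Qed.

Lemma coef_e p : tower_coef p -> p * e = p.
Proof. by move=> /coef_star/e_coef h; rewrite -{1}[p]starK -{1}se -starM h starK. Qed.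

Lemma LL : L * L = L.
Proof.
rewrite tower_diagM; last by move=> i j; case: eqP; rewrite ?mulr0.
by apply: eq_tower => i j; case: eqP; rewrite ?mulr0.
Qed.

Lemma Lstar : cstar L = L.
Proof. by rewrite tower_diag_star se. Qed.

Lemma L_tower q : (forall i j, tower_coef (q i j)) -> L * tower q = tower q.
Proof.
move=> hq; rewrite tower_diagM => [|i j]; last exact: e_coef.
by apply: eq_tower => i j; exact: e_coef.
Qed.

Lemma tower_L q : (forall i j, tower_coef (q i j)) -> tower q * L = tower q.
Proof.
by move=> hq; rewrite tower_Mdiag//; apply: eq_tower => i j; exact: coef_e.
Qed.

Lemma L1 : (1 - L) * L = 0. Proof. by rewrite mulrBl mul1r LL subrr. Qed.
Lemma L2 : L * (1 - L) = 0. Proof. by rewrite mulrBr mulr1 LL subrr. Qed.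
Lemma L3 : (1 - L) * (1 - L) = 1 - L.
Proof. by rewrite mulrBr mulr1 L1 subr0. Qed.

Lemma sL1 : cstar (1 - L) = 1 - L.
Proof. by rewrite starB star1 Lstar. Qed.

Lemma tower_algebra_star : star_algebra tower_algebra.
Proof.
have [D0 Dlin DM DS] := Dstar.
split.
- exists 0 => //; exists (fun _ _ => 0); first by move=> *; exact: coef0.
  rewrite mulr0 mul0r add0r /tower big1// => i _; rewrite big1// => j _.
  by rewrite mulr0 mul0r.
- move=> a _ _ [y Dy [q hq ->]] [y' Dy' [q' hq' ->]].
  exists (a *: y + y'); first exact: Dlin.
  exists (fun i j => a *: q i j + q' i j); first by move=> i j; exact: coef_lin.
  rewrite -tower_lin scalerDr addrACA; congr (_ + _).
  by rewrite [_ * (_ + y')]mulrDr [RHS]mulrDl scAr scAl.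
- move=> _ _ [y Dy [q hq ->]] [y' Dy' [q' hq' ->]].
  exists (y * (1 - L) * y'); first exact: DL.
  exists (fun i l => \sum_j q i j * q' j l).
    by move=> i l; apply: coef_sum => j; exact: coefM.
  rewrite -towerM; last by move=> i j; exact: e_coef.
  have P1 := L1; have P2 := L2; have P3 := L3; set P := 1 - L in P1 P2 P3 *.
  clearbody P.
  rewrite mulrDl !mulrDr.
  have -> : P * y * P * tower q' = 0.
    by rewrite -(L_tower hq') mulrA -[_ * P * L]mulrA P1 mulr0 mul0r.
  have -> : tower q * (P * y' * P) = 0.
    by rewrite -(tower_L hq) !mulrA -[tower q * L * _]mulrA P2 mulr0 !mul0r.
  rewrite addr0 add0r; congr (_ + _).
  by rewrite !mulrA -[P * y * P * P]mulrA P3.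
- move=> _ [y Dy [q hq ->]]; exists (cstar y); first exact: DS.
  exists (fun i j => cstar (q j i)); first by move=> i j; exact: coef_star.
  by rewrite starD !starM sL1 mulrA tower_star.
Qed.

Variable J : finType.
Hypothesis HD : forall (H : hilbertType R) (pi : T -> H -> H),
  irreducible_representation (closure tower_algebra) pi ->
  (forall s x, closure tower_algebra s -> pi (L * s) x = 0) ->
  exists k : T -> J -> R[i], forall n (y : 'I_n -> T) (c : 'I_n -> R[i]),
    (forall i, D (y i)) -> (forall t, \sum_i c i * k (y i) t = 0) ->
    forall x, pi ((1 - L) * (\sum_i c i *: y i) * (1 - L)) x = 0.

(** [L] is a central multiplier, so in an irreducible representation [L] or [1 - L] acts as zero. In
    the first case [HD] provides coordinates indexed by [J]. In the second, diagonal towers over the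
    commutative [Cc] are central and act by scalars, which leaves one coordinate for each matrix
    position and each [g r]. [K] has room for both cases. *)
Lemma tower_subhomogeneous : subhomogeneous (closure tower_algebra).
Proof.
pose S := closure tower_algebra.
have SA := closure_star_algebra tower_algebra_star.
have S0S : tower_algebra `<=` S by exact: subset_closure.
pose K : finType := (J + 'I_N * 'I_N * 'I_d)%type.
exists #|K| => H pi irr.
have Lc : central_multiplier S L.
  apply: central_closure => [|_ [y Dy [q hq ->]]]; first exact: tower_algebra_star.
  have -> : L * ((1 - L) * y * (1 - L) + tower q) = tower q.
    by rewrite mulrDr !mulrA L2 !mul0r add0r L_tower.
  have -> : ((1 - L) * y * (1 - L) + tower q) * L = tower q.
    by rewrite mulrDl -mulrA L1 mulr0 add0r tower_L.
  split=> //; exists 0; first by case: Dstar.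
  by exists q => //; rewrite mulr0 mul0r add0r.
have L1c : central_multiplier S (1 - L).
  have [_ _ lin] := central_closed SA; rewrite addrC -scaleN1r; apply: lin => //.
  exact: central1.
have diag_c c : Cc c -> central_multiplier S (tower_diag c).
  move=> hc; apply: central_closure => [|_ [y Dy [q hq ->]]].
    exact: tower_algebra_star.
  have cL : tower_diag c * L = tower_diag c.
    rewrite tower_Mdiag//; apply: eq_tower => i j; case: eqP; rewrite ?mul0r// => _.
    by rewrite -CC// eC.
  have Lc' : L * tower_diag c = tower_diag c.
    rewrite tower_diagM.
      by apply: eq_tower => i j; case: eqP; rewrite ?mulr0// eC.
    by move=> i j; case: eqP; rewrite ?mulr0// eC.
  have -> : tower_diag c * ((1 - L) * y * (1 - L) + tower q) =
      tower (fun i j => c * q i j).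
    rewrite mulrDr -{1}cL !mulrA -[tower_diag c * L * _]mulrA L2 mulr0 !mul0r.
    by rewrite add0r tower_diagM// => i j; exact: e_coef.
  have cq i j : q i j * c = c * q i j.
    have [k hk ->] := hq i j; rewrite mulr_suml mulr_sumr; apply: eq_bigr => r _.
    by rewrite -mulrA (GC (span_mem g r) hc) mulrA (CC (hk r) hc) mulrA.
  have -> : ((1 - L) * y * (1 - L) + tower q) * tower_diag c =
      tower (fun i j => c * q i j).
    rewrite mulrDl -{1}Lc' !mulrA -[_ * (1 - L) * L]mulrA L1 mulr0 mul0r add0r.
    by rewrite tower_Mdiag ?eC//; apply: eq_tower.
  split=> //; exists 0; first by case: Dstar.
  exists (fun i j => c * q i j); last by rewrite mulr0 mul0r add0r.
  move=> i j; apply: coefM => //.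
  by rewrite -[c]mulr1; exact: coefC.
(* The scalar by which the diagonal tower of [c] acts; 0 is a dummy value outside [Cc]. *)
have /choice[mu hmu] c : exists l : R[i], Cc c ->
    forall s x, S s -> pi (tower_diag c * s) x = l *: pi s x.
  have [hc|nc] := pselect (Cc c); last by exists 0.
  have [|l hl] := central_scalar_complex SA irr (diag_c _ hc); last by exists l.
  by rewrite tower_diag_star; apply: diag_c; case: Cstar => _ _ _; exact.
pose E a b r : T := z a * g r * cstar (z b).
have E0 a b r : tower_algebra (E a b r).
  exists 0; first by case: Dstar.
  exists (fun i j => if (i == a) && (j == b) then e * g r else 0).
    move=> i j; case: ifP => _; last exact: coef0.
    exact: coefC Ce (span_mem _ _).
  rewrite mulr0 mul0r add0r /tower (bigD1 a)//= eqxx (bigD1 b)//= eqxx /=.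
  rewrite mulrA ze [\sum_(_ < _ | _ != b) _]big1 => [|j /negPf ->]; last first.
    by rewrite mulr0 mul0r.
  rewrite addr0 big1 ?addr0// => i /negPf ->; rewrite big1// => j _.
  by rewrite mulr0 mul0r.
have pi_tower q (c : 'I_N -> 'I_N -> 'I_d -> T) x :
    (forall i j r, Cc (c i j r)) -> (forall i j, q i j = \sum_r c i j r * g r) ->
    pi (tower q) x = \sum_i \sum_j \sum_r mu (c i j r) *: pi (E i j r) x.
  move=> hc qE.
  have dE i j r : z i * (c i j r * g r) * cstar (z j) = tower_diag (c i j r) * E i j r.
    rewrite /E !mulrA tower_diagz ?eC//; congr (_ * _); rewrite -!mulrA.
    by rewrite [_ * (e * _)]mulrA (CC (hc i j r) Ce) eC.
  have SdE i j r : S (tower_diag (c i j r) * E i j r).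
    by case: (diag_c _ (hc i j r) (E i j r) (S0S _ (E0 i j r))).
  rewrite /tower.
  have -> : \sum_i \sum_j z i * q i j * cstar (z j) =
      \sum_i \sum_j \sum_r tower_diag (c i j r) * E i j r.
    apply: eq_bigr => i _; apply: eq_bigr => j _; rewrite qE mulr_sumr mulr_suml.
    by apply: eq_bigr => r _; rewrite dE.
  have h1 i j := rep_sum SA irr x (SdE i j).
  have h2 i := rep_sum SA irr x (fun j => (h1 i j).1).
  have [_ ->] := rep_sum SA irr x (fun i => (h2 i).1).
  apply: eq_bigr => i _; rewrite (h2 i).2; apply: eq_bigr => j _.
  rewrite (h1 i j).2; apply: eq_bigr => r _.
  by rewrite hmu//; exact: S0S.
(* The chosen decomposition need not be linear in [s]. It does not have to be: a linear relation is
   sought between the coordinates of finitely many elements, and it is applied to their chosen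
   parts. *)
have /choice[dec hdec] s : exists p : T * ('I_N -> 'I_N -> 'I_d -> T),
    tower_algebra s -> [/\ D p.1, forall i j r, Cc (p.2 i j r) &
      s = (1 - L) * p.1 * (1 - L) + tower (fun i j => \sum_r p.2 i j r * g r)].
  have [[y Dy [q hq ->]]|ns] := pselect (tower_algebra s); last first.
    by exists (0, fun _ _ _ => 0).
  have /choice[c hc] (ij : 'I_N * 'I_N) : exists c : 'I_d -> T,
      (forall r, Cc (c r)) /\ q ij.1 ij.2 = \sum_r c r * g r.
    by have [c h1 h2] := hq ij.1 ij.2; exists c.
  exists (y, fun i j => c (i, j)) => _; split => //=.
    by move=> i j r; case: (hc (i, j)).
  by congr (_ + _); apply: eq_tower => i j; case: (hc (i, j)).
have [kD hkD] : exists k : T -> J -> R[i],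
    (forall s x, S s -> pi (L * s) x = 0) ->
    forall n (y : 'I_n -> T) (c : 'I_n -> R[i]),
    (forall i, D (y i)) -> (forall t, \sum_i c i * k (y i) t = 0) ->
    forall x, pi ((1 - L) * (\sum_i c i *: y i) * (1 - L)) x = 0.
  have [h|nh] := pselect (forall s x, S s -> pi (L * s) x = 0).
    by have [k hk] := HD irr h; exists k.
  by exists (fun _ _ => 0).
apply: (irreducible_dim SA S0S (fun _ => id) irr) => s S0s.
pose k i (t : K) : R[i] := match t with
  | inl j => kD (dec (s i)).1 j
  | inr (a, b, r) => mu ((dec (s i)).2 a b r) end.
have [c [nz hc]] := kernel_vector k.
exists c; split=> // x.
pose u : T := \sum_i c i *: s i.
have S0u : tower_algebra u.
  apply: star_algebra_sum => [|i]; first exact: tower_algebra_star.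
  apply: star_algebraZ => //; exact: tower_algebra_star.
have Su := S0S _ S0u.
have [SLu _] := Lc u Su; have [SL1u _] := L1c u Su.
have uE : pi u x = pi (L * u) x + pi ((1 - L) * u) x.
  by rewrite -(repD irr)// -mulrDl addrC subrK mul1r.
rewrite -/u uE.
case: (central_prime SA irr Lc L1c L1) => h.
  rewrite h// addr0.
  have -> : L * u = \sum_i c i *: tower (fun a b => \sum_r (dec (s i)).2 a b r * g r).
    rewrite mulr_sumr; apply: eq_bigr => i _; rewrite scAr.
    have [_ hCc {1}->] := hdec (s i) (S0s i).
    rewrite mulrDr !mulrA L2 !mul0r add0r L_tower// => a b.
    by eexists; last reflexivity.
  have Stow i : S (tower (fun a b => \sum_r (dec (s i)).2 a b r * g r)).
    have [_ hCc _] := hdec (s i) (S0s i).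
    apply: S0S; exists 0; first by case: Dstar.
    eexists; last by rewrite mulr0 mul0r add0r.
    by move=> a b; eexists; last reflexivity.
  have [|_ ->] := @rep_sum _ _ _ SA _ _ irr _
    (fun i => c i *: tower (fun a b => \sum_r (dec (s i)).2 a b r * g r)) x.
    by move=> i; case: SA => Scl _ _; exact: (closedZ _ Scl (Stow i)).
  under eq_bigr => i _.
    have [_ hCc _] := hdec (s i) (S0s i).
    rewrite (repZ SA irr _ _ (Stow i)) (pi_tower _ (dec (s i)).2)// scaler_sumr.
    over.
  rewrite exchange_big /= big1// => a _.
  under eq_bigr do rewrite scaler_sumr.
  rewrite exchange_big /= big1// => b _.
  under eq_bigr do rewrite scaler_sumr.
  rewrite exchange_big /= big1// => r _.
  under eq_bigr do rewrite scalerA.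
  by rewrite -scaler_suml (hc (inr (a, b, r))) scale0r.
rewrite h// add0r.
have -> : (1 - L) * u = (1 - L) * (\sum_i c i *: (dec (s i)).1) * (1 - L).
  rewrite !mulr_sumr mulr_suml; apply: eq_bigr => i _; rewrite !scAr scAl.
  have [_ hCc {1}->] := hdec (s i) (S0s i).
  rewrite mulrDr !mulrA L3 -[X in _ + _ * X]L_tower; last first.
    by move=> a b; eexists; last reflexivity.
  by rewrite mulrA L1 mul0r addr0.
apply: hkD => //; first by move=> i; case: (hdec (s i) (S0s i)).
by move=> t; exact: (hc (inl t)).
Qed.

End Subhomogeneous.

End Tower.

(** * Unitaries and exchanges *)

Section OrthogonalSum.
Variables (R : realType) (T : cstarType R).

Lemma nrm_sq_iter k (a : T) : cstar a = a ->
  cstar (iter k (fun x => x * x) a) = iter k (fun x => x * x) a /\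
  nrm (iter k (fun x => x * x) a) = nrm a ^+ (2 ^ k).
Proof.
move=> sa; elim: k => [|k [ih1 ih2]] /=; first by rewrite expr1.
split; first by rewrite starM ih1.
by rewrite -{1}ih1 nrm_starM ih2 -exprM expnS mulnC.
Qed.

Lemma orth_sq_iter k n (b : 'I_n -> T) : (forall i j, i != j -> b i * b j = 0) ->
  iter k (fun x => x * x) (\sum_i b i) = \sum_i iter k (fun x => x * x) (b i).
Proof.
elim: k b => [//|k ih] b orth; rewrite iterSr.
have -> : (\sum_i b i) * (\sum_i b i) = \sum_i b i * b i.
  rewrite mulr_suml; apply: eq_bigr => i _; rewrite mulr_sumr (bigD1 i)//=.
  by rewrite big1 ?addr0// => j ji; rewrite orth// eq_sym.
rewrite ih => [|i j ij]; first by apply: eq_bigr => i _; rewrite -iterSr.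
by rewrite mulrA -[b i * b i * b j]mulrA orth// mulr0 mul0r.
Qed.

Lemma pow_bound (t : R) n : (forall k, t ^+ (2 ^ k) <= n%:R) -> t <= 1.
Proof.
move=> h; rewrite leNgt; apply/negP => t1.
have bern N : 1 + N%:R * (t - 1) <= t ^+ N.
  elim: N => [|N ih]; first by rewrite mul0r addr0.
  rewrite exprS -natr1.
  have N0 : 0 <= N%:R :> R by [].
  have : t * (1 + N%:R * (t - 1)) <= t * t ^+ N by apply: ler_wpM2l => //; lra.
  have := mulr_ge0 N0 (sqr_ge0 (t - 1)); rewrite expr2; nra.
pose K := Num.bound (n%:R / (t - 1)).
have hK : n%:R / (t - 1) < K%:R by apply: archi_boundP; rewrite divr_ge0// subr_ge0 ltW.
have h1 := le_trans (bern (2 ^ K)%N) (h K).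
have h2 : K%:R <= (2 ^ K)%:R :> R by rewrite ler_nat ltnW// ltn_expl.
by move: hK; rewrite ltr_pdivrMr ?subr_gt0//; nra.
Qed.

(** The square of the sum, in the sense of the C*-identity, is a sum of orthogonal self-adjoint
    elements. Raising it to the power [2 ^ k] commutes with norms and with this sum, so the triangle
    inequality costs a factor [n] that does not depend on [k], and [pow_bound] removes it. *)
Lemma nrm_orth_sum n (d : 'I_n -> T) (b : R) :
  (forall i j, i != j -> cstar (d i) * d j = 0) ->
  (forall i j, i != j -> d i * cstar (d j) = 0) ->
  0 < b -> (forall i, nrm (d i) <= b) -> nrm (\sum_i d i) <= b.
Proof.
move=> o1 o2 b0 db.
pose c i := cstar (d i) * d i.
have aa : cstar (\sum_i d i) * (\sum_i d i) = \sum_i c i.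
  rewrite star_sum mulr_suml; apply: eq_bigr => i _; rewrite mulr_sumr (bigD1 i)//=.
  by rewrite big1 ?addr0// => j ji; rewrite o1// eq_sym.
have sc i : cstar (c i) = c i by rewrite starM starK.
have co i j : i != j -> c i * c j = 0.
  by move=> ij; rewrite /c mulrA -[_ * d i * _]mulrA o2// mulr0 mul0r.
have ssum : cstar (\sum_i c i) = \sum_i c i.
  by rewrite star_sum; apply: eq_bigr => i _.
have key k : (nrm (\sum_i d i) ^+ 2) ^+ (2 ^ k) <= n%:R * (b ^+ 2) ^+ (2 ^ k).
  rewrite -nrm_starM aa -(nrm_sq_iter k ssum).2 orth_sq_iter//.
  apply: le_trans (nrm_sum _ _ _) _.
  have -> : n%:R * (b ^+ 2) ^+ (2 ^ k) = \sum_(i < n) (b ^+ 2) ^+ (2 ^ k).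
    by rewrite sumr_const card_ord mulr_natl.
  apply: ler_sum => i _; rewrite (nrm_sq_iter k (sc i)).2 nrm_starM.
  have d0 := nrm_ge0 (d i).
  have db2 : nrm (d i) ^+ 2 <= b ^+ 2.
    by apply: lerXn2r; rewrite ?nnegrE ?(ltW b0)//.
  by apply: lerXn2r; rewrite ?nnegrE ?sqr_ge0//.
have : (nrm (\sum_i d i) / b) ^+ 2 <= 1.
  by apply: (@pow_bound _ n) => k; rewrite !expr_div_n ler_pdivrMr ?exprn_gt0.
rewrite expr_div_n ler_pdivrMr ?exprn_gt0// mul1r.
have := nrm_ge0 (\sum_i d i); rewrite !expr2; nra.
Qed.

(** The last two equations say that [1 + y] is unitary. It is enough that [cstar s * s] acts as the
    identity on [y] and its adjoint; in the applications it is the square of a bump function and not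
    a projection. *)
Lemma conj_unitary (s y : T) : cstar s * s * y = y -> cstar s * s * cstar y = cstar y ->
  y + cstar y + y * cstar y = 0 -> y + cstar y + cstar y * y = 0 ->
  let w := 1 + s * cstar y * cstar s in cstar w * w = 1 /\ w * cstar w = 1.
Proof.
move=> h1 h2 h3 h4 w.
have sw : cstar w = 1 + s * y * cstar s.
  by rewrite starD star1 !starM !starK mulrA.
rewrite sw /w; split.
  transitivity (1 + s * (y + cstar y + y * (cstar s * s * cstar y)) * cstar s).
    by ncring.
  by rewrite h2 h3 mulr0 mul0r addr0.
transitivity (1 + s * (y + cstar y + cstar y * (cstar s * s * y)) * cstar s).
  by ncring.
by rewrite h1 h4 mulr0 mul0r addr0.
Qed.

(** On the projection [q] the skew-adjoint [t] is a square root of -1; the element [r] is [c + s t]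
    there and 1 off [q]. *)
Lemma rotation_unitary (q t : T) (c s : R) : cstar q = q -> cstar t = - t ->
  q * q = q -> t * t = - q -> q * t = t -> t * q = t -> c ^+ 2 + s ^+ 2 = 1 ->
  let r := 1 + (c - 1)%:C *: q + s%:C *: t in cstar r * r = 1 /\ r * cstar r = 1.
Proof.
move=> sq st qq tt qt tq cs r.
have sr : cstar r = 1 + (c - 1)%:C *: q - s%:C *: t.
  have creal (a : R) : Num.conj (a%:C) = a%:C.
    by apply/CrealP; rewrite complex_real.
  by rewrite !starD !starZ star1 sq st !creal scalerN.
pose q' : T := (c - 1)%:C *: q; pose t' : T := s%:C *: t.
have h : q' + q' + q' * q' - t' * t' = 0.
  rewrite /q' /t' !scAl !scAr qq tt !scalerA scalerN opprK -!scalerDl -!rmorphM -!rmorphD /=.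
  have -> : c - 1 + (c - 1) + (c - 1) * (c - 1) + s * s = c ^+ 2 + s ^+ 2 - 1 by ring.
  by rewrite cs subrr scale0r.
have hc : q' * t' = t' * q' by rewrite /q' /t' !scAl !scAr qt tq !scalerA mulrC.
rewrite sr /r -/q' -/t'; split.
  transitivity (1 + (q' + q' + q' * q' - t' * t') + (q' * t' - t' * q')); first by ncring.
  by rewrite h hc subrr !addr0.
transitivity (1 + (q' + q' + q' * q' - t' * t') - (q' * t' - t' * q')); first by ncring.
by rewrite h hc subrr subr0 addr0.
Qed.

(* Up to the factor [- u], [x] is the value at 1 of the Livsic characteristic
   function of the contraction [u * h], whose defect operator is [g]. *)
Lemma livsic_unitary (u h g b : T) : cstar u * u = 1 -> u * cstar u = 1 ->
  cstar h = h -> cstar g = g ->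
  h * g = g * h -> h * h + g * g = 1 -> (u - h) * b = 1 -> b * (u - h) = 1 ->
  let x := h - g * b * g in cstar x * x = 1 /\ x * cstar x = 1.
Proof.
move=> uu uu' sh sg hg hh ub bu x.
have sx : cstar x = h - g * cstar b * g by rewrite starB !starM sh sg mulrA.
have sub : cstar b * (cstar u - h) = 1.
  by rewrite -[in LHS]sh -starB -starM ub star1.
have sbu : (cstar u - h) * cstar b = 1.
  by rewrite -[in LHS]sh -starB -starM bu star1.
have gg : g * g = 1 - h * h by rewrite -hh addrC addKr.
have k1 : - (h * b) - (cstar b * h) + cstar b * (g * g) * b = 1.
  have -> : cstar b * (g * g) * b = cstar b * (1 - h * h) * b by rewrite gg.
  transitivity (cstar b * (1 - h * h - (cstar u - h) * h - h * (u - h)) * b).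
    transitivity (- (cstar b * (cstar u - h)) * h * b
      - cstar b * h * ((u - h) * b) + cstar b * (1 - h * h) * b); last by ncring.
    by rewrite sub ub; ncring.
  have -> : 1 - h * h - (cstar u - h) * h - h * (u - h) = (cstar u - h) * (u - h).
    by rewrite -uu; ncring.
  by rewrite !mulrA sub mul1r ub.
have k2 : - (h * cstar b) - (b * h) + b * (g * g) * cstar b = 1.
  have -> : b * (g * g) * cstar b = b * (1 - h * h) * cstar b by rewrite gg.
  transitivity (b * (1 - h * h - (u - h) * h - h * (cstar u - h)) * cstar b).
    transitivity (- (b * (u - h)) * h * cstar b
      - b * h * ((cstar u - h) * cstar b) + b * (1 - h * h) * cstar b); last by ncring.
    by rewrite bu sbu; ncring.
  have -> : 1 - h * h - (u - h) * h - h * (cstar u - h) = (u - h) * (cstar u - h).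
    by rewrite -uu'; ncring.
  by rewrite !mulrA bu mul1r sbu.
rewrite sx /x; split.
  transitivity (h * h - h * g * b * g - g * cstar b * (g * h) + g * (cstar b * (g * g) * b) * g).
    by ncring.
  have -> : h * g * b * g = g * h * b * g by rewrite hg.
  have -> : g * cstar b * (g * h) = g * cstar b * (h * g) by rewrite hg.
  transitivity (h * h + g * (- (h * b) - (cstar b * h) + cstar b * (g * g) * b) * g).
    by ncring.
  by rewrite k1 mulr1.
transitivity (h * h - h * g * cstar b * g - g * b * (g * h) + g * (b * (g * g) * cstar b) * g).
  by ncring.
have -> : h * g * cstar b * g = g * h * cstar b * g by rewrite hg.
have -> : g * b * (g * h) = g * b * (h * g) by rewrite hg.
transitivity (h * h + g * (- (h * cstar b) - (b * h) + b * (g * g) * cstar b) * g).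
  by ncring.
by rewrite k2 mulr1.
Qed.

End OrthogonalSum.

Section Exchange.
Variables (R : realType) (T : cstarType R) (e a b s k y : T).
Hypotheses (aa : cstar a * a = e) (bb : cstar b * b = e) (ab : cstar a * b = 0)
  (ae : a * e = a) (be : b * e = b) (es : e * s = s) (ss : cstar s * s = k * k)
  (sk : cstar k = k) (ka : k * a = 0) (kb : k * b = 0)
  (ky : k * y = y) (yk : y * k = y)
  (yy : cstar (1 + y) * (1 + y) = 1) (yy' : (1 + y) * cstar (1 + y) = 1).

Let conj_real (r : R) : Num.conj (r%:C) = r%:C.
Proof. by apply/CrealP; rewrite complex_real. Qed.

Let ba : cstar b * a = 0.
Proof. by rewrite -[cstar b * a]starK starM starK ab star0. Qed.
Let bk : cstar b * k = 0. Proof. by rewrite -sk -starM kb star0. Qed.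
Let ksy : k * cstar y = cstar y. Proof. by rewrite -{1}sk -starM yk. Qed.
Let syk : cstar y * k = cstar y. Proof. by rewrite -{1}sk -starM ky. Qed.
Let se : cstar e = e. Proof. by rewrite -aa starM starK. Qed.
Let ee : e * e = e. Proof. by rewrite -{1}aa -mulrA ae aa. Qed.
Let y1 : y + cstar y + y * cstar y = 0.
Proof.
have : (1 + y) * cstar (1 + y) - 1 = 0 by rewrite yy' subrr.
by rewrite starD star1 => <-; ncring.
Qed.
Let y2 : y + cstar y + cstar y * y = 0.
Proof.
have : cstar (1 + y) * (1 + y) - 1 = 0 by rewrite yy subrr.
by rewrite starD star1 => <-; ncring.
Qed.

(** The adjoint of the unitary [1 + y], carried by [s] into the corner of [e]. *)
Definition corner_unitary := e + s * cstar y * cstar s.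

Lemma corner_unitaryP : let w := corner_unitary in
  [/\ cstar w * w = e, w * cstar w = e, e * w = w & w * e = w].
Proof.
have ses : cstar s * e = cstar s by rewrite -se -starM es.
have sw : cstar corner_unitary = e + s * y * cstar s.
  by rewrite starD !starM !starK se mulrA.
have ey : e * (s * y * cstar s) = s * y * cstar s by rewrite !mulrA es.
have ye : s * y * cstar s * e = s * y * cstar s by rewrite -!mulrA ses.
have esy : e * (s * cstar y * cstar s) = s * cstar y * cstar s by rewrite !mulrA es.
have sye : s * cstar y * cstar s * e = s * cstar y * cstar s by rewrite -!mulrA ses.
rewrite /= sw /corner_unitary; split.
- rewrite mulrDl mulrDr ee esy mulrDr ye.
  transitivity (e + s * (y + cstar y + y * (cstar s * s) * cstar y) * cstar s).
    by ncring.
  by rewrite ss [y * (k * k)]mulrA !yk y1 mulr0 mul0r addr0.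
- rewrite mulrDl mulrDr ee ey mulrDr sye.
  transitivity (e + s * (y + cstar y + cstar y * (cstar s * s) * y) * cstar s).
    by ncring.
  by rewrite ss [cstar y * (k * k)]mulrA !syk y2 mulr0 mul0r addr0.
- by rewrite mulrDr ee esy.
- by rewrite mulrDl ee sye.
Qed.

(** Places the support of [y] at its origin for [(1, 0)] and inside the range of [b] for [(0, 1)].
    The two positions are orthogonal, so a point of the circle gives a superposition with the same
    [cstar sigma * sigma]. *)
Definition sigma (c d : R) : T := c%:C *: k + d%:C *: (b * s).

Definition arm c d : T := 1 + sigma c d * cstar y * cstar (sigma c d).

Definition turn (c d : R) : T := 1 + (c - 1)%:C *: (a * cstar a + b * cstar b) +
  d%:C *: (a * cstar b - b * cstar a).

(** The factor [arm] is the adjoint of [1 + y] in the place given by [sigma], and [turn] rotates the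
    range of [b] towards that of [a]. At [(1, 0)] the outer factors cancel. At [(0, 1)] the inverse
    of the defect sits in the range of [b]: there [b] is sent to [a] times the corner unitary, while
    the factor [1 + y] is left alone near the cut. *)
Definition exchange c d : T := (1 + y) * turn c d * arm c d.

Lemma sigma_star c d : cstar (sigma c d) = c%:C *: k + d%:C *: (cstar s * cstar b).
Proof. by rewrite starD !starZ !conj_real sk starM. Qed.

Lemma sigma_sigma c d : c ^+ 2 + d ^+ 2 = 1 -> cstar (sigma c d) * sigma c d = k * k.
Proof.
move=> cd; rewrite sigma_star /sigma mulrDl !mulrDr !scAl !scAr !scalerA.
have -> : k * (b * s) = 0 by rewrite mulrA kb mul0r.
have -> : cstar s * cstar b * k = 0 by rewrite -mulrA bk mulr0.
have -> : cstar s * cstar b * (b * s) = k * k.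
  by rewrite -mulrA [cstar b * _]mulrA bb es ss.
rewrite !scaler0 addr0 add0r -scalerDl -!rmorphM -rmorphD -!expr2 cd.
by rewrite scale1r.
Qed.

Lemma arm_unitary c d : c ^+ 2 + d ^+ 2 = 1 ->
  cstar (arm c d) * arm c d = 1 /\ arm c d * cstar (arm c d) = 1.
Proof.
move=> cd; apply: conj_unitary; rewrite ?sigma_sigma//.
- by rewrite -mulrA ky ky.
- by rewrite -mulrA ksy ksy.
Qed.

Let q := a * cstar a + b * cstar b.
Let r := a * cstar b - b * cstar a.

Let prod (w x : T) (v z : T) : w * cstar x * (v * cstar z) = w * (cstar x * v) * cstar z.
Proof. by rewrite !mulrA. Qed.

Lemma turn_unitary c d : c ^+ 2 + d ^+ 2 = 1 ->
  cstar (turn c d) * turn c d = 1 /\ turn c d * cstar (turn c d) = 1.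
Proof.
move=> cd; apply: rotation_unitary => //.
- by rewrite starD !starM !starK.
- by rewrite starB !starM !starK opprB.
- by rewrite mulrDl !mulrDr !prod aa bb ab ba ae be !mulr0 !mul0r addr0 add0r.
- rewrite mulrBl !mulrBr !prod aa bb ab ba ae be !mulr0 !mul0r !sub0r subr0.
  by rewrite opprD.
- by rewrite mulrDl !mulrBr !prod aa bb ab ba ae be !mulr0 !mul0r !sub0r subr0.
- by rewrite mulrBl !mulrDr !prod aa bb ab ba ae be !mulr0 !mul0r !addr0 !add0r.
Qed.

Lemma exchange_unitary c d : c ^+ 2 + d ^+ 2 = 1 ->
  cstar (exchange c d) * exchange c d = 1 /\ exchange c d * cstar (exchange c d) = 1.
Proof.
move=> cd; have [t1 t2] := turn_unitary cd; have [x1 x2] := arm_unitary cd.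
rewrite /exchange !starM; split; rewrite !mulrA.
  rewrite -[_ * cstar (1 + y) * _]mulrA yy mulr1 -[_ * cstar (turn c d) * _]mulrA.
  by rewrite t1 mulr1.
rewrite -[_ * arm c d * _]mulrA x2 mulr1 -[_ * turn c d * _]mulrA t2 mulr1.
exact: yy'.
Qed.

Lemma exchange10 : exchange 1 0 = 1.
Proof.
rewrite /exchange /turn /arm sigma_star /sigma subrr !scale0r !addr0 !scale1r mulr1.
by rewrite ksy syk; move: yy'; rewrite starD star1.
Qed.

Lemma exchange01_top : exchange 0 1 * b = a * corner_unitary.
Proof.
rewrite /exchange /turn /arm sigma_star /sigma sub0r rmorphN !scale0r !scale1r !add0r.
rewrite scaleN1r -!mulrA.
have -> : (1 + b * (s * (cstar y * (cstar s * cstar b)))) * b = b * corner_unitary.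
  rewrite mulrDl mul1r -!mulrA bb /corner_unitary mulrDr be -!mulrA.
  have -> : cstar s * e = cstar s by rewrite -se -starM es.
  by [].
rewrite [_ * (b * _)]mulrA.
have -> : (1 - (a * cstar a + b * cstar b) + (a * cstar b - b * cstar a)) * b = a.
  transitivity (b - a * (cstar a * b) - b * (cstar b * b) + a * (cstar b * b) -
      b * (cstar a * b)); first by ncring.
  by rewrite ab bb be ae !mulr0 !subr0 subrr add0r.
rewrite mulrA; congr (_ * _); rewrite mulrDl mul1r.
by rewrite -{1}yk -mulrA ka mulr0 addr0.
Qed.

(** With the arm gone, [u] times what remains starts with [u * (1 + y)], which belongs to the
    algebra of cut orbits. *)
Lemma exchange01_away z : cstar b * z = 0 -> exchange 0 1 * z = (1 + y) * turn 0 1 * z.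
Proof.
move=> bz; rewrite /exchange /arm sigma_star scale0r add0r scale1r -mulrA.
congr (_ * _); rewrite mulrDl mul1r -!mulrA bz !mulr0 addr0//.
Qed.

Lemma exchange01_fix z : cstar a * z = 0 -> cstar b * z = 0 -> k * z = 0 ->
  exchange 0 1 * z = z.
Proof.
move=> az bz kz; rewrite exchange01_away// -mulrA.
have -> : turn 0 1 * z = z.
  rewrite /turn sub0r rmorphN scaleN1r scale1r !(mulrDl, mulNr) mul1r.
  by rewrite -!mulrA az bz !mulr0 !(oppr0, addr0).
by rewrite mulrDl mul1r -{1}yk -mulrA kz mulr0 addr0.
Qed.

Lemma exchange_under p : cstar p = p -> p * a = a -> p * b = b -> p * k = k -> forall c d,
  p * (exchange c d - 1) = exchange c d - 1 /\ (exchange c d - 1) * p = exchange c d - 1.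
Proof.
move=> sp pa pb pk c d.
have ap : cstar a * p = cstar a by rewrite -{1}sp -starM pa.
have bp : cstar b * p = cstar b by rewrite -{1}sp -starM pb.
have kp : k * p = k by rewrite -{1}sk -{1}sp -starM pk sk.
have py : p * y = y by rewrite -ky mulrA pk.
have yp : y * p = y by rewrite -yk -mulrA kp.
have h1 : p * (turn c d - 1) = turn c d - 1 /\ (turn c d - 1) * p = turn c d - 1.
  have -> : turn c d - 1 = (c - 1)%:C *: (a * cstar a + b * cstar b) +
      d%:C *: (a * cstar b - b * cstar a) by rewrite /turn; ncring.
  split.
    by rewrite mulrDr !scAr mulrDr mulrBr !mulrA pa pb.
  by rewrite mulrDl !scAl mulrDl mulrBl -!mulrA ap bp.
have psg : p * sigma c d = sigma c d by rewrite /sigma mulrDr !scAr mulrA pk pb.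
have h2 : p * (arm c d - 1) = arm c d - 1 /\ (arm c d - 1) * p = arm c d - 1.
  rewrite /arm [1 + _]addrC addrK; split; first by rewrite !mulrA psg.
  by rewrite -!mulrA -{1}sp -starM psg.
have [h1l h1r] := h1; have [h2l h2r] := h2.
have -> : exchange c d - 1 = y + (turn c d - 1) + y * (turn c d - 1) + (arm c d - 1) +
    y * (arm c d - 1) + (turn c d - 1) * (arm c d - 1) +
    y * (turn c d - 1) * (arm c d - 1) by rewrite /exchange; ncring.
move: (turn c d - 1) (arm c d - 1) h1l h1r h2l h2r => v w vl vr wl wr.
by split; rewrite !(mulrDr, mulrDl) ?(mulrA p) ?(mulrA (p * y)) ?py ?vl ?wl// -!mulrA yp ?vr ?wr.
Qed.

Lemma exchange_comm g : (forall z, z = a \/ z = b \/ z = s \/ z = k \/ z = y ->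
    g * z = z * g /\ g * cstar z = cstar z * g) ->
  forall c d, g * exchange c d = exchange c d * g.
Proof.
move=> gc c d.
have commM w z : g * w = w * g -> g * z = z * g -> g * (w * z) = w * z * g.
  by move=> hw hz; rewrite mulrA hw -mulrA hz mulrA.
have commD w z : g * w = w * g -> g * z = z * g -> g * (w + z) = (w + z) * g.
  by move=> hw hz; rewrite mulrDr mulrDl hw hz.
have commN w : g * w = w * g -> g * (- w) = - w * g by rewrite mulrN mulNr => ->.
have commZ (l : R[i]) w : g * w = w * g -> g * (l *: w) = l *: w * g.
  by rewrite scAr scAl => ->.
have comm1 : g * 1 = 1 * g by rewrite mulr1 mul1r.
have [a1 a2] : g * a = a * g /\ g * cstar a = cstar a * g by apply: gc; left.
have [b1 b2] : g * b = b * g /\ g * cstar b = cstar b * g by apply: gc; right; left.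
have [s1 s2] : g * s = s * g /\ g * cstar s = cstar s * g.
  by apply: gc; right; right; left.
have [k1 _] : g * k = k * g /\ g * cstar k = cstar k * g.
  by apply: gc; do 3 right; left.
have [yy1 yy2] : g * y = y * g /\ g * cstar y = cstar y * g.
  by apply: gc; do 4 right.
apply: (commM); first apply: (commM).
- exact: (commD).
- rewrite /turn; apply: (commD); first apply: (commD) => //; apply: (commZ); apply: (commD) => //.
  + exact: (commM).
  + exact: (commM).
  + exact: (commM).
  + by apply: (commN); exact: (commM).
- apply: (commD) => //; apply: (commM).
    apply: (commM) => //; apply: (commD); first exact: (commZ).
    by apply: (commZ); exact: (commM).
  rewrite sigma_star; apply: (commD); first exact: (commZ).
  by apply: (commZ); exact: (commM).
Qed.

Hypothesis k1 : nrm k <= 1.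

(** Of the constant 6, [turn] contributes 2 and [arm] 4: [sigma] enters [arm] twice and [nrm y] is
    bounded by 2. *)
Lemma exchange_close c d c' d' : c ^+ 2 + d ^+ 2 = 1 -> c' ^+ 2 + d' ^+ 2 = 1 ->
  nrm (exchange c' d' - exchange c d) <= 6%:R * (`|c' - c| + `|d' - d|).
Proof.
move=> cd cd'.
have [[t1 _] [x1 _]] := (turn_unitary cd, arm_unitary cd').
have ne : nrm e <= 1 by have := nrm_starM e; rewrite se ee; have := nrm_ge0 e; nra.
have nsq (w : T) : nrm (cstar w * w) <= 1 -> nrm w <= 1.
  by rewrite nrm_starM; have := nrm_ge0 w; nra.
have na : nrm a <= 1 by apply: nsq; rewrite aa.
have nb : nrm b <= 1 by apply: nsq; rewrite bb.
have nM (w z : T) : nrm w <= 1 -> nrm z <= 1 -> nrm (w * z) <= 1.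
  by move=> hw hz; apply: le_trans (nrmM _ _) _; rewrite mulr_ile1 ?nrm_ge0.
have ns : nrm s <= 1 by apply: nsq; rewrite ss; exact: nM.
have nsa : nrm (cstar a) <= 1 by rewrite nrm_star.
have nsb : nrm (cstar b) <= 1 by rewrite nrm_star.
have nx : nrm (1 + y) <= 1 by exact: nrm_isometry.
have ny : nrm y <= 2%:R.
  have -> : y = (1 + y) - 1 by rewrite addrC addKr.
  apply: le_trans (nrmB _ _) _; have := nrm1_le1 T; lra.
have nsig u v : u ^+ 2 + v ^+ 2 = 1 -> nrm (sigma u v) <= 1.
  by move=> uv; apply: nsq; rewrite sigma_sigma//; exact: nM.
have scB (u v : R) (w : T) : (u - v)%:C *: w = u%:C *: w - v%:C *: w.
  by rewrite rmorphB scalerBl.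
have dt : nrm (turn c' d' - turn c d) <= 2%:R * (`|c' - c| + `|d' - d|).
  have -> : turn c' d' - turn c d = (c' - c)%:C *: q + (d' - d)%:C *: r.
    rewrite /turn -/q -/r.
    have -> : c' - c = (c' - 1) - (c - 1) by ring.
    rewrite (scB (c' - 1)) (scB d').
    set q1 := (c' - 1)%:C *: q; set q2 := (c - 1)%:C *: q; set r1 := _ *: r; set r2 := _ *: r.
    by clearbody q1 q2 r1 r2; ncring.
  apply: le_trans (nrmD _ _) _; rewrite !nrmZ_real.
  have nq : nrm q <= 2%:R.
    by apply: le_trans (nrmD _ _) _; have := nM _ _ na nsa; have := nM _ _ nb nsb; lra.
  have nr : nrm r <= 2%:R.
    by apply: le_trans (nrmB _ _) _; have := nM _ _ na nsb; have := nM _ _ nb nsa; lra.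
  have := normr_ge0 (c' - c); have := normr_ge0 (d' - d); nra.
have ds : nrm (sigma c' d' - sigma c d) <= `|c' - c| + `|d' - d|.
  have -> : sigma c' d' - sigma c d = (c' - c)%:C *: k + (d' - d)%:C *: (b * s).
    by rewrite /sigma !scB opprD addrACA.
  apply: le_trans (nrmD _ _) _; rewrite !nrmZ_real.
  by have nbs := nM _ _ nb ns; apply: lerD; rewrite ler_piMr.
have dx : nrm (arm c' d' - arm c d) <= 4%:R * (`|c' - c| + `|d' - d|).
  pose sd := sigma c' d' - sigma c d.
  have -> : arm c' d' - arm c d = sd * cstar y * cstar (sigma c' d') +
      sigma c d * cstar y * cstar sd.
    by rewrite /arm /sd starB; ncring.
  have n1 (w z : T) : nrm z <= 1 -> nrm (w * cstar y * z) <= 2%:R * nrm w.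
    move=> hz; apply: le_trans (nrmM _ _) _; have := nrmM w (cstar y).
    rewrite nrm_star; have := nrm_ge0 w; have := nrm_ge0 (w * cstar y).
    have := nrm_ge0 z; nra.
  apply: le_trans (nrmD _ _) _.
  have hs' : nrm (cstar (sigma c' d')) <= 1 by rewrite nrm_star; exact: nsig.
  have -> : nrm (sigma c d * cstar y * cstar sd) = nrm (sd * y * cstar (sigma c d)).
    by rewrite -[in RHS]nrm_star !starM !starK mulrA.
  have hs : nrm (cstar (sigma c d)) <= 1 by rewrite nrm_star; exact: nsig.
  have n2 : nrm (sd * y * cstar (sigma c d)) <= 2%:R * nrm sd.
    apply: le_trans (nrmM _ _) _; have := nrmM sd y.
    have := nrm_ge0 sd; have := nrm_ge0 (sd * y).
    have := nrm_ge0 (cstar (sigma c d)); nra.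
  by have := n1 sd _ hs'; rewrite /sd in n2 *; lra.
have -> : exchange c' d' - exchange c d =
    (1 + y) * ((turn c' d' - turn c d) * arm c' d') +
    (1 + y) * turn c d * (arm c' d' - arm c d) by rewrite /exchange; ncring.
apply: le_trans (nrmD _ _) _.
have n1 (w z : T) : nrm w <= 1 -> nrm (w * z) <= nrm z.
  move=> hw; apply: le_trans (nrmM _ _) _.
  by have := nrm_ge0 w; have := nrm_ge0 z; nra.
have h1 := n1 _ ((turn c' d' - turn c d) * arm c' d') nx.
have h2 := n1 _ (arm c' d' - arm c d) (nM _ _ nx (nrm_isometry t1)).
have h3 : nrm ((turn c' d' - turn c d) * arm c' d') <= nrm (turn c' d' - turn c d).
  apply: le_trans (nrmM _ _) _; have := nrm_isometry x1.
  have := nrm_ge0 (turn c' d' - turn c d); nra.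
lra.
Qed.

End Exchange.

Section Bicommutant.
Variables (R : realType) (T : cstarType R) (e w : T).
Hypotheses (ee : e * e = e) (se : cstar e = e)
  (ww : cstar w * w = e) (ww' : w * cstar w = e) (ew : e * w = w) (we : w * e = w).

(** A commutative algebra containing the unitary [w] of the corner. In this form, whatever commutes
    with [w] and its adjoint commutes with the whole algebra by definition, and no description of
    the algebra generated by [w] is required. *)
Definition bicommutant : set T := [set c | [/\ e * c = c, c * e = c &
  forall x, x * w = w * x -> x * cstar w = cstar w * x -> c * x = x * c]].

Lemma bicommutant_star : star_algebra bicommutant.
Proof.
split.
- by split=> [||x _ _]; rewrite ?mulr0 ?mul0r.
- move=> c x x' [h1 h2 h3] [h1' h2' h3']; split.
  + by rewrite mulrDr scAr h1 h1'.
  + by rewrite mulrDl scAl h2 h2'.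
  + by move=> v hv hv'; rewrite mulrDl mulrDr scAl scAr h3// h3'.
- move=> x x' [h1 h2 h3] [h1' h2' h3']; split.
  + by rewrite mulrA h1.
  + by rewrite -mulrA h2'.
  + by move=> v hv hv'; rewrite -mulrA h3'// mulrA h3// mulrA.
- move=> x [h1 h2 h3]; split.
  + by rewrite -{1}se -starM h2.
  + by rewrite -{1}se -starM h1.
  + move=> v hv hv'; rewrite -[v]starK -!starM h3//.
      by rewrite -[w]starK -!starM hv'.
    by rewrite -!starM hv.
Qed.

Lemma bicommutant_mem : bicommutant w.
Proof. by split => // x ->. Qed.

Lemma bicommutant_unit : bicommutant e.
Proof.
split; rewrite ?ee// => x h1 h2.
by rewrite -ww -mulrA -h1 mulrA -h2 mulrA.
Qed.

Lemma bicommutant_comm c c' : bicommutant c -> bicommutant c' -> c * c' = c' * c.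
Proof.
move=> [_ _ h] [_ _ h']; apply: h; apply: h' => //; first by rewrite ww ww'.
by rewrite ww ww'.
Qed.

End Bicommutant.

Section UnitaryConjugate.
Variables (R : realType) (T : cstarType R) (S : set T) (Q : T).
Hypotheses (Salg : cstar_subalgebra S) (Q1 : cstar Q * Q = 1) (Q2 : Q * cstar Q = 1).

Let S' : set T := [set s | S (cstar Q * s * Q)].

Lemma conj_cstar_subalgebra : cstar_subalgebra S'.
Proof.
have [[Scl S0 Slin] SM Sstar] := Salg.
have nQ := nrm_isometry Q1.
have nQs : nrm (cstar Q) <= 1 by rewrite nrm_star.
split; first split.
- apply/closedE => x hx; move/closedE: Scl; apply => e /hx[y Sy xy].
  exists (cstar Q * y * Q) => //; apply: le_lt_trans xy.
  rewrite -mulrBl -mulrBr; apply: le_trans (nrmM _ _) _.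
  apply: le_trans (ler_piMr (nrm_ge0 _) nQ) _.
  by apply: le_trans (nrmM _ _) _; rewrite ler_piMl ?nrm_ge0.
- by rewrite /S' /= mulr0 mul0r.
- move=> a x y hx hy; rewrite /S' /= mulrDr mulrDl scAr scAl; exact: Slin.
- move=> x y hx hy; rewrite /S' /=.
  have -> : cstar Q * (x * y) * Q = (cstar Q * x * Q) * (cstar Q * y * Q).
    by rewrite !mulrA -[_ * Q * cstar Q]mulrA Q2 mulr1.
  exact: SM.
- move=> x /Sstar; rewrite /S' /= !starM starK mulrA; exact.
Qed.

Lemma conj_subhomogeneous : subhomogeneous S -> subhomogeneous S'.
Proof.
case=> n hn; exists n => H pi [[pi1 pi2 pi3 pi4] pi5 pi6].
have S'S s : S s -> S' (Q * s * cstar Q).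
  by move=> Ss; rewrite /S' /= !mulrA Q1 mul1r -mulrA Q1 mulr1.
have S'E s : S' s -> exists2 t, S t & s = Q * t * cstar Q.
  by move=> hs; exists (cstar Q * s * Q) => //; rewrite !mulrA Q2 mul1r -mulrA Q2 mulr1.
apply: (hn H (fun s => pi (Q * s * cstar Q))); split; first split.
- by move=> s /S'S; exact: pi1.
- by move=> c a b x Sa Sb; rewrite mulrDr mulrDl scAr scAl; apply: pi2; exact: S'S.
- move=> a b x Sa Sb.
  have -> : Q * (a * b) * cstar Q = (Q * a * cstar Q) * (Q * b * cstar Q).
    by rewrite !mulrA -[_ * cstar Q * Q]mulrA Q1 mulr1.
  by apply: pi3; exact: S'S.
- move=> a x y Sa; rewrite pi4; last exact: S'S.
  by rewrite !starM starK mulrA.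
- have [s /S'E[t St ->] ex] := pi5; by exists t.
- move=> W Wc hW; apply: pi6 => // s x /S'E[t St ->] Wx; exact: hW.
Qed.

End UnitaryConjugate.

Section Zit.
Variables (A : Type) (f g : A -> A).
Hypotheses (fK : cancel f g) (gK : cancel g f).

(** Serves both for the integer iterates of the homeomorphism and, applied to left multiplication by
    [u], for the integer powers of [u]. *)
Definition zit (j : int) (x : A) : A :=
  match j with Posz n => iter n f x | Negz n => iter n.+1 g x end.

Lemma zitS j x : zit (j + 1) x = f (zit j x).
Proof.
case: j => [n|[|n]].
- by have -> : Posz n + 1 = Posz n.+1 by lia.
- by rewrite [zit (Negz 0) x]/= gK.
- have -> : Negz n.+1 + 1 = Negz n by lia.
  by rewrite [zit (Negz n.+1) x]/= gK.
Qed.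

Lemma zitP j x : zit (j - 1) x = g (zit j x).
Proof. by have := zitS (j - 1) x; rewrite subrK => ->; rewrite fK. Qed.

Lemma zitD i j x : zit (i + j) x = zit i (zit j x).
Proof.
elim/int_ind: i => [|n ih|n ih]; first by rewrite add0r.
  have -> : n.+1%:Z + j = n%:Z + j + 1 by lia.
  by rewrite zitS ih.
have -> : - n.+1%:Z = - n%:Z - 1 by lia.
have -> : - n%:Z - 1 + j = - n%:Z + j - 1 by lia.
by rewrite !zitP ih.
Qed.

Lemma zitK j x : zit (- j) (zit j x) = x.
Proof. by rewrite -zitD addNr. Qed.

Lemma zitNK j x : zit j (zit (- j) x) = x.
Proof. by rewrite -zitD addrN. Qed.

End Zit.

(** * Covariant pairs and broken orbits *)

Section ContinuousFunctions.
Variables (R : realType) (X : topologicalType).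

Lemma nrm_realC (a : R) : nrm (a%:C : R[i]^o) = `|a|.
Proof. by rewrite /nrm normc_def /= expr0n addr0 sqrtr_sqr. Qed.

Lemma nrm_mulC (a b : R[i]^o) : nrm (a * b : R[i]^o) = nrm a * nrm b.
Proof. exact: (nrmZ a b). Qed.

Lemma nrm_conj (a : R[i]^o) : nrm (Num.conj a : R[i]^o) = nrm a.
Proof. by apply: complexI; rewrite -!nrmE norm_conjC. Qed.

Definition cont_nrm (V : normedModType R[i]) (f : X -> V) :=
  forall x (e : R), 0 < e -> nbhs x [set y | nrm (f x - f y) < e].

Lemma cont_nrmP (V : normedModType R[i]) (f : X -> V) :
  continuous f <-> cont_nrm f.
Proof.
split=> [fc x e e0|h x A /nbhs_nrm[e e0 eA]].
  have h : nbhs (f x) [set z | nrm (f x - z) < e] by apply/nbhs_nrm; exists e.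
  exact: fc x _ h.
have : nbhs x (f @^-1` A) by apply: (filterS _ (h x e e0)) => y; exact: eA.
by [].
Qed.

Definition cont_abs (r : X -> R) :=
  forall x (e : R), 0 < e -> nbhs x [set y | `|r x - r y| < e].

Lemma cont_absP (r : X -> R) : continuous r <-> cont_abs r.
Proof.
split=> [rc x e e0|h x A].
  by have h := rc x _ (nbhsx_ballx (r x) _ e0).
rewrite -nbhs_ballE => -[e e0 eA].
have : nbhs x (r @^-1` A) by apply: (filterS _ (h x e e0)) => y; exact: eA.
by [].
Qed.

(* Wrapping [continuous] stops unification from unfolding the topologies. *)
Variant contC (f : X -> R[i]^o) : Prop := ContC of continuous f.
Variant contR (r : X -> R) : Prop := ContR of continuous r.

Lemma contC_real r : contR r -> contC (fun x => (r x)%:C).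
Proof.
move=> [/cont_absP rc]; split; apply/cont_nrmP => x e e0.
apply: filterS (rc x e e0) => y /=.
by rewrite -rmorphB nrm_realC.
Qed.

Lemma contC_add f g : contC f -> contC g -> contC (fun x => f x + g x).
Proof. by move=> [fc] [gc]; split=> x; apply: continuousD; [exact: fc|exact: gc]. Qed.

Lemma contC_mul f g : contC f -> contC g -> contC (fun x => f x * g x).
Proof. by move=> [fc] [gc]; split=> x; apply: continuousM; [exact: fc|exact: gc]. Qed.

Lemma contC_cst c : contC (fun _ => c).
Proof. by split=> x; exact: cvg_cst. Qed.

Lemma contC_opp f : contC f -> contC (fun x => - f x).
Proof.
move=> fc; have := contC_mul (contC_cst (-1)) fc.
by under eq_fun do rewrite mulN1r.
Qed.

Lemma contC_conj f : contC f -> contC (fun x => Num.conj (f x)).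
Proof.
move=> [/cont_nrmP fc]; split; apply/cont_nrmP => x e e0.
apply: filterS (fc x e e0) => y /=.
by rewrite -rmorphB nrm_conj.
Qed.

Lemma contC_sum n (f : 'I_n -> X -> R[i]^o) : (forall i, contC (f i)) ->
  contC (fun x => \sum_i f i x).
Proof.
elim: n f => [|n ih] f fc.
  by under eq_fun do rewrite big_ord0; exact: contC_cst.
under eq_fun do rewrite big_ord_recl.
by apply: contC_add => //; exact: ih.
Qed.

Lemma contC_comp f (a : X -> X) : contC f -> continuous a -> contC (fun x => f (a x)).
Proof. by move=> [fc] ac; split=> x; apply: continuous_comp; [exact: ac|exact: fc]. Qed.

Lemma contR_nrm f : contC f -> contR (fun x => nrm (f x)).
Proof.
move=> [/cont_nrmP fc]; split; apply/cont_absP => x e e0.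
apply: filterS (fc x e e0) => y /=; apply: le_lt_trans.
have h1 := nrm_tri (f x) (f y) 0; have h2 := nrm_tri (f y) (f x) 0.
rewrite !subr0 (nrmBC (f y)) in h1 h2.
by rewrite ler_norml; apply/andP; split; lra.
Qed.

Lemma contR_add r s : contR r -> contR s -> contR (fun x => r x + s x).
Proof. by move=> [rc] [sc]; split=> x; apply: continuousD; [exact: rc|exact: sc]. Qed.

Lemma contR_mul r s : contR r -> contR s -> contR (fun x => r x * s x).
Proof. by move=> [rc] [sc]; split=> x; apply: continuousM; [exact: rc|exact: sc]. Qed.

Lemma contR_cst c : contR (fun _ => c).
Proof. by split=> x; exact: cvg_cst. Qed.

Lemma contR_opp r : contR r -> contR (fun x => - r x).
Proof. by move=> [rc]; split=> x; apply: continuousN; exact: rc. Qed.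

Lemma contR_inv r : contR r -> (forall x, r x != 0) -> contR (fun x => (r x)^-1).
Proof. by move=> [rc] r0; split=> x; apply: continuousV; [exact: r0|exact: rc]. Qed.

Lemma contR_max r s : contR r -> contR s -> contR (fun x => Num.max (r x) (s x)).
Proof. by move=> [rc] [sc]; split=> x; apply: continuous_max; [exact: rc|exact: sc]. Qed.

Lemma contR_min r s : contR r -> contR s -> contR (fun x => Num.min (r x) (s x)).
Proof. by move=> [rc] [sc]; split=> x; apply: continuous_min; [exact: rc|exact: sc]. Qed.

Lemma contR_sqrt r : contR r -> contR (fun x => Num.sqrt (r x)).
Proof.
by move=> [rc]; split=> x; apply: continuous_comp; [exact: rc|exact: sqrt_continuous].
Qed.

Lemma contR_comp r (a : X -> X) : contR r -> continuous a -> contR (fun x => r (a x)).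
Proof. by move=> [rc] ac; split=> x; apply: continuous_comp; [exact: ac|exact: rc]. Qed.

Lemma contR_sum (I : Type) (l : seq I) (P : pred I) (r : I -> X -> R) :
  (forall i, contR (r i)) -> contR (fun x => \sum_(i <- l | P i) r i x).
Proof.
move=> rc; elim: l => [|i l ih].
  by under eq_fun do rewrite big_nil; exact: contR_cst.
under eq_fun do rewrite big_cons.
by case: (P i) => //; exact: contR_add.
Qed.

Lemma contR_prod (I : Type) (l : seq I) (P : pred I) (r : I -> X -> R) :
  (forall i, contR (r i)) -> contR (fun x => \prod_(i <- l | P i) r i x).
Proof.
move=> rc; elim: l => [|i l ih].
  by under eq_fun do rewrite big_nil; exact: contR_cst.
under eq_fun do rewrite big_cons.
by case: (P i) => //; exact: contR_mul.
Qed.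

End ContinuousFunctions.

(** If [Q] failed for the whole space, the complements of the sets satisfying [Q] would form a
    proper filter. At a cluster point of it, the neighbourhood satisfying [Q] would meet its own
    complement. *)
Lemma compact_induction (X : topologicalType) (Q : set X -> Prop) :
  compact [set: X] -> Q set0 -> (forall A B, Q A -> Q B -> Q (A `|` B)) ->
  (forall A B, A `<=` B -> Q B -> Q A) ->
  (forall x : X, exists2 V : set X, nbhs x V & Q V) -> Q [set: X].
Proof.
move=> Xc Q0 QU QS Qloc; apply: contrapT => nQ.
pose F : set (set X) := [set A | Q (~` A)].
have FF : ProperFilter F.
  split; first by rewrite /F /= setC0.
  split; rewrite /F /=; first by rewrite setCT.
    by move=> A B QA QB; have := QU _ _ QA QB; rewrite -setCI.
  by move=> A B AB; apply: QS; exact: subsetC.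
have [|x [_ xF]] := Xc F FF; first by rewrite /F /= setCT.
have [V xV QV] := Qloc x.
have [|y [/= nVy Vy]] := xF (~` V) V _ xV; first by rewrite /F /= setCK.
exact: nVy.
Qed.

Section CovariantPair.
Variables (R : realType) (X : topologicalType) (al be : X -> X).
Hypotheses (alK : cancel al be) (beK : cancel be al)
  (alc : continuous al) (bec : continuous be).
Variables (T : cstarType R) (phi : (X -> R[i]^o) -> T) (u : T).
Hypothesis cov : covariant_pair al phi u.
Implicit Types f g : X -> R[i]^o.

Lemma phi_lin (a : R[i]) f g : contC f -> contC g ->
  phi (fun x => a * f x + g x) = a *: phi f + phi g.
Proof. by case: cov => [[h _ _ _] _ _] [fc] [gc]; exact: h. Qed.

Lemma phiM f g : contC f -> contC g ->
  phi (fun x => f x * g x) = phi f * phi g.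
Proof. by case: cov => [[_ h _ _] _ _] [fc] [gc]; exact: h. Qed.

Lemma phi1 : phi (fun=> 1) = 1.
Proof. by case: cov => [[]]. Qed.

Lemma phi_star f : contC f -> phi (fun x => Num.conj (f x)) = cstar (phi f).
Proof. by case: cov => [[_ _ _ h] _ _] [fc]; exact: h. Qed.

Lemma phiD f g : contC f -> contC g ->
  phi (fun x => f x + g x) = phi f + phi g.
Proof.
move=> fc gc; have := phi_lin 1 fc gc; rewrite scale1r => <-; congr phi.
by apply/funext => x; rewrite mul1r.
Qed.

Lemma phi0 : phi (fun=> 0) = 0.
Proof.
have := phiD (contC_cst X 0) (contC_cst X (0 : R[i]^o)).
under [X in phi X]eq_fun do rewrite addr0.
by move=> /(congr1 (fun y => y - phi (fun=> 0))); rewrite addrK subrr.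
Qed.

Lemma phiZ (a : R[i]) f : contC f -> phi (fun x => a * f x) = a *: phi f.
Proof.
move=> fc; have := phi_lin a fc (contC_cst X (0 : R[i]^o)).
rewrite phi0 addr0 => <-; congr phi.
by apply/funext => x; rewrite addr0.
Qed.

Lemma phiN f : contC f -> phi (fun x => - f x) = - phi f.
Proof.
move=> fc; have := phiZ (-1) fc; rewrite scaleN1r => <-; congr phi.
by apply/funext => x; rewrite mulN1r.
Qed.

Lemma phi_sum n (f : 'I_n -> X -> R[i]^o) : (forall i, contC (f i)) ->
  phi (fun x => \sum_i f i x) = \sum_i phi (f i).
Proof.
elim: n f => [|n ih] f fc.
  rewrite big_ord0 -phi0; congr phi; apply/funext => x; by rewrite big_ord0.
have fc' i : contC (f (lift ord0 i)) by [].
have := phiD (fc ord0) (contC_sum fc'); rewrite ih// big_ord_recl => <-.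
by congr phi; apply/funext => x; rewrite big_ord_recl.
Qed.

Lemma uu : cstar u * u = 1. Proof. by case: cov => _ []. Qed.
Lemma uu' : u * cstar u = 1. Proof. by case: cov => _ []. Qed.

Lemma u_phi f : contC f -> u * phi (fun x => f (al x)) = phi f * u.
Proof.
move=> [fc]; case: cov => _ _ h.
by rewrite -(h f fc) -mulrA uu mulr1.
Qed.

Lemma phi_real_star (q : X -> R) : contR q ->
  cstar (phi (fun x => (q x)%:C)) = phi (fun x => (q x)%:C).
Proof.
move=> qc; have <- := phi_star (contC_real qc).
by congr phi; apply/funext => x; apply/CrealP; rewrite complex_real.
Qed.

(** [phi] comes with no continuity assumption; the bound follows as in [star_hom_contract], from the
    unitary function [r + i s] with [r ^ 2 + s ^ 2 = 1]. *)
Lemma nrm_phi_real (r : X -> R) : contR r -> (forall x, `|r x| <= 1) ->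
  nrm (phi (fun x => (r x)%:C)) <= 1.
Proof.
move=> rc r1.
pose s x := Num.sqrt (1 - r x * r x).
have sc : contR s.
  apply/contR_sqrt/contR_add; first exact: contR_cst.
  exact/contR_opp/contR_mul.
have rs x : r x * r x + s x * s x = 1.
  rewrite -[s x * _]expr2 sqr_sqrtr; first by rewrite addrC subrK.
  have := r1 x; rewrite ler_norml subr_ge0 => /andP[]; nra.
have rcc := contC_real rc; have scc := contC_real sc.
pose P := phi (fun x => (r x)%:C); pose S := phi (fun x => (s x)%:C).
have PS : P * P + S * S = 1.
  have h1 := phiM rcc rcc; have h2 := phiM scc scc.
  have h3 := phiD (contC_mul rcc rcc) (contC_mul scc scc).
  rewrite h1 h2 -/P -/S in h3; rewrite -h3 -phi1; congr phi; apply/funext => x.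
  by rewrite -!rmorphM -rmorphD /= rs.
have PSc : P * S = S * P.
  have h1 := phiM rcc scc; have h2 := phiM scc rcc.
  rewrite -/P -/S in h1 h2; rewrite -h1 -h2; congr phi.
  by apply/funext => x; rewrite mulrC.
pose c : T := 'i%C *: S.
have cc : c * c = - (S * S).
  by rewrite /c scAl scAr scalerA -expr2 sqr_i scaleN1r.
have ac : P * c = c * P by rewrite /c scAl scAr PSc.
have se : cstar (P + c) = P - c.
  rewrite starD starZ !phi_real_star// -scaleNr; congr (_ + _ *: _).
  by rewrite complexiE conjCi.
have ee : cstar (P + c) * (P + c) = 1.
  rewrite se; transitivity (P * P - c * c + (P * c - c * P)); first by ncring.
  by rewrite ac subrr addr0 cc opprK.
have e1 := nrm_isometry ee.
rewrite -/P; have -> : P = 2^-1 *: ((P + c) + cstar (P + c)).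
  rewrite se; have -> : P + c + (P - c) = P + P by ncring.
  by rewrite scalerDr -scalerDl halves scale1r.
rewrite nrmZ Re_norm_half; have := nrmD (P + c) (cstar (P + c)).
rewrite nrm_star; lra.
Qed.

Lemma nrm_phi f (b : R) : contC f -> 0 <= b ->
  (forall x, nrm (f x) <= b) -> nrm (phi f) <= b.
Proof.
move=> fc b0 fb.
have h1 g : contC g -> (forall x, nrm (g x) <= 1) -> nrm (phi g) <= 1.
  move=> gc g1.
  have : nrm (cstar (phi g) * phi g) <= 1.
    have h := phiM (contC_conj gc) gc; rewrite phi_star// in h.
    rewrite -h.
    have -> : (fun x => Num.conj (g x) * g x) = (fun x => (nrm (g x) * nrm (g x))%:C).
      by apply/funext => x; rewrite mulrC -normCK rmorphM /= -!nrmE expr2.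
    apply: nrm_phi_real => [|x].
      by apply: contR_mul; exact: contR_nrm.
    rewrite ger0_norm ?mulr_ge0 ?nrm_ge0//; have := g1 x; have := nrm_ge0 (g x); nra.
  rewrite nrm_starM; have := nrm_ge0 (phi g); nra.
apply/ler_addgt0Pr => e e0; have be0 : 0 < b + e by lra.
have := h1 (fun x => (b + e)^-1%:C * f x).
rewrite (phiZ _ fc) nrmZ_real ger0_norm => [h|]; last by rewrite invr_ge0 ltW.
have : (b + e)^-1 * nrm (phi f) <= 1.
  apply: h; first by apply: contC_mul => //; exact: contC_cst.
  move=> x; rewrite nrm_mulC nrm_realC ger0_norm; last by rewrite invr_ge0 ltW.
  by rewrite mulrC ler_pdivrMr// mul1r; have := fb x; lra.
by rewrite mulrC ler_pdivrMr// mul1r.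
Qed.

Lemma nat_of_nneg (i : int) : 0 <= i -> exists n : nat, i = n%:Z.
Proof. by case: i => // n _; exists n. Qed.

Local Notation alz := (zit al be).

Definition upow (j : int) : T := zit (fun a => u * a) (fun a => cstar u * a) j 1.

Let uK : cancel (fun a => u * a) (fun a => cstar u * a).
Proof. by move=> a; rewrite mulrA uu mul1r. Qed.
Let u'K : cancel (fun a => cstar u * a) (fun a => u * a).
Proof. by move=> a; rewrite mulrA uu' mul1r. Qed.

Lemma upow0 : upow 0 = 1. Proof. by []. Qed.

Lemma upowS j : upow (j + 1) = u * upow j.
Proof. by rewrite /upow zitS. Qed.

Lemma upowP j : upow (j - 1) = cstar u * upow j.
Proof. by rewrite /upow (zitP uK u'K). Qed.

Lemma upowD i j : upow (i + j) = upow i * upow j.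
Proof.
elim/int_ind: i => [|n ih|n ih]; first by rewrite add0r mul1r.
  have -> : n.+1%:Z + j = n%:Z + j + 1 by lia.
  have -> : n.+1%:Z = n%:Z + 1 by lia.
  by rewrite !upowS ih mulrA.
have -> : - n.+1%:Z + j = - n%:Z + j - 1 by lia.
have -> : - n.+1%:Z = - n%:Z - 1 by lia.
by rewrite !upowP ih mulrA.
Qed.

Lemma upow1 : upow 1 = u.
Proof. by rewrite -[1%R in LHS]add0r upowS upow0 mulr1. Qed.

Lemma upowN1 : upow (-1) = cstar u.
Proof. by rewrite -[-1 in LHS]add0r upowP upow0 mulr1. Qed.

Lemma upowK j : upow (- j) * upow j = 1.
Proof. by rewrite -upowD addNr upow0. Qed.

Lemma upowNK j : upow j * upow (- j) = 1.
Proof. by rewrite -upowD addrN upow0. Qed.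

Lemma upow_star j : cstar (upow j) = upow (- j).
Proof.
have h : cstar (upow j) * upow j = 1.
  elim/int_ind: j => [|n ih|n ih]; first by rewrite upow0 star1 mul1r.
    have -> : n.+1%:Z = n%:Z + 1 by lia.
    by rewrite upowS starM -mulrA [cstar u * _]mulrA uu mul1r.
  have -> : - n.+1%:Z = - n%:Z - 1 by lia.
  by rewrite upowP starM -mulrA [cstar (cstar u) * _]mulrA starK uu' mul1r.
by rewrite -[LHS]mulr1 -(upowNK j) mulrA h mul1r.
Qed.

Lemma nrm_upow j : nrm (upow j) <= 1.
Proof. by apply: nrm_isometry; rewrite upow_star upowK. Qed.

Lemma alz_cont j : continuous (alz j).
Proof.
elim/int_ind: j => [|n ih|n ih] x; first exact: cvg_id.
  have -> : alz n.+1%:Z = al \o alz n%:Z.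
    by [].
  by apply: continuous_comp; [exact: ih|exact: alc].
have -> : alz (- n.+1%:Z) = be \o alz (- n%:Z).
  have -> : - n.+1%:Z = - n%:Z - 1 by lia.
  by apply/funext => y; rewrite (zitP alK beK).
by apply: continuous_comp; [exact: ih|exact: bec].
Qed.

Lemma alzD i j x : alz (i + j) x = alz i (alz j x).
Proof. exact: zitD. Qed.

Lemma contC_alz f j : contC f -> contC (fun x => f (alz j x)).
Proof. by move=> fc; apply: contC_comp => //; exact: alz_cont. Qed.

Lemma contR_alz (r : X -> R) j : contR r -> contR (fun x => r (alz j x)).
Proof. by move=> fc; apply: contR_comp => //; exact: alz_cont. Qed.

Lemma phi_upow f j : contC f -> phi f * upow j = upow j * phi (fun x => f (alz j x)).
Proof.
elim/int_ind: j f => [|n ih|n ih] f fc; first by rewrite upow0 mulr1 mul1r.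
  have -> : n.+1%:Z = n%:Z + 1 by lia.
  rewrite upowS mulrA -u_phi// -!mulrA; congr (_ * _); rewrite ih.
    by congr (_ * phi _); apply/funext => x; rewrite zitS.
  exact: contC_comp.
have -> : - n.+1%:Z = - n%:Z - 1 by lia.
rewrite upowP.
have fbc : contC (fun x => f (be x)) by exact: contC_comp.
have h : phi f * cstar u = cstar u * phi (fun x => f (be x)).
  have := u_phi fbc; under [X in phi X]eq_fun do rewrite alK.
  move=> h; rewrite -[LHS]mul1r -{1}uu !mulrA -[cstar u * u * _]mulrA h.
  by rewrite mulrA -mulrA uu' mulr1.
rewrite mulrA h -!mulrA; congr (_ * _); rewrite ih//.
by congr (_ * phi _); apply/funext => x; rewrite (zitP alK beK).
Qed.

Lemma upow_phi f j : contC f -> upow j * phi f = phi (fun x => f (alz (- j) x)) * upow j.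
Proof.
move=> fc; rewrite phi_upow; last exact: contC_alz.
by congr (_ * phi _); apply/funext => x; rewrite (zitK alK beK).
Qed.

Section Breaking.
Variables (k : nat) (h : 'I_k -> T).
Hypotheses (Gstar : star_algebra (span_set h))
  (Gphi : forall x f, span_set h x -> contC f -> x * phi f = phi f * x)
  (Gu : forall x, span_set h x -> x * u = u * x).
Variables (eta : X -> R) (m : nat).
Hypotheses (etac : contR eta)
  (hit : forall x, exists2 i, (i < m)%N & eta (iter i al x) = 1).

Lemma Gupow x j : span_set h x -> x * upow j = upow j * x.
Proof.
move=> hx; have hsx : x * cstar u = cstar u * x.
  have sx : span_set h (cstar x) by case: Gstar => _ _ _; exact.
  by rewrite -{1}[x]starK -starM -(Gu sx) starM starK.
elim/int_ind: j => [|n ih|n ih]; first by rewrite upow0 mulr1 mul1r.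
  have -> : n.+1%:Z = n%:Z + 1 by lia.
  by rewrite upowS mulrA Gu// -mulrA ih mulrA.
have -> : - n.+1%:Z = - n%:Z - 1 by lia.
by rewrite upowP mulrA hsx -mulrA ih mulrA.
Qed.

(** Edge [i] joins [alz i x] to [alz (i + 1) x] and is cut where [eta] does not vanish at its start.
    The path of [j] steps from [x] crosses the edges from 0 to [j - 1], or from [j] to -1 if it goes
    backward. *)
Definition uncut (j : int) (f : X -> R[i]^o) := forall x i,
  ((0 <= i) && (i < j)) || ((j <= i) && (i < 0)) -> eta (alz i x) <> 0 -> f x = 0.

Definition monomial (y : T) := exists j f (g : T),
  [/\ contC f, uncut j f, span_set h g & y = upow j * phi f * g].

(** Putnam's orbit-breaking algebra before completion, with coefficients in the span of [h]. Scalars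
    are absorbed in the coefficient of a monomial, so sums are enough. *)
Inductive breaking : T -> Prop :=
  | breaking0 : breaking 0
  | breakingS a y : monomial a -> breaking y -> breaking (a + y).

Lemma breaking_mono y : monomial y -> breaking y.
Proof. by move=> hy; rewrite -[y]addr0; apply: breakingS => //; exact: breaking0. Qed.

Lemma breakingD y y' : breaking y -> breaking y' -> breaking (y + y').
Proof.
move=> hy hy'; elim: hy => [|a z ha _ ih]; first by rewrite add0r.
by rewrite -addrA; exact: breakingS.
Qed.

Lemma breakingZ (a : R[i]) y : breaking y -> breaking (a *: y).
Proof.
elim=> [|b z [j [f [g [fc fu gg ->]]]] _ ih].
  by rewrite scaler0; exact: breaking0.
rewrite scalerDr; apply: breakingS => //.
exists j, f, (a *: g); split => //; first exact: star_algebraZ.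
by rewrite scAr.
Qed.

Lemma monomialM y y' : monomial y -> monomial y' -> monomial (y * y').
Proof.
move=> [i [f [g [fc fu hg ->]]]] [j [f' [g' [fc' fu' hg' ->]]]].
exists (i + j), (fun x => f (alz j x) * f' x), (g * g'); split.
- by apply: contC_mul => //; exact: contC_alz.
- move=> x l hl ne.
  have [h1|h1] := boolP ((0 <= l) && (l < j) || (j <= l) && (l < 0)).
    by rewrite (fu' x l h1 ne) mulr0.
  rewrite (fu (alz j x) (l - j)) ?mul0r//; first lia.
  by rewrite -alzD subrK.
- by case: Gstar => _ _ hM _; exact: hM.
- rewrite phiM//; last exact: contC_alz.
  rewrite upowD -!mulrA; congr (_ * _).
  rewrite [g * (upow j * _)]mulrA Gupow// -mulrA [g * (phi f' * _)]mulrA Gphi//.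
  by rewrite !mulrA phi_upow.
Qed.

Lemma monomial_star y : monomial y -> monomial (cstar y).
Proof.
move=> [j [f [g [fc fu hg ->]]]].
have hsg : span_set h (cstar g) by case: Gstar => _ _ _; exact.
exists (- j), (fun x => Num.conj (f (alz (- j) x))), (cstar g); split => //.
- exact/contC_conj/contC_alz.
- move=> x i hi ne; rewrite (fu _ (i + j)) ?rmorph0//; first lia.
  by rewrite -alzD addrK.
- rewrite !starM -phi_star// upow_star mulrA Gphi//; last exact: contC_conj.
  by rewrite -mulrA Gupow// mulrA phi_upow//; exact: contC_conj.
Qed.

Lemma breaking_star_algebra : star_algebra breaking.
Proof.
split.
- exact: breaking0.
- by move=> a x y hx hy; apply: breakingD => //; exact: breakingZ.
- move=> x y hx hy; elim: hx => [|a z ha _ ih].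
    by rewrite mul0r; exact: breaking0.
  rewrite mulrDl; apply: breakingD => //.
  elim: hy {ih} => [|b w hb _ ih]; first by rewrite mulr0; exact: breaking0.
  by rewrite mulrDr; apply: breakingS => //; exact: monomialM.
- move=> x; elim=> [|a z ha _ ih]; first by rewrite star0; exact: breaking0.
  by rewrite starD; apply: breakingS => //; exact: monomial_star.
Qed.

(** Among [m] consecutive points one has [eta = 1], so a path of at least [m] steps is cut
    somewhere. This is what bounds the degree. *)
Lemma uncut_large j f : uncut j f -> m%:Z <= `|j| -> forall x, f x = 0.
Proof.
move=> fu jm x; have [j0|j0] := lerP 0 j.
  have [i im ei] := hit x; apply: (fu x i%:Z); first lia.
  by rewrite /= ei; apply/eqP; exact: oner_neq0.
have [i im ei] := hit (alz (- m%:Z) x).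
apply: (fu x (i%:Z - m%:Z)); first lia.
by rewrite alzD /= ei; apply/eqP; exact: oner_neq0.
Qed.

Let deg (i : 'I_(m + m).+1) : int := i%:Z - m%:Z.

Lemma breaking_normal y : breaking y ->
  exists F : 'I_(m + m).+1 -> 'I_k -> X -> R[i]^o,
    (forall i r, contC (F i r) /\ uncut (deg i) (F i r)) /\
    y = \sum_i \sum_r upow (deg i) * phi (F i r) * h r.
Proof.
elim=> [|a z [j [f [g [fc fu [c ->] ->]]]] _ [F [hF ->]]].
  exists (fun _ _ _ => 0); split; first by split; [exact: contC_cst|].
  rewrite big1// => i _; rewrite big1// => r _.
  by rewrite phi0 mulr0 mul0r.
have [jm|jm] := leP m%:Z `|j|.
  exists F; split => //; have -> : f = fun=> 0.
    by apply/funext => x; exact: uncut_large jm x.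
  by rewrite phi0 mulr0 mul0r add0r.
have jlt : (absz (j + m%:Z)%R < (m + m).+1)%N by lia.
pose j' := Ordinal jlt; have dj : deg j' = j by rewrite /deg /=; lia.
exists (fun i r x => (if i == j' then c r * f x else 0) + F i r x); split.
  move=> i r; have [Fc Fu] := hF i r; split.
    apply: contC_add => //; case: eqP => _; last exact: contC_cst.
    by apply: contC_mul => //; exact: contC_cst.
  move=> x l hl ne; rewrite (Fu x l)// addr0; case: eqP => // ij.
  by rewrite (fu x l) ?mulr0//; move: hl; rewrite ij dj.
have -> : upow j * phi f * (\sum_(i < k) c i *: h i) =
    \sum_i \sum_r upow (deg i) * phi (fun x => if i == j' then c r * f x else 0) * h r.
  rewrite [RHS](bigD1 j')//= eqxx [X in _ = _ + X]big1 ?addr0 => [|i /negPf ij]; last first.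
    by rewrite big1// => r _; rewrite ij phi0 mulr0 mul0r.
  rewrite mulr_sumr; apply: eq_bigr => r _.
  by rewrite dj phiZ// !scAr scAl.
rewrite -big_split; apply: eq_bigr => i _; rewrite -big_split.
apply: eq_bigr => r _ /=; rewrite -mulrDl -mulrDr phiD//; last by case: (hF i r).
case: eqP => _; last exact: contC_cst.
by apply: contC_mul => //; exact: contC_cst.
Qed.

(** Functions that are constant across uncut edges. They commute with every monomial and supply the
    central multipliers for the representation theory of [breaking]. *)
Definition invariant_fun (c : X -> R) :=
  contR c /\ forall x, eta x = 0 -> c (al x) = c x.

Lemma invariant_uncut c j f x : invariant_fun c -> uncut j f ->
  c (alz j x) != c x -> f x = 0.
Proof.
move=> [_ ci] fu /eqP ne; apply: contrapT => fx; apply: ne.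
have eta0 i : ((0 <= i) && (i < j)) || ((j <= i) && (i < 0)) -> eta (alz i x) = 0.
  by move=> hi; apply: contrapT => ne; apply: fx; exact: fu hi ne.
have [j0|j0] := lerP 0 j.
  have [n jn] := nat_of_nneg j0; subst j.
  have : forall n', (n' <= n)%N -> c (alz n'%:Z x) = c x.
    elim=> [//|n' ih] hn'; have -> : n'.+1%:Z = n'%:Z + 1 by lia.
    by rewrite (zitS beK) ci ?ih ?eta0//; lia.
  exact.
have [n jn] : exists n : nat, j = - n%:Z by exists (absz j); lia.
subst j; suff : forall n', (n' <= n)%N -> c (alz (- n'%:Z) x) = c x by exact.
elim=> [//|n' ih] hn'; have -> : - n'.+1%:Z = - n'%:Z - 1 by lia.
have e0 : eta (alz (- n'%:Z - 1) x) = 0 by apply: eta0; lia.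
by rewrite -ci// -(zitS beK) subrK ih//; lia.
Qed.

Lemma invariant_comm c y : invariant_fun c -> breaking y ->
  let p := phi (fun x => (c x)%:C) in p * y = y * p /\ breaking (p * y).
Proof.
move=> hc hy p; have [cc ci] := hc; have ccc := contC_real cc.
elim: hy => [|a z [j [f [g [fc fu hg ->]]]] _ [ih1 ih2]].
  by rewrite mulr0 mul0r; split => //; exact: breaking0.
have e1 : p * (upow j * phi f * g) = upow j * phi (fun x => (c x)%:C * f x) * g.
  rewrite !mulrA phi_upow// -[upow j * _ * _]mulrA -phiM//; last exact: (contC_alz _ ccc).
  congr (_ * phi _ * _); apply/funext => x.
  have [->//|ne] := eqVneq (c (alz j x)) (c x).
  by rewrite (invariant_uncut hc fu ne) !mulr0.
have e2 : upow j * phi f * g * p = upow j * phi (fun x => (c x)%:C * f x) * g.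
  rewrite -mulrA (Gphi hg ccc) mulrA -[upow j * _ * _]mulrA -phiM//.
  by congr (_ * phi _ * _); apply/funext => x; rewrite mulrC.
rewrite mulrDr mulrDl e1 e2 ih1; split => //.
rewrite -ih1; apply: breakingS => //.
exists j, (fun x => (c x)%:C * f x), g; split => //; first exact: contC_mul.
by move=> x i hi ne; rewrite (fu x i) ?mulr0.
Qed.

Let fwd (F : X -> R) := fix A n (x : X) : R :=
  if n is n'.+1 then F x + (1 - eta x) * A n' (al x) else 0.
Let bwd (F : X -> R) := fix B n (x : X) : R :=
  if n is n'.+1 then (1 - eta (be x)) * (F (be x) + B n' (be x)) else 0.

(* Summing [F] along the orbit in both directions, with weight [1 - eta] on
   each edge that is crossed, gives a function that is constant across the uncut
   edges. *)
Lemma invariant_hull (F : X -> R) : contR F -> (forall x, 0 <= F x) ->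
  (forall x, 0 <= eta x <= 1) ->
  exists2 c, invariant_fun c & forall x, F x <= c x /\
    ((forall i : 'I_(m + m).+1, F (alz (deg i) x) = 0) -> c x = 0).
Proof.
move=> Fc F0 eta01.
have fwd_c n : contR (fwd F n).
  elim: n => [|n ih]; first exact: contR_cst.
  apply: contR_add => //; apply: contR_mul; last exact: contR_comp.
  by apply: contR_add; [exact: contR_cst|exact: contR_opp].
have bwd_c n : contR (bwd F n).
  elim: n => [|n ih]; first exact: contR_cst.
  apply: contR_mul; last exact: (contR_comp (contR_add Fc ih) bec).
  apply: contR_add; [exact: contR_cst|apply: contR_opp].
  exact: contR_comp.
have fwd_ge0 n x : 0 <= fwd F n x.
  elim: n x => [//|n ih] x /=; apply: addr_ge0 => //; apply: mulr_ge0 => //.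
  by have := eta01 x; lra.
have bwd_ge0 n x : 0 <= bwd F n x.
  elim: n x => [//|n ih] x /=; apply: mulr_ge0; last exact: addr_ge0.
  by have := eta01 (be x); lra.
(* A point with [eta = 1] multiplies the rest of the sum by 0, so a sum of [m] terms is already
   complete. This turns the recursion for the sums into the invariance of [c]. *)
have fwd_st n x : (exists2 i, (i < n)%N & eta (iter i al x) = 1) ->
    fwd F n.+1 x = fwd F n x.
  elim: n x => [|n ih] x [i hi ei]; first by [].
  rewrite -[LHS]/(F x + (1 - eta x) * fwd F n.+1 (al x)).
  rewrite -[RHS]/(F x + (1 - eta x) * fwd F n (al x)).
  case: i hi ei => [_ /= ->|i hi]; first by rewrite subrr !mul0r.
  by rewrite iterSr => ei; rewrite ih//; exists i.
have bwd_st n x : (exists2 i, (i < n)%N & eta (iter i.+1 be x) = 1) ->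
    bwd F n.+1 x = bwd F n x.
  elim: n x => [|n ih] x [i hi ei]; first by [].
  rewrite -[LHS]/((1 - eta (be x)) * (F (be x) + bwd F n.+1 (be x))).
  rewrite -[RHS]/((1 - eta (be x)) * (F (be x) + bwd F n (be x))).
  case: i hi ei => [_ /= ->|i hi]; first by rewrite subrr !mul0r.
  by rewrite iterSr => ei; rewrite ih//; exists i.
have hitb x : exists2 i, (i < m)%N & eta (iter i.+1 be x) = 1.
  have [i im ei] := hit (iter m be x).
  exists (m - i.+1)%N; first by lia.
  rewrite -ei; congr eta; rewrite -subSn// subSS.
  have -> : (m = i + (m - i))%N by lia.
  rewrite addKn iterD; elim: i {im ei} (iter _ _ _) => [//|i ih] y.
  by rewrite iterSr [iter i.+1 be y]/= beK -ih.
pose c x := fwd F m x + bwd F m x.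
exists c; first split.
- exact: contR_add.
- move=> x ex; rewrite /c -(bwd_st m (al x))//.
  rewrite -[bwd F m.+1 _]/((1 - eta (be (al x))) * (F (be (al x)) + bwd F m (be (al x)))).
  rewrite alK ex subr0 mul1r -(fwd_st m x)//.
  rewrite -[fwd F m.+1 x]/(F x + (1 - eta x) * fwd F m (al x)) ex; ring.
move=> x; split.
  have : F x <= fwd F m x.
    rewrite -(fwd_st m x)// -[fwd F m.+1 x]/(F x + (1 - eta x) * fwd F m (al x)).
    rewrite lerDl mulr_ge0//; have := eta01 x; lra.
  by have := bwd_ge0 m x; rewrite /c; lra.
move=> Fx.
have Fx' (j : int) : `|j| <= m%:Z -> F (alz j x) = 0.
  move=> jm; have jlt : (absz (j + m%:Z)%R < (m + m).+1)%N by lia.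
  have <- : deg (Ordinal jlt) = j by rewrite /deg /=; lia.
  exact: Fx.
have -> : c x = fwd F m x + bwd F m x by [].
have fwd0 n y : (forall i, (i < n)%N -> F (iter i al y) = 0) -> fwd F n y = 0.
  elim: n y => [//|n ih] y hy /=; rewrite (hy 0%N)// ih ?mulr0 ?addr0// => i hi.
  by rewrite -iterSr hy.
have bwd0 n y : (forall i, (i < n)%N -> F (iter i.+1 be y) = 0) -> bwd F n y = 0.
  elim: n y => [//|n ih] y hy /=; rewrite (hy 0%N)// ih ?addr0 ?mulr0// => i hi.
  by rewrite -iterSr hy.
rewrite fwd0 ?bwd0 ?addr0// => i hi; first by apply: (Fx' (Negz i)); lia.
by apply: (Fx' i%:Z); lia.
Qed.

Hypothesis eta01 : forall x, 0 <= eta x <= 1.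
Hypothesis X_compact : compact [set: X].

Variables (S : set T) (H : hilbertType R) (pi : T -> H -> H) (P : T).
Hypotheses (Salg : cstar_subalgebra S) (irr : irreducible_representation S pi)
  (PP : P * P = P) (sP : cstar P = P)
  (SP : forall y, breaking y -> S (P * y * P))
  (Pc : forall c, invariant_fun c -> let p := phi (fun x => (c x)%:C) in
     P * p = p * P /\ central_multiplier S (P * p))
  (piP : forall s x, S s -> pi (P * s) x = pi s x).

(** Each invariant function acts by a scalar [l]. If no point gave all these scalars, every [x]
    would have an invariant [c] with [c x] different from [l]; then the square of [c - l] acts as
    zero and is positive near [x]. By compactness a finite sum of such squares is positive
    everywhere, so its inverse is invariant as well, although the sum acts as zero. *)
Lemma evaluation_point : exists x0, forall c, invariant_fun c ->
  forall s x, S s -> pi (P * phi (fun y => (c y)%:C) * s) x = (c x0)%:C *: pi s x.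
Proof.
apply: contrapT => /forallNP nx.
have bad x : exists c (l : R), [/\ invariant_fun c, c x != l &
    forall s y, S s -> pi (P * phi (fun y => (c y)%:C) * s) y = l%:C *: pi s y].
  have /existsNP[c /not_implyP[hc nc]] := nx x.
  have [Ppc Pcent] := Pc hc.
  have [|l hl] := central_scalar Salg irr Pcent.
    by rewrite starM sP phi_real_star ?Ppc//; case: hc.
  exists c, l; split => //; apply/eqP => cl; apply: nc => s y Ss.
  by rewrite cl hl.
pose Q (A : set X) := exists c (d : R), [/\ invariant_fun c, 0 < d,
  forall y, 0 <= c y, forall y, A y -> d <= c y &
  forall s y, S s -> pi (P * phi (fun y => (c y)%:C) * s) y = 0].
have SP' c s : invariant_fun c -> S s -> S (P * phi (fun y => (c y)%:C) * s).
  by move=> hc Ss; have [_ h1] := Pc hc; case: (h1 s Ss).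
have inv_cst b : invariant_fun (fun=> b) by split => //; exact: contR_cst.
have : Q [set: X].
  apply: compact_induction => //.
  - exists (fun=> 0), 1; split => // s y Ss.
    by rewrite phi0 mulr0 mul0r (rep0 Salg irr).
  - move=> A B [c [d [hc d0 c0 cA cpi]]] [c' [d' [hc' d0' c0' cA' cpi']]].
    have [cc ci] := hc; have [cc' ci'] := hc'.
    exists (fun x => c x + c' x), (Num.min d d'); split.
    + by split=> [|x ex]; [exact: contR_add|rewrite ci ?ci'].
    + by rewrite lt_min d0.
    + by move=> y; exact: addr_ge0.
    + move=> y [/cA h1|/cA' h1]; rewrite ge_min; apply/orP; [left|right].
        by have := c0' y; lra.
      by have := c0 y; lra.
    + move=> s y Ss; under [X in phi X]eq_fun do rewrite rmorphD.
      rewrite phiD; try exact: contC_real.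
      rewrite mulrDr mulrDl (repD irr); try exact: SP'.
      by rewrite cpi// cpi'// addr0.
  - move=> A B AB [c [d [hc d0 c0 cA cpi]]]; exists c, d; split => // y /AB.
    exact: cA.
  - move=> x; have [c [l [hc cl cpi]]] := bad x; have [cc ci] := hc.
    pose c1 y := c y - l; have c1c : contR c1.
      by apply: contR_add => //; exact: contR_cst.
    have hc1 : invariant_fun c1 by split=> // y ey; rewrite /c1 ci.
    pose c2 y := c1 y * c1 y.
    have c2c : contR c2 by exact: contR_mul.
    have c20 y : 0 <= c2 y by rewrite /c2 -expr2 sqr_ge0.
    have c2x : 0 < c2 x.
      by rewrite lt_def c20 andbT mulf_neq0 // subr_eq0.
    exists [set y | c2 x / 2%:R <= c2 y].
      case: c2c => /cont_absP/(_ x (c2 x / 2%:R)) hcc.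
      apply: filterS (hcc _) => [y /=|]; last lra.
      by move=> /(le_lt_trans (ler_norm _)); lra.
    exists c2, (c2 x / 2%:R); split => //; [|lra|].
      by split=> // y ey; rewrite /c2 /c1 ci.
    move=> s y Ss; pose M := P * phi (fun y => (c1 y)%:C).
    have [Ppc _] := Pc hc1.
    have -> : P * phi (fun y => (c2 y)%:C) = M * M.
      under [X in phi X]eq_fun do rewrite rmorphM.
      rewrite phiM; try exact: contC_real.
      by rewrite /M -!mulrA [phi _ * (P * _)]mulrA -Ppc -!mulrA [P * (P * _)]mulrA PP.
    have M0 t z : S t -> pi (M * t) z = 0.
      move=> St; have -> : M * t = P * phi (fun y => (c y)%:C) * t + (- l%:C) *: (P * t).
        rewrite /M; under [X in phi X]eq_fun do rewrite rmorphD.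
        rewrite phiD; [|exact: contC_real|exact: contC_cst].
        have -> : phi (fun=> (- l)%:C) = (- l)%:C *: (1 : T).
          rewrite -phi1 -phiZ; last exact: contC_cst.
          by under [X in _ = phi X]eq_fun do rewrite mulr1.
        by rewrite mulrDr mulrDl scAr mulr1 scAl rmorphN.
      have [Pc2 Pcent] := Pc hc.
      have SPt : S (P * t).
        have [_ Pt] := Pc (inv_cst 1); have [] := Pt t St.
        by rewrite phi1 mulr1.
      rewrite (repD irr); [|exact: SP'|by apply: closedZ => //; case: Salg].
      by rewrite (repZ Salg irr)// piP// cpi// -scalerDl subrr scale0r.
    by rewrite -mulrA M0//; exact: SP'.
move=> [c [d [hc d0 c0 cT cpi]]].
have cpos y : c y != 0 by rewrite gt_eqF// (lt_le_trans d0)// cT.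
have hv : invariant_fun (fun y => (c y)^-1).
  have [cc ci] := hc; split; first exact: contR_inv.
  by move=> y ey; rewrite ci.
case: irr => _ [s Ss [y sy]] _; case/eqP: sy.
rewrite -piP//.
have [Ppc _] := Pc hc.
have -> : P * s = P * phi (fun y => (c y)%:C) * (P * phi (fun y => ((c y)^-1)%:C) * s).
  rewrite Ppc -!mulrA [P * (P * _)]mulrA PP mulrA -Ppc -!mulrA; congr (_ * _).
  rewrite mulrA -phiM; [|by apply: contC_real; case: hc|by apply: contC_real; case: hv].
  under [X in phi X]eq_fun do rewrite -rmorphM mulfV//.
  by rewrite phi1 mul1r.
by rewrite cpi//; exact: SP'.
Qed.

(** The coordinates are the values of the coefficient functions at the points within [m] steps of
    [x0]. If they vanish for [f], the invariant hull [c'] of the norm of [f] vanishes at [x0].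
    Writing [f = c' g + d g] with [g = f / (c' + d)] of norm at most 1, the first term acts as zero
    and the second is as small as [d]. *)
Lemma breaking_coordinates :
  exists q : T -> 'I_(m + m).+1 * 'I_k * 'I_(m + m).+1 -> R[i],
    forall n (y : 'I_n -> T) (c : 'I_n -> R[i]), (forall i, breaking (y i)) ->
    (forall t, \sum_i c i * q (y i) t = 0) ->
    forall x, pi (P * (\sum_i c i *: y i) * P) x = 0.
Proof.
have [x0 hx0] := evaluation_point.
have /choice[F hF] y : exists F : 'I_(m + m).+1 -> 'I_k -> X -> R[i]^o, breaking y ->
    (forall i r, contC (F i r) /\ uncut (deg i) (F i r)) /\
    y = \sum_i \sum_r upow (deg i) * phi (F i r) * h r.
  have [/breaking_normal[F hF]|ny] := pselect (breaking y); first by exists F.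
  by exists (fun _ _ _ => 0).
exists (fun y t => F y t.1.1 t.1.2 (alz (deg t.2) x0)) => n y c hy hc x.
pose G i r z : R[i]^o := \sum_l c l * F (y l) i r z.
have Gc i r : contC (G i r).
  apply: contC_sum => l; apply: contC_mul; first exact: contC_cst.
  by case: (hF _ (hy l)) => /(_ i r)[].
have Gu' i r : uncut (deg i) (G i r).
  move=> z j hj ne; rewrite /G big1// => l _.
  by case: (hF _ (hy l)) => /(_ i r)[_ /(_ z j hj ne) ->]; rewrite mulr0.
have G0 i r t : G i r (alz (deg t) x0) = 0 by exact: (hc (i, r, t)).
have -> : \sum_i c i *: y i = \sum_i \sum_r upow (deg i) * phi (G i r) * h r.
  under eq_bigr => l _.
    have [_ {1}->] := hF _ (hy l); rewrite scaler_sumr.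
    under eq_bigr do rewrite scaler_sumr.
    over.
  rewrite exchange_big; apply: eq_bigr => i _; rewrite exchange_big.
  apply: eq_bigr => r _ /=; rewrite phi_sum; last first.
    move=> l; apply: contC_mul; first exact: contC_cst.
    by case: (hF _ (hy l)) => /(_ i r)[].
  rewrite mulr_sumr mulr_suml; apply: eq_bigr => l _.
  by rewrite phiZ ?scAr ?scAl//; case: (hF _ (hy l)) => /(_ i r)[].
have P1 : nrm P <= 1.
  have := nrm_starM P; rewrite sP PP; have := nrm_ge0 P; nra.
suff h0 i r : S (P * (upow (deg i) * phi (G i r) * h r) * P) /\
    pi (P * (upow (deg i) * phi (G i r) * h r) * P) x = 0.
  have -> : P * (\sum_i \sum_r upow (deg i) * phi (G i r) * h r) * P =
      \sum_i \sum_r P * (upow (deg i) * phi (G i r) * h r) * P.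
    rewrite mulr_sumr mulr_suml; apply: eq_bigr => i _.
    by rewrite mulr_sumr mulr_suml.
  have h1 i := rep_sum Salg irr x (fun r => (h0 i r).1).
  have [_ ->] := rep_sum Salg irr x (fun i => (h1 i).1).
  rewrite big1// => i _; rewrite (h1 i).2 big1// => r _.
  by case: (h0 i r).
have mono_h f : contC f -> uncut (deg i) f ->
    S (P * (upow (deg i) * phi f * h r) * P).
  move=> fc fu; apply: SP; apply: breaking_mono.
  by exists (deg i), f, (h r); split => //; exact: span_mem.
split; first exact: mono_h.
pose f : X -> R[i]^o := G i r; have fc : contC f by exact: Gc.
have [|c' hc' hull] := @invariant_hull (fun z => nrm (f z)) (contR_nrm fc) _ eta01.
  by move=> z; exact: nrm_ge0.
have [c'c _] := hc'.
have c'0 : c' x0 = 0.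
  by have [_] := hull x0; apply => t; rewrite /f G0 nrm0.
have c'ge z : 0 <= c' z by have [h1 _] := hull z; apply: le_trans h1; exact: nrm_ge0.
apply/nrm_eq0/eqP; rewrite eq_le nrm_ge0 andbT; apply/ler_addgt0Pr => e e0.
rewrite add0r.
pose K := nrm (h r) * nrm x + 1.
have K0 : 0 < K by have := nrm_ge0 (h r); have := nrm_ge0 x; rewrite /K; nra.
pose d : R := e / K; have d0 : 0 < d by exact: divr_gt0.
have h2 : d * K = e by rewrite /d divfK// gt_eqF.
have den z : c' z + d != 0.
  by apply: lt0r_neq0; have := c'ge z; lra.
pose w z := (c' z + d)^-1.
have wc : contR w.
  by apply: contR_inv => //; apply: contR_add => //; exact: contR_cst.
pose g z := (w z)%:C * f z.
have gc : contC g by apply: contC_mul => //; exact: contC_real.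
have gu : uncut (deg i) g by move=> z j hj ne; rewrite /g /f (Gu' i r z j hj ne) mulr0.
have fE : phi f = phi (fun z => (c' z)%:C * g z) + d%:C *: phi g.
  rewrite -phiZ// -phiD; [|exact: contC_mul (contC_real c'c) gc|]; last first.
    by apply: contC_mul => //; exact: contC_cst.
  congr phi; apply/funext => z; rewrite -mulrDl -rmorphD /= /g mulrA -rmorphM.
  by rewrite /w mulfV// mul1r.
have cgE : P * (upow (deg i) * phi (fun z => (c' z)%:C * g z) * h r) * P =
    P * phi (fun z => (c' z)%:C) * (P * (upow (deg i) * phi g * h r) * P).
  have [Ppc _] := Pc hc'; rewrite Ppc -!mulrA [P * (P * _)]mulrA PP.
  rewrite [phi _ * (P * _)]mulrA -Ppc -!mulrA; congr (_ * _).
  rewrite [phi _ * (upow _ * _)]mulrA phi_upow; last exact: contC_real.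
  rewrite -!mulrA; congr (_ * _); rewrite [phi _ * (phi _ * _)]mulrA -phiM//.
    congr (phi _ * _); apply/funext => z.
    have [->//|ne] := eqVneq (c' (alz (deg i) z)) (c' z).
    by rewrite (invariant_uncut hc' gu ne) !mulr0.
  exact: (contC_alz _ (contC_real c'c)).
have -> : P * (upow (deg i) * phi (G i r) * h r) * P =
    P * phi (fun z => (c' z)%:C) * (P * (upow (deg i) * phi g * h r) * P) +
    d%:C *: (P * (upow (deg i) * phi g * h r) * P).
  rewrite -/f fE -cgE -scAl -scAr -scAl -scAr; ncring.
have Sg := mono_h _ gc gu.
rewrite (repD irr); last 2 first.
- by have [_ /(_ _ Sg)[]] := Pc hc'.
- by apply: closedZ => //; case: Salg.
rewrite hx0// c'0 scale0r add0r (repZ Salg irr)// nrmZ_real gtr0_norm//.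
have ng : nrm (phi g) <= 1.
  apply: nrm_phi => // z; rewrite nrm_mulC nrm_realC.
  have cd : 0 < c' z + d by have := c'ge z; lra.
  rewrite ger0_norm; last by rewrite invr_ge0 ltW.
  by rewrite mulrC ler_pdivrMr// mul1r; have [h1 _] := hull z; lra.
have nS : nrm (P * (upow (deg i) * phi g * h r) * P) <= nrm (h r).
  have nh := nrm_ge0 (h r).
  apply: le_trans (nrmM _ _) _; apply: le_trans (ler_wpM2l (nrm_ge0 _) P1) _.
  rewrite mulr1; apply: le_trans (nrmM _ _) _.
  apply: le_trans (ler_wpM2r (nrm_ge0 _) P1) _.
  rewrite mul1r; apply: le_trans (nrmM _ _) _.
  rewrite -[leRHS]mul1r; apply: ler_wpM2r => //.
  apply: le_trans (nrmM _ _) _; have := nrm_upow (deg i).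
  have := nrm_ge0 (upow (deg i)); have := nrm_ge0 (phi g); nra.
have h1 := rep_contract Salg irr x Sg.
have h3 := nrm_ge0 x.
have h4 : nrm (pi (P * (upow (deg i) * phi g * h r) * P) x) <= nrm (h r) * nrm x.
  by apply: le_trans h1 _; exact: ler_wpM2r.
by rewrite -h2; apply: ler_wpM2l; [exact: ltW|rewrite /K; lra].
Qed.

End Breaking.

(** * Berg's technique *)

Section Berg.
Variables (p : T) (M : nat).
Hypotheses (sp : cstar p = p)
  (p_orth : forall j : int, j != 0 -> `|j| <= M%:Z -> p * upow j * p = 0).

Definition under (y : T) := p * y = y /\ y * p = y.

Lemma underD x y : under x -> under y -> under (x + y).
Proof. by move=> [h1 h2] [h3 h4]; split; rewrite ?mulrDr ?mulrDl ?h1 ?h2 ?h3 ?h4. Qed.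

Lemma underN x : under x -> under (- x).
Proof. by move=> [h1 h2]; split; rewrite ?mulrN ?mulNr ?h1 ?h2. Qed.

Lemma under_star x : under x -> under (cstar x).
Proof. by move=> [h1 h2]; split; rewrite -{1}sp -starM ?h1 ?h2. Qed.

Let loc (j : int) (y : T) := upow (- j) * y * upow j.

Lemma loc_star j y : cstar (loc j y) = loc j (cstar y).
Proof. by rewrite /loc !starM !upow_star opprK mulrA. Qed.

Lemma locM j y y' : loc j y * loc j y' = loc j (y * y').
Proof.
rewrite /loc !mulrA -[_ * upow j * upow _]mulrA upowNK mulr1.
by rewrite -!mulrA.
Qed.

Lemma locD j y y' : loc j (y + y') = loc j y + loc j y'.
Proof. by rewrite /loc mulrDr mulrDl. Qed.

Lemma loc_orth i j y y' : under y -> under y' -> i != j -> `|i - j| <= M%:Z ->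
  loc i y * loc j y' = 0.
Proof.
move=> [_ h1] [h2 _] ij hij; rewrite /loc -{1}h1 -{1}h2.
have -> : upow (- i) * (y * p) * upow i * (upow (- j) * (p * y') * upow j) =
    upow (- i) * y * (p * (upow i * upow (- j)) * p) * y' * upow j by rewrite !mulrA.
by rewrite -upowD p_orth ?subr_eq0// mulr0 !mul0r.
Qed.

Lemma nrm_loc j y : nrm (loc j y) <= nrm y.
Proof.
have h1 := nrm_upow j; have h2 := nrm_upow (- j); have h3 := nrm_ge0 y.
apply: le_trans (nrmM _ _) _.
have := nrmM (upow (- j)) y; have := nrm_ge0 (upow (- j) * y).
have := nrm_ge0 (upow j); have := nrm_ge0 (upow (- j)); nra.
Qed.

Lemma loc_sum_unitary (c : nat -> T) : (forall j, under (c j)) ->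
  (forall j, cstar (1 + c j) * (1 + c j) = 1) ->
  (forall j, (1 + c j) * cstar (1 + c j) = 1) ->
  let Q := 1 + \sum_(j < M) loc j%:Z (c j) in cstar Q * Q = 1 /\ Q * cstar Q = 1.
Proof.
move=> uc cc cc' Q.
have key (a b : nat -> T) : (forall j, under (a j)) -> (forall j, under (b j)) ->
    (forall j, (1 + a j) * (1 + b j) = 1) ->
    (1 + \sum_(j < M) loc j%:Z (a j)) * (1 + \sum_(j < M) loc j%:Z (b j)) = 1.
  move=> ua ub ab.
  have -> : (1 + \sum_(j < M) loc j%:Z (a j)) * (1 + \sum_(j < M) loc j%:Z (b j)) =
      1 + (\sum_(j < M) loc j%:Z (a j) + \sum_(j < M) loc j%:Z (b j) +
      (\sum_(j < M) loc j%:Z (a j)) * (\sum_(j < M) loc j%:Z (b j))) by ncring.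
  have -> : (\sum_(j < M) loc j%:Z (a j)) * (\sum_(j < M) loc j%:Z (b j)) =
      \sum_(j < M) loc j%:Z (a j * b j).
    rewrite mulr_suml; apply: eq_bigr => i _; rewrite mulr_sumr (bigD1 i)//= locM.
    rewrite big1 ?addr0// => j ji; rewrite loc_orth//.
      by apply: contra_neq ji => /eqP; rewrite eqz_nat => /eqP ij; exact: val_inj.
    by have := ltn_ord i; have := ltn_ord j; lia.
  rewrite -!big_split big1 ?addr0// => j _ /=; rewrite -!locD.
  have -> : a j + b j + a j * b j = (1 + a j) * (1 + b j) - 1 by ncring.
  by rewrite ab subrr /loc mulr0 mul0r.
have sQ : cstar Q = 1 + \sum_(j < M) loc j%:Z (cstar (c j)).
  rewrite starD star1 star_sum; congr (_ + _); apply: eq_bigr => j _.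
  exact: loc_star.
have s1 j : 1 + cstar (c j) = cstar (1 + c j) by rewrite starD star1.
have usc j : under (cstar (c j)) by exact: under_star.
rewrite sQ; split; [apply: (key (fun j => cstar (c j)) c)|
  apply: (key c (fun j => cstar (c j)))] => // j; by rewrite s1.
Qed.

Variables (gam : nat -> T) (e : R).
Hypotheses (e0 : 0 < e) (ugam : forall j, under (gam j - 1))
  (gamM : gam M = 1)
  (gam_close : forall j, (j < M)%N -> nrm (gam j.+1 - gam j) <= e)
  (gam_unitary : forall j, cstar (gam j) * gam j = 1 /\ gam j * cstar (gam j) = 1).

(** Acts as a copy of [gam j] under the [j]-th backward translate of [p], and these translates are
    orthogonal. *)
Definition berg : T := 1 + \sum_(j < M) loc j%:Z (gam j - 1).

Lemma berg_unitary : cstar berg * berg = 1 /\ berg * cstar berg = 1.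
Proof.
apply: (@loc_sum_unitary (fun j => gam j - 1)) => // j.
  by rewrite addrC subrK; case: (gam_unitary j).
by rewrite addrC subrK; case: (gam_unitary j).
Qed.

(** Conjugation by [u] moves the copy at [j] to [j - 1], so up to a factor [u] the difference is a
    sum of copies of [gam j.+1 - gam j]. The copy of [gam 0] that leaves the window is accounted for
    by the factor [gam 0], and [gam M = 1] closes the other end. The copies are orthogonal, hence
    the norm of their sum is bounded by [e] and not by [M * e]. *)
Lemma berg_conj : nrm (u * berg - berg * (u * gam 0%N)) <= e.
Proof.
have uloc j y : u * loc j y * cstar u = loc (j - 1) y.
  have -> : u * loc j y * cstar u = (upow 1 * upow (- j)) * y * (upow j * upow (-1)).
    by rewrite upow1 upowN1 /loc !mulrA.
  by rewrite -!upowD /loc; congr (upow _ * _ * upow _); lia.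
have uQ : u * berg * cstar u = 1 + loc (-1) (gam 0%N - 1) +
    \sum_(j < M) loc j%:Z (gam j.+1 - 1).
  have -> : u * berg * cstar u = 1 + \sum_(j < M) loc (j%:Z - 1) (gam j - 1).
    rewrite /berg mulrDr mulrDl mulr1 uu'; congr (_ + _).
    by rewrite mulr_sumr mulr_suml; apply: eq_bigr => j _; rewrite uloc.
  rewrite -addrA; congr (_ + _).
  have -> : \sum_(j < M) loc (j%:Z - 1) (gam j - 1) =
      \sum_(j < M.+1) loc (j%:Z - 1) (gam j - 1).
    by rewrite big_ord_recr /= gamM subrr /loc mulr0 mul0r addr0.
  rewrite big_ord_recl; congr (_ + _).
  apply: eq_bigr => j _; by rewrite lift0; congr (loc _ _); lia.
have Qu : berg * (u * gam 0%N) * cstar u = berg + loc (-1) (gam 0%N - 1).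
  have -> : berg * (u * gam 0%N) * cstar u =
      berg * (u * cstar u) + berg * (u * (gam 0%N - 1) * cstar u) by ncring.
  have -> : u * (gam 0%N - 1) * cstar u = loc (-1) (gam 0%N - 1).
    by rewrite /loc opprK upow1 upowN1.
  rewrite uu' mulr1; congr (_ + _).
  rewrite /berg mulrDl mul1r mulr_suml big1 ?addr0// => j _.
  by rewrite loc_orth//; have := ltn_ord j; lia.
have -> : u * berg - berg * (u * gam 0%N) =
    (\sum_(j < M) loc j%:Z (gam j.+1 - gam j)) * u.
  transitivity ((u * berg * cstar u - berg * (u * gam 0%N) * cstar u) * u).
    by rewrite mulrBl -!mulrA uu !mulr1.
  congr (_ * _); rewrite uQ Qu /berg.
  have -> : \sum_(j < M) loc j%:Z (gam j.+1 - gam j) =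
      \sum_(j < M) loc j%:Z (gam j.+1 - 1) - \sum_(j < M) loc j%:Z (gam j - 1).
    rewrite -sumrB; apply: eq_bigr => j _.
    by rewrite /loc -mulrBl -mulrBr; congr (_ * _ * _); ncring.
  by ncring.
apply: le_trans (nrmM _ _) _.
have h1 : nrm u <= 1 by exact: nrm_isometry uu.
have uc j : under (gam j.+1 - gam j).
  have -> : gam j.+1 - gam j = (gam j.+1 - 1) - (gam j - 1) by ncring.
  by apply: underD => //; exact: underN.
have neq (i j : 'I_M) : i != j -> i%:Z != j%:Z.
  by apply: contra_neq => /eqP; rewrite eqz_nat => /eqP ij; exact: val_inj.
have hlt (i j : 'I_M) : `|i%:Z - j%:Z| <= M%:Z.
  by have := ltn_ord i; have := ltn_ord j; lia.
have h2 : nrm (\sum_(j < M) loc j%:Z (gam j.+1 - gam j)) <= e.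
  apply: nrm_orth_sum => // [i j ij|i j ij|i].
  - by rewrite loc_star loc_orth//; exact: under_star.
  - by rewrite loc_star loc_orth//; exact: under_star.
  - by apply: le_trans (nrm_loc _ _) _; exact: gam_close.
have := nrm_ge0 u; have := nrm_ge0 (\sum_(j < M) loc j%:Z (gam j.+1 - gam j)); nra.
Qed.

(** Here the errors are simply added. The factor [M] is harmless because [d] is made small after [M]
    is fixed. *)
Lemma berg_comm (x : T) (d : R) :
  (forall j, (j < M)%N -> let xj := upow j%:Z * x * upow (- j%:Z) in
     nrm (xj * (gam j - 1) - (gam j - 1) * xj) <= d) ->
  nrm (x * berg - berg * x) <= M%:R * d.
Proof.
move=> h.
pose xs (j : nat) := upow j%:Z * x * upow (- j%:Z).
have -> : x * berg - berg * x = \sum_(j < M)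
   loc j%:Z (xs j * (gam j - 1) - (gam j - 1) * xs j).
  rewrite /berg mulrDr mulrDl mulr1 mul1r opprD addrACA subrr add0r.
  rewrite mulr_sumr mulr_suml -sumrB; apply: eq_bigr => j _.
  have -> : loc j%:Z (xs j * (gam j - 1) - (gam j - 1) * xs j) =
      (upow (- j%:Z) * upow j%:Z) * x * (upow (- j%:Z) * (gam j - 1) * upow j%:Z) -
      upow (- j%:Z) * (gam j - 1) * upow j%:Z * x * (upow (- j%:Z) * upow j%:Z).
    rewrite /loc /xs; ncring.
  by rewrite upowK mul1r mulr1.
apply: le_trans (nrm_sum _ _ _) _.
have -> : M%:R * d = \sum_(j < M) d by rewrite sumr_const card_ord mulr_natl.
apply: ler_sum => j _; apply: le_trans (nrm_loc _ _) _.
exact: h.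
Qed.

End Berg.

Definition rphi (r : X -> R) : T := phi (fun x => (r x)%:C).

Lemma rphiM r s : contR r -> contR s -> rphi r * rphi s = rphi (fun x => r x * s x).
Proof.
move=> rc sc; rewrite /rphi -phiM; try exact: contC_real.
by congr phi; apply/funext => x; rewrite rmorphM.
Qed.

Lemma rphi_star r : contR r -> cstar (rphi r) = rphi r.
Proof. exact: phi_real_star. Qed.

Lemma rphi_upow r j : contR r -> rphi r * upow j = upow j * rphi (fun x => r (alz j x)).
Proof. by move=> rc; rewrite /rphi phi_upow//; exact: contC_real. Qed.

Lemma rphi_eq r s : (forall x, r x = s x) -> rphi r = rphi s.
Proof. by move=> rs; congr phi; apply/funext => x; rewrite rs. Qed.

Lemma rphi0 r : (forall x, r x = 0) -> rphi r = 0.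
Proof. by move=> r0; rewrite -[RHS]phi0; congr phi; apply/funext => x; rewrite r0. Qed.

Lemma rphi1 r : (forall x, r x = 1) -> rphi r = 1.
Proof. by move=> r0; rewrite -[RHS]phi1; congr phi; apply/funext => x; rewrite r0. Qed.

Lemma rphiB r s : contR r -> contR s -> rphi r - rphi s = rphi (fun x => r x - s x).
Proof.
move=> rc sc; rewrite /rphi -phiN; last exact: contC_real.
rewrite -phiD; [|exact: contC_real|exact/contC_opp/contC_real].
by congr phi; apply/funext => x; rewrite rmorphB.
Qed.

Lemma rphi_sum k (r : 'I_k -> X -> R) : (forall i, contR (r i)) ->
  \sum_i rphi (r i) = rphi (fun x => \sum_i r i x).
Proof.
move=> rc; rewrite /rphi -phi_sum; last by move=> i; exact: contC_real.
by congr phi; apply/funext => x; rewrite rmorph_sum.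
Qed.

(** * The approximating algebra for aperiodic dynamics *)

Section MainAlgebra.
Hypothesis X_compact : compact [set: X].
Variables (k : nat) (hb : 'I_k -> T).
Hypotheses (Gstar : star_algebra (span_set hb)) (G1 : span_set hb 1)
  (Gphi : forall x f, span_set hb x -> contC f -> x * phi f = phi f * x)
  (Gu : forall x, span_set hb x -> x * u = u * x).
Variables (d : nat) (g : 'I_d -> T).
Hypotheses (gstar : star_algebra (span_set g)) (g1 : span_set g 1)
  (gG : span_set g `<=` span_set hb).
Variables (l : nat) (E : 'I_l.+1 -> 'I_l.+1 -> T).
Hypotheses (EG : forall a b, span_set hb (E a b))
  (EM : forall a b a' b', E a b * E a' b' = if b == a' then E a b' else 0)
  (Es : forall a b, cstar (E a b) = E b a)
  (E1 : \sum_a E a a = 1)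
  (gE : forall x a b, span_set g x -> x * E a b = E a b * x).
Variables (nf : nat) (f : 'I_nf -> X -> R[i]^o) (M N n m : nat) (del : R).
Variables (xi tau eta h zeta : X -> R) (mu : 'I_(n + n).+1 -> X -> R).

Let dg (t : 'I_(n + n).+1) : int := t%:Z - n%:Z.

(* [eta] marks the cut, and the defect is supported where [h] is not 1, inside
   the set where [zeta] is 1. The tower rises from the support of [tau] to a height
   [N] at which the orbit is back in the support of [xi], on which Berg's rotations
   act. From each point, some [mu t] leads to the support of [tau] in [t - n] steps
   (possibly backwards) without meeting the cut. *)
Record orbit_data : Prop := OrbitData {
  od_f : forall a, contC (f a);
  od_del : 0 < del;
  od_M : (0 < M)%N;
  od_N : (0 < N)%N;
  od_nl : (n + n <= l)%N;
  od_xic : contR xi;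
  od_xi01 : forall x, 0 <= xi x <= 1;
  od_xi_orth : forall (j : int) x, j != 0 -> `|j| <= M%:Z -> xi x * xi (alz j x) = 0;
  od_xi_f : forall a j, (j < M)%N -> exists c : R[i]^o,
    forall x, xi x != 0 -> nrm (f a (alz (- j%:Z) x) - c) <= del;
  od_tauc : contR tau;
  od_tau01 : forall x, 0 <= tau x <= 1;
  od_tau_orth : forall (j : int) x, j != 0 -> `|j| <= N%:Z -> tau x * tau (alz j x) = 0;
  od_tau_xi : forall x, xi x * tau x = tau x;
  od_tau_xiN : forall x, xi (alz N%:Z x) * tau x = tau x;
  od_tau_f : forall a i, (i <= N)%N -> exists c : R[i]^o,
    forall x, tau x != 0 -> N%:R * nrm (f a (alz i%:Z x) - c) <= del;
  od_etac : contR eta;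
  od_eta01 : forall x, 0 <= eta x <= 1;
  od_hit : forall x, exists2 i, (i < m)%N & eta (iter i al x) = 1;
  od_hc : contR h;
  od_h01 : forall x, 0 <= h x <= 1;
  od_h_eta : forall x, eta x != 0 -> h x = 0;
  od_zetac : contR zeta;
  od_zeta01 : forall x, 0 <= zeta x <= 1;
  od_zeta_h : forall x, h x != 1 -> zeta x = 1;
  od_zeta_orth : forall (j : int) x, j != 0 -> `|j| <= l%:Z -> zeta x * zeta (alz j x) = 0;
  od_zeta_xi : forall x, xi x * zeta x = zeta x;
  od_zeta_tau : forall i x, (i <= N)%N -> zeta (alz i%:Z x) * tau x = 0;
  od_muc : forall t, contR (mu t);
  od_mu1 : forall x, \sum_t mu t x * mu t x = 1;
  od_mu_tau : forall t x, tau (alz (dg t) x) * mu t x = mu t x;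
  od_mu_uncut : forall t x i,
    ((0 <= i) && (i < dg t)) || ((dg t <= i) && (i < 0)) ->
    eta (alz i x) != 0 -> mu t x = 0
}.

Hypothesis od : orbit_data.
Let tc := od_tauc od.
Let xc := od_xic od.
Let zc := od_zetac od.
Let hc := od_hc od.
Let mc := od_muc od.

Lemma Ephi a b r : contR r -> E a b * rphi r = rphi r * E a b.
Proof. by move=> rc; apply: Gphi => //; exact: contC_real. Qed.

Lemma Eupow a b j : E a b * upow j = upow j * E a b.
Proof. exact: (Gupow Gstar Gu). Qed.

Lemma gphi x r : span_set g x -> contR r -> x * rphi r = rphi r * x.
Proof. by move=> gx rc; apply: Gphi; [exact: gG|exact: contC_real]. Qed.

Lemma gupow x j : span_set g x -> x * upow j = upow j * x.
Proof. by move=> gx; apply: (Gupow Gstar Gu); exact: gG. Qed.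

Lemma rphi_mid r s j : contR r -> contR s -> (forall x, r (alz j x) * s x = 0) ->
  rphi r * upow j * rphi s = 0.
Proof.
move=> rc sc rs; rewrite rphi_upow// -mulrA rphiM//; last exact: contR_alz.
by rewrite rphi0 ?mulr0.
Qed.

Lemma rphi_absorb r s j : contR r -> contR s -> (forall x, r (alz j x) * s x = s x) ->
  rphi r * (upow j * rphi s) = upow j * rphi s.
Proof.
move=> rc sc rs; rewrite mulrA rphi_upow// -mulrA rphiM//; last exact: contR_alz.
by congr (_ * _); apply: rphi_eq.
Qed.

Let e := E ord0 ord0.

Lemma e_idem : e * e = e. Proof. by rewrite EM eqxx. Qed.
Lemma e_star : cstar e = e. Proof. by rewrite Es. Qed.

Definition sheet (t : 'I_(n + n).+1) : 'I_l.+1 := inord t.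

Lemma sheet_inj t s : (sheet t == sheet s) = (t == s).
Proof.
have lt_l (i : 'I_(n + n).+1) : (i < l.+1)%N.
  by have := ltn_ord i; have := od_nl od; lia.
by rewrite -!val_eqE /= !inordK.
Qed.

(** Each path length has its own sheet, so the cross terms of [cstar bottom * bottom] vanish. The
    diagonal terms add up to [e] because the squares of the [mu t] sum to 1. *)
Definition bottom : T := \sum_t E (sheet t) ord0 * (upow (dg t) * rphi (mu t)).

Lemma bottom_tau : rphi tau * bottom = bottom.
Proof.
rewrite mulr_sumr; apply: eq_bigr => t _.
rewrite mulrA -Ephi// -mulrA rphi_absorb//; exact: od_mu_tau.
Qed.

Lemma bottom_e : bottom * e = bottom.
Proof.
rewrite mulr_suml; apply: eq_bigr => t _.
by rewrite -!mulrA -Ephi// [upow _ * (e * _)]mulrA -Eupow -!mulrA mulrA EM eqxx.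
Qed.

Lemma bottom_star : cstar bottom = \sum_t E ord0 (sheet t) * (rphi (mu t) * upow (- dg t)).
Proof.
rewrite star_sum; apply: eq_bigr => t _.
rewrite !starM rphi_star// upow_star Es -mulrA -Eupow mulrA -Ephi//.
by rewrite -mulrA.
Qed.

Lemma bottom_bottom : cstar bottom * bottom = e.
Proof.
have -> : cstar bottom * bottom = \sum_t rphi (fun x => mu t x * mu t x) * e.
  rewrite bottom_star mulr_suml; apply: eq_bigr => t _.
  rewrite mulr_sumr (bigD1 t)//= [X in _ + X]big1 ?addr0 => [|s st].
    rewrite -[E ord0 _ * _ * _]mulrA.
    have -> : rphi (mu t) * upow (- dg t) * (E (sheet t) ord0 * (upow (dg t) * rphi (mu t))) =
        E (sheet t) ord0 * (rphi (mu t) * (upow (- dg t) * upow (dg t)) * rphi (mu t)).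
      rewrite !mulrA Ephi// -![rphi _ * E _ _ * _]mulrA Eupow.
      by rewrite -!mulrA.
    rewrite upowK mulr1 rphiM// mulrA EM eqxx Ephi//.
    exact: contR_mul.
  have -> : E ord0 (sheet t) * (rphi (mu t) * upow (- dg t)) *
      (E (sheet s) ord0 * (upow (dg s) * rphi (mu s))) =
      rphi (mu t) * upow (- dg t) * (E ord0 (sheet t) * E (sheet s) ord0) *
      (upow (dg s) * rphi (mu s)).
    rewrite !mulrA Ephi// -[rphi _ * E _ _ * _]mulrA Eupow.
    by rewrite -!mulrA.
  by rewrite EM sheet_inj eq_sym (negPf st) mulr0 mul0r.
rewrite -mulr_suml rphi_sum => [|t]; last exact: contR_mul.
by rewrite rphi1 ?mul1r//; exact: od_mu1.
Qed.

Definition level (i : nat) : T := upow i%:Z * bottom.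

Lemma level_e i : level i * e = level i.
Proof. by rewrite /level -mulrA bottom_e. Qed.

Lemma level_level i j : (i <= N)%N -> (j <= N)%N ->
  cstar (level i) * level j = if i == j then e else 0.
Proof.
move=> iN jN.
have -> : cstar (level i) * level j = cstar bottom * (upow (- i%:Z) * upow j%:Z) * bottom.
  by rewrite /level starM upow_star !mulrA.
rewrite -upowD; case: eqP => [->|ij]; first by rewrite addNr upow0 mulr1 bottom_bottom.
rewrite -bottom_tau starM rphi_star// !mulrA -[_ * rphi tau * upow _]mulrA.
rewrite -[_ * (rphi tau * _) * _]mulrA rphi_mid ?mulr0 ?mul0r// => x.
by rewrite mulrC (od_tau_orth od)//; lia.
Qed.

Lemma level_under i r : (i <= N)%N -> contR r ->
  (forall x, r (alz i%:Z x) * tau x = tau x) -> rphi r * level i = level i.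
Proof.
move=> iN rc rt; by rewrite /level -bottom_tau [upow _ * (rphi _ * _)]mulrA mulrA rphi_absorb.
Qed.

Lemma level_far i r : (i <= N)%N -> contR r ->
  (forall x, r (alz i%:Z x) * tau x = 0) -> rphi r * level i = 0.
Proof.
move=> iN rc rt; rewrite /level -bottom_tau !mulrA rphi_mid// mul0r//.
Qed.

Lemma tau_eta i x : (i <= N)%N -> eta (alz i%:Z x) != 0 -> tau x = 0.
Proof.
move=> iN /(od_h_eta od) h0.
have z1 : zeta (alz i%:Z x) = 1.
  by apply: (od_zeta_h od); rewrite h0 eq_sym oner_neq0.
by have := od_zeta_tau od x iN; rewrite z1 mul1r.
Qed.

Local Notation brk := (breaking hb eta).

Lemma brkM x y : brk x -> brk y -> brk (x * y).
Proof.
by case: (@breaking_star_algebra _ _ Gstar Gphi Gu eta) => _ _ hM _; exact: hM.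
Qed.

Lemma brk_star x : brk x -> brk (cstar x).
Proof. by case: (@breaking_star_algebra _ _ Gstar Gphi Gu eta) => _ _ _; exact. Qed.

Lemma brk_sum (I : Type) (s : seq I) (P : pred I) (F : I -> T) :
  (forall i, brk (F i)) -> brk (\sum_(i <- s | P i) F i).
Proof. by move=> hF; apply: star_algebra_sum => //; exact: breaking_star_algebra. Qed.

Lemma brk_phi r : contC r -> brk (phi r).
Proof.
move=> rc; apply: breaking_mono; exists 0, r, 1; split => //.
  by move=> x i hi; exfalso; move: hi; lia.
by rewrite upow0 mul1r mulr1.
Qed.

Lemma brk_G x : span_set hb x -> brk x.
Proof.
move=> hx; apply: breaking_mono; exists 0, (fun=> 1), x; split => //.
- exact: contC_cst.
- by move=> y i hi; exfalso; move: hi; lia.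
- by rewrite upow0 mul1r phi1 mul1r.
Qed.

(** An edge on the path of [i + dg t] steps belongs to the path into the base, which avoids the cut
    by the choice of [mu], or to the climb, at height [j - dg t] above the base. In the climb a cut
    is excluded because [zeta] vanishes on the levels of the tower. *)
Lemma level_brk i : (i <= N)%N -> brk (level i).
Proof.
move=> iN; rewrite /level /bottom mulr_sumr; apply: brk_sum => t; apply: breaking_mono.
exists (i%:Z + dg t), (fun x => (mu t x)%:C), (E (sheet t) ord0); split => //.
- exact: contC_real.
- move=> x j hj ne; apply/eqP; rewrite -[0 in X in _ == X]/(0%:C) (inj_eq (@complexI _)).
  apply/eqP.
  have [h1|h1] := boolP (((0 <= j) && (j < dg t)) || ((dg t <= j) && (j < 0))).
    by apply: (od_mu_uncut od h1); apply/eqP.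
  rewrite -(od_mu_tau od) (@tau_eta (absz (j - dg t)%R)) ?mul0r//; first by lia.
  have -> : alz (absz (j - dg t)%R) (alz (dg t) x) = alz j x.
    by rewrite -alzD; congr alz; lia.
  exact/eqP.
- by rewrite -/(rphi (mu t)) -!mulrA -Ephi// ![E _ _ * _]mulrA Eupow upowD -!mulrA.
Qed.

Lemma mono_star a b i r : contR r ->
  cstar (E a b * (upow i * rphi r)) = E b a * (rphi r * upow (- i)).
Proof.
move=> rc; rewrite !starM rphi_star// upow_star Es -mulrA -Eupow mulrA -Ephi//.
by rewrite -mulrA.
Qed.

Lemma mono_mono a b i r c d' j r' : contR r ->
  E a b * (rphi r * upow i) * (E c d' * (upow j * rphi r')) =
  E a b * E c d' * (rphi r * upow (i + j) * rphi r').
Proof.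
move=> rc; rewrite upowD -!mulrA; congr (E a b * _).
by rewrite [upow i * (E c d' * _)]mulrA -Eupow -mulrA [rphi r * (E c d' * _)]mulrA -Ephi// -!mulrA.
Qed.

Let om x := Num.sqrt (1 - h x * h x).

Let omc : contR om.
Proof.
apply/contR_sqrt/contR_add; first exact: contR_cst.
exact/contR_opp/contR_mul.
Qed.

Let h_om x : h x * h x + om x * om x = 1.
Proof.
rewrite -[om x * _]expr2 sqr_sqrtr; first by rewrite addrC subrK.
by have := od_h01 od x; nra.
Qed.

Lemma livsic_pow j : (cstar u * rphi h) ^+ j =
  upow (- j%:Z) * rphi (fun x => \prod_(i < j) h (alz (- i%:Z) x)).
Proof.
elim: j => [|j ih].
  by rewrite expr0 oppr0 upow0 mul1r rphi1// => x; rewrite big_ord0.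
have pc : contR (fun x => \prod_(i < j) h (alz (- i%:Z) x)).
  by apply: contR_prod => i; exact: contR_alz.
set P := fun x => _ in pc ih; rewrite exprSr ih.
transitivity (upow (- j%:Z) * (rphi P * upow (-1)) * rphi h).
  by rewrite upowN1 !mulrA.
rewrite rphi_upow// mulrA -upowD -mulrA rphiM//; last exact: (contR_alz _ pc).
congr (upow _ * _); first by lia.
apply: rphi_eq => x; rewrite big_ord_recl mulrC; congr (_ * _).
by apply: eq_bigr => i _; rewrite -alzD lift0; congr (h (alz _ _)); lia.
Qed.

(** Each power brings in [h] at one more point of the orbit, and among [m] consecutive points one
    has [eta = 1], hence [h = 0]. So the Neumann series inverting [u - h] is a finite sum. *)
Lemma livsic_nilpotent : (cstar u * rphi h) ^+ m = 0.
Proof.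
rewrite livsic_pow rphi0 ?mulr0// => x.
have m0 : (0 < m)%N by have [i im _] := od_hit od x; exact: leq_ltn_trans im.
have [i im ei] := od_hit od (alz (- m.-1%:Z) x).
have jm : (m.-1 - i < m)%N by lia.
rewrite (bigD1 (Ordinal jm))//= (od_h_eta od) ?mul0r//.
have -> : - (m.-1 - i)%N%:Z = i%:Z - m.-1%:Z by lia.
by rewrite alzD /= ei oner_neq0.
Qed.

Lemma geometric (w : T) : w ^+ m = 0 ->
  (1 - w) * (\sum_(i < m) w ^+ i) = 1 /\ (\sum_(i < m) w ^+ i) * (1 - w) = 1.
Proof.
have key j : (1 - w) * (\sum_(i < j) w ^+ i) = 1 - w ^+ j /\
    (\sum_(i < j) w ^+ i) * (1 - w) = 1 - w ^+ j.
  elim: j => [|j [ih1 ih2]]; first by rewrite big_ord0 mulr0 mul0r expr0 subrr.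
  rewrite big_ord_recr /= [X in X = _ /\ _]mulrDr [X in _ /\ X = _]mulrDl ih1 ih2; split.
    by rewrite mulrBl mul1r -exprS addrA subrK.
  by rewrite mulrBr mulr1 -exprSr addrA subrK.
by move=> wm; have := key m; rewrite wm subr0.
Qed.

(** Take for [1 + y] the unitary of [livsic_unitary], with [om] as the defect function; both [h - 1]
    and [om] live where [zeta] is 1. In [u * (1 + y)] conjugation by [u] turns the powers of
    [cstar u * h] into powers of the adjoint of [u * h], and [u * h] is a monomial since [h]
    vanishes on the cut. So every factor lies in [breaking]. *)
Lemma defect : exists y, [/\ cstar (1 + y) * (1 + y) = 1, (1 + y) * cstar (1 + y) = 1,
  rphi zeta * y = y & y * rphi zeta = y] /\
  (breaking hb eta (u * (1 + y)) /\ forall x, span_set g x -> x * y = y * x).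
Proof.
pose H := rphi h; pose G := rphi om; pose w := cstar u * H.
pose b := (\sum_(i < m) w ^+ i) * cstar u.
have [g1' g2'] := geometric livsic_nilpotent; rewrite -/H -/w in g1' g2'.
have uw : u - H = u * (1 - w).
  by rewrite mulrBr mulr1 /w mulrA uu' mul1r.
have ub : (u - H) * b = 1.
  by rewrite uw /b -mulrA [(1 - w) * _]mulrA g1' mul1r uu'.
have bu : b * (u - H) = 1.
  by rewrite uw /b mulrA -[_ * cstar u * u]mulrA uu mulr1 g2'.
have HG : H * G = G * H.
  by rewrite /H /G !rphiM//; apply: rphi_eq => x; rewrite mulrC.
have HH : H * H + G * G = 1.
  rewrite /H /G !rphiM// -(rphi1 h_om).
  have hh : contR (fun x => h x * h x) by exact: contR_mul.
  have oo : contR (fun x => om x * om x) by exact: contR_mul.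
  rewrite /rphi -phiD; try exact: contC_real.
  by congr phi; apply/funext => x; rewrite rmorphD.
have [x1 x2] := livsic_unitary uu uu' (rphi_star hc) (rphi_star omc) HG HH ub bu.
have xE : 1 + (H - G * b * G - 1) = H - G * b * G by rewrite addrC subrK.
have zG : rphi zeta * G = G.
  rewrite /G rphiM//; apply: rphi_eq => x.
  have [h1|h1] := eqVneq (h x) 1; last by rewrite (od_zeta_h od h1) mul1r.
  by rewrite /om h1 mulr1 subrr sqrtr0 mulr0.
have Gz : G * rphi zeta = G.
  by rewrite -[RHS]zG /G !rphiM//; apply: rphi_eq => x; rewrite mulrC.
have H1c : contR (fun x => h x - 1).
  by apply: contR_add => //; exact: contR_cst.
have H1 : H - 1 = rphi (fun x => h x - 1).
  by rewrite -rphiB//; [rewrite [in RHS](@rphi1 (fun=> 1))|exact: contR_cst].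
have zh x : zeta x * (h x - 1) = h x - 1.
  have [->|h1] := eqVneq (h x) 1; first by rewrite subrr mulr0.
  by rewrite (od_zeta_h od h1) mul1r.
have zH : rphi zeta * (H - 1) = H - 1.
  by rewrite H1 rphiM//; apply: rphi_eq => x; rewrite zh.
have Hz : (H - 1) * rphi zeta = H - 1.
  by rewrite H1 rphiM//; apply: rphi_eq => x; rewrite mulrC zh.
have yE : H - G * b * G - 1 = (H - 1) - G * b * G by ncring.
exists (H - G * b * G - 1); rewrite xE; split; first split=> //.
- by rewrite yE mulrBr zH !mulrA zG.
- by rewrite yE mulrBl Hz -!mulrA Gz.
split; last first.
  move=> x gx; have xH : x * H = H * x by exact: gphi.
  have xG : x * G = G * x by exact: gphi.
  have xu : x * cstar u = cstar u * x by rewrite -upowN1 gupow.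
  have xw : x * w = w * x by rewrite /w mulrA xu -mulrA xH mulrA.
  have xwi i : x * w ^+ i = w ^+ i * x.
    elim: i => [|i ih]; first by rewrite mulr1 mul1r.
    by rewrite exprS mulrA xw -mulrA ih mulrA.
  have xb : x * b = b * x.
    rewrite /b -mulrA -xu !mulrA; congr (_ * _); rewrite mulr_sumr mulr_suml.
    by apply: eq_bigr => i _.
  have xGbG : x * (G * b * G) = G * b * G * x.
    clearbody b; by rewrite !mulrA xG -[G * x * b]mulrA xb !mulrA -[G * b * x * G]mulrA xG !mulrA.
  by rewrite yE !mulrBr !mulrBl xH xGbG mulr1 mul1r.
have buH : brk (u * H).
  apply: breaking_mono; exists 1, (fun x => (h x)%:C), 1; split => //.
  - exact: contC_real.
  - move=> x i hi; have -> : i = 0 by lia.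
    by move=> /eqP/(od_h_eta od) ->.
  - by rewrite upow1 mulr1.
have buG : u * G * cstar u = rphi (fun x => om (be x)).
  have omb : contR (fun x => om (be x)) by exact: contR_comp.
  have := u_phi (contC_real omb).
  under [X in phi X]eq_fun do rewrite alK.
  by rewrite -/(rphi om) -/G => ->; rewrite -mulrA uu' mulr1.
have -> : u * (H - G * b * G) = u * H -
    \sum_(i < m) rphi (fun x => om (be x)) * (cstar (u * H)) ^+ i * G.
  rewrite mulrBr; congr (_ - _).
  rewrite /b mulr_suml !mulr_sumr mulr_suml mulr_sumr; apply: eq_bigr => i _.
  rewrite !mulrA -buG starM rphi_star// -/H -!mulrA; congr (_ * (_ * _)).
  rewrite !mulrA; congr (_ * _); elim: (nat_of_ord i) => [|j ih].
    by rewrite !expr0 mul1r mulr1.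
  by rewrite exprSr [in RHS]exprSr [RHS]mulrA -ih /w !mulrA.
have bstar : star_algebra brk by exact: breaking_star_algebra.
apply: star_algebraD => //; rewrite -scaleN1r; apply: star_algebraZ => //.
apply: brk_sum => i; apply: brkM; last by apply: brk_phi; exact: contC_real.
apply: brkM; first by apply: brk_phi; apply: contC_real; exact: contR_comp.
elim: (nat_of_ord i) => [|j ih]; first exact: brk_G.
by rewrite exprS; apply: brkM => //; exact: brk_star.
Qed.

(** The defect occupies all [l + 1] sheets. Sheet [a] is brought to sheet 0 and at the same time
    moved [a] steps along the orbit; since these translates of the support of [zeta] are disjoint,
    the copies do not overlap in the corner. *)
Definition shift : T := \sum_a E ord0 a * (upow a%:Z * rphi zeta).

Lemma shift_e : e * shift = shift.
Proof.
by rewrite mulr_sumr; apply: eq_bigr => a _; rewrite mulrA EM eqxx.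
Qed.

Lemma shift_shift : cstar shift * shift = rphi zeta * rphi zeta.
Proof.
rewrite {1}/shift star_sum mulr_suml.
transitivity (\sum_a E a a * (rphi zeta * rphi zeta)); last by rewrite -mulr_suml E1 mul1r.
apply: eq_bigr => a _; rewrite mono_star// /shift mulr_sumr (big_only1 a)//.
  by rewrite mono_mono// EM eqxx addNr upow0 mulr1.
move=> b ba _; rewrite mono_mono// (rphi_mid zc zc) ?mulr0// => x.
rewrite mulrC (od_zeta_orth od)//.
  by move: ba; rewrite -val_eqE /=; lia.
by have := ltn_ord a; have := ltn_ord b; lia.
Qed.

Lemma g_star x z : (forall x, span_set g x -> x * z = z * x) ->
  span_set g x -> x * cstar z = cstar z * x.
Proof.
move=> hz gx; have gs : span_set g (cstar x) by case: gstar => _ _ _; exact.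
by rewrite -{1}[x]starK -starM -(hz _ gs) starM starK.
Qed.

Lemma g_shift x : span_set g x -> x * shift = shift * x.
Proof.
move=> gx; rewrite mulr_sumr mulr_suml; apply: eq_bigr => a _.
by rewrite mulrA gE// -!mulrA -gphi// [x * (upow _ * _)]mulrA gupow// -!mulrA.
Qed.

Lemma g_level x i : span_set g x -> x * level i = level i * x.
Proof.
move=> gx; rewrite /level mulrA gupow// -!mulrA; congr (_ * _).
rewrite mulr_sumr mulr_suml; apply: eq_bigr => t _.
by rewrite mulrA gE// -!mulrA -gphi// [x * (upow _ * _)]mulrA gupow// -!mulrA.
Qed.

Lemma u_level i : u * level i = level i.+1.
Proof. by rewrite /level mulrA -upowS; congr (upow _ * _); lia. Qed.

Lemma brk_star_algebra : star_algebra brk.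
Proof. exact: breaking_star_algebra. Qed.

Section Defect.
Variable y : T.
Hypotheses (yy : cstar (1 + y) * (1 + y) = 1) (yy' : (1 + y) * cstar (1 + y) = 1)
  (ky : rphi zeta * y = y) (yk : y * rphi zeta = y)
  (vb : breaking hb eta (u * (1 + y))) (gy : forall x, span_set g x -> x * y = y * x).

Let a := level 0.
Let b := level N.
Let k0 := rphi zeta.
Let aa : cstar a * a = e. Proof. by rewrite level_level. Qed.
Let bb : cstar b * b = e. Proof. by rewrite level_level// eqxx. Qed.
Let ab : cstar a * b = 0.
Proof. by rewrite level_level//; case: eqP => // N0; have := od_N od; rewrite -N0. Qed.
Let ae : a * e = a. Proof. exact: level_e. Qed.
Let be' : b * e = b. Proof. exact: level_e. Qed.
Let kz i : (i <= N)%N -> k0 * level i = 0.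
Proof. by move=> iN; apply: level_far => // x; exact: (od_zeta_tau od). Qed.
Let ka : k0 * a = 0. Proof. exact: kz. Qed.
Let kb : k0 * b = 0. Proof. exact: kz. Qed.
Let sk : cstar k0 = k0. Proof. exact: rphi_star. Qed.
Let k1 : nrm k0 <= 1.
Proof.
by apply: nrm_phi_real => // x; have := od_zeta01 od x; rewrite ler_norml; lra.
Qed.
Let p := rphi xi.
Let sp : cstar p = p. Proof. exact: rphi_star. Qed.

Let ex (c d : R) := exchange a b shift k0 y c d.
Let w0 := corner_unitary e shift y.

(** A path on the quarter circle from [(0, 1)] to [(1, 0)], written with square roots. Steps of size
    1/M under the root account for the rate 1/sqrt M. Truncation by [minn] keeps the pair on the
    circle for every [j]. *)
Let cj (j : nat) : R := Num.sqrt ((minn j M)%:R / M%:R).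
Let sj (j : nat) : R := Num.sqrt (1 - (minn j M)%:R / M%:R).
Let gam j := ex (cj j) (sj j).

Let M0 : 0 < M%:R :> R. Proof. by rewrite ltr0n (od_M od). Qed.

Let cs j : cj j ^+ 2 + sj j ^+ 2 = 1.
Proof.
have h1 : (minn j M)%:R / M%:R <= 1 :> R.
  by rewrite ler_pdivrMr// mul1r ler_nat geq_minr.
rewrite !sqr_sqrtr ?subr_ge0//; by rewrite addrC subrK.
Qed.

Lemma gam_unitary j : cstar (gam j) * gam j = 1 /\ gam j * cstar (gam j) = 1.
Proof.
by apply: (@exchange_unitary _ _ e) => //;
  first [exact: shift_e|exact: shift_shift|exact: cs].
Qed.

Lemma gamM : gam M = 1.
Proof.
rewrite /gam /cj /sj minnn mulfV ?gt_eqF// subrr sqrtr1 sqrtr0.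
exact: exchange10.
Qed.

Lemma gam0 : gam 0%N = ex 0 1.
Proof. by rewrite /gam /cj /sj min0n mul0r subr0 sqrtr0 sqrtr1. Qed.

Lemma gam_under j : under p (gam j - 1).
Proof.
apply: exchange_under => //.
- by apply: level_under => // x; exact: od_tau_xi.
- by apply: level_under => // x; exact: od_tau_xiN.
- by rewrite /p /k0 rphiM//; apply: rphi_eq => x; exact: od_zeta_xi.
Qed.

Lemma sqrt_close (s t r : R) : 0 <= s -> s <= t -> t - s <= r ->
  `|Num.sqrt t - Num.sqrt s| <= Num.sqrt r.
Proof.
move=> s0 st tr; have h1 : Num.sqrt s <= Num.sqrt t by exact: ler_wsqrtr.
rewrite ger0_norm ?subr_ge0// -[leLHS]ger0_norm ?subr_ge0// -sqrtr_sqr.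
apply: ler_wsqrtr; apply: le_trans tr.
have h2 := sqrtr_ge0 s.
have <- : Num.sqrt t ^+ 2 - Num.sqrt s ^+ 2 = t - s.
  by rewrite !sqr_sqrtr//; exact: le_trans st.
by rewrite !expr2; nra.
Qed.

(** The factor 6 of [exchange_close], for two coordinates that each move by at most 1/sqrt M. *)
Lemma gam_close j : (j < M)%N -> nrm (gam j.+1 - gam j) <= 12%:R * Num.sqrt M%:R^-1.
Proof.
move=> jM; apply: le_trans (_ : _ <= 6%:R * (`|cj j.+1 - cj j| + `|sj j.+1 - sj j|)) _.
  by apply: (@exchange_close _ _ e) => //; first [exact: shift_e|exact: shift_shift|exact: cs].
have hj : minn j M = j by lia.
have hj' : minn j.+1 M = j.+1 by lia.
have h1 : `|cj j.+1 - cj j| <= Num.sqrt M%:R^-1.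
  rewrite /cj hj hj'; apply: sqrt_close; first by rewrite divr_ge0.
    by rewrite ler_pM2r ?invr_gt0// ler_nat.
  by rewrite -mulrBl -natrB// subSnn mul1r.
have h2 : `|sj j.+1 - sj j| <= Num.sqrt M%:R^-1.
  rewrite distrC /sj hj hj'; apply: sqrt_close.
  - by rewrite subr_ge0 ler_pdivrMr// mul1r ler_nat.
  - by rewrite lerD2l lerN2 ler_pM2r ?invr_gt0// ler_nat.
  - have -> : 1 - j%:R / M%:R - (1 - j.+1%:R / M%:R) = j.+1%:R / M%:R - j%:R / M%:R :> R.
      by ring.
    by rewrite -mulrBl -natrB// subSnn mul1r.
by lra.
Qed.

Lemma p_orth (j : int) : j != 0 -> `|j| <= M%:Z -> p * upow j * p = 0.
Proof.
by move=> j0 jM; apply: rphi_mid => // x; rewrite mulrC; exact: od_xi_orth.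
Qed.

Definition berg_rotation : T := berg M gam.

Lemma berg_rotation_unitary :
  cstar berg_rotation * berg_rotation = 1 /\ berg_rotation * cstar berg_rotation = 1.
Proof. exact: (berg_unitary sp p_orth gam_under gam_unitary). Qed.

Lemma berg_rotation_conj :
  nrm (u * berg_rotation - berg_rotation * (u * gam 0%N)) <= 12%:R * Num.sqrt M%:R^-1.
Proof.
apply: (berg_conj sp p_orth) => //; [|exact: gam_under|exact: gamM|exact: gam_close].
by rewrite mulr_gt0// sqrtr_gt0 invr_gt0.
Qed.

Lemma nrm_gam_1 j : nrm (gam j - 1) <= 2%:R.
Proof.
apply: le_trans (nrmB _ _) _; have := nrm1_le1 T.
have := nrm_isometry (gam_unitary j).1; lra.
Qed.

(** On the support of [xi] the translated function is within [del] of a constant, and constants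
    commute. Each of the two remaining products has norm at most [2 * del]. *)
Lemma berg_rotation_comm r :
  nrm (phi (f r) * berg_rotation - berg_rotation * phi (f r)) <= M%:R * (4%:R * del).
Proof.
have fc : contC (f r) by exact: od_f.
apply: berg_comm => j jM /=.
have [c hcx] := od_xi_f od r jM.
set ff := fun x => f r (alz (- j%:Z) x).
have ffc : contC ff by exact: (contC_alz _ fc).
have -> : upow j%:Z * phi (f r) * upow (- j%:Z) = phi ff.
  by rewrite upow_phi// -mulrA upowNK mulr1.
pose fd x := (xi x)%:C * (ff x - c).
have dc : contC (fun x => ff x - c).
  by apply: contC_add => //; exact: contC_cst.
have fdc : contC fd by apply: contC_mul => //; exact: contC_real.
have d0 := od_del od.
have nfd : nrm (phi fd) <= del.
  apply: nrm_phi => // [|x]; first exact: ltW.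
  rewrite nrm_mulC nrm_realC; have := od_xi01 od x => xi01.
  have [->|xi0] := eqVneq (xi x) 0; first by rewrite normr0 mul0r ltW.
  have := hcx x xi0; rewrite -/(ff x) ger0_norm; last by lra.
  by have := nrm_ge0 (ff x - c); nra.
have pfd : p * phi (fun x => ff x - c) = phi fd by rewrite -phiM//; exact: contC_real.
have fdp : phi (fun x => ff x - c) * p = phi fd.
  rewrite -phiM//; last exact: contC_real.
  by congr phi; apply/funext => x; rewrite mulrC.
have fE : phi ff = phi (fun x => ff x - c) + c *: (1 : T).
  rewrite -phi1 -phiZ; last exact: contC_cst.
  rewrite -phiD//; last by apply: contC_mul; exact: contC_cst.
  by congr phi; apply/funext => x; rewrite mulr1 subrK.
have [u1 u2] := gam_under j.
have -> : phi ff * (gam j - 1) - (gam j - 1) * phi ff =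
    phi fd * (gam j - 1) - (gam j - 1) * phi fd.
  rewrite fE; move: (phi (fun x => ff x - c)) pfd fdp (gam j - 1) u1 u2 => q pq qp w u1 u2.
  rewrite mulrDl mulrDr scAl scAr mul1r mulr1 opprD addrACA subrr addr0.
  have -> : q * w = phi fd * w by rewrite -{1}u1 mulrA qp.
  by have -> : w * q = w * phi fd by rewrite -{1}u2 -mulrA pq.
apply: le_trans (nrmB _ _) _.
have h1 := nrmM (phi fd) (gam j - 1); have h2 := nrmM (gam j - 1) (phi fd).
have := nrm_gam_1 j; have := nrm_ge0 (phi fd); have := nrm_ge0 (gam j - 1).
nra.
Qed.

(** The tower has the levels 1 to [N]. Level 0 is left out: it is where the top is rotated to before
    [u] lifts it to level 1. *)
Let z (i : 'I_N) := level i.+1.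

Lemma z_e i : z i * e = z i. Proof. exact: level_e. Qed.

Lemma z_z i j : cstar (z i) * z j = if i == j then e else 0.
Proof. by rewrite level_level// eqSS. Qed.

Definition tower_proj : T := tower_diag z e.

Lemma tower_projE : tower_proj = \sum_(1 <= j < N.+1) level j * cstar (level j).
Proof.
rewrite big_add1 big_mkord; apply: eq_bigr => i _.
rewrite (big_only1 i) ?eqxx => [|//|j ji _]; first by rewrite z_e.
by rewrite eq_sym (negPf ji) mulr0 mul0r.
Qed.

Lemma tower_proj_z j : (0 < j <= N)%N -> tower_proj * level j = level j.
Proof.
move=> jN; have jlt : (j.-1 < N)%N by lia.
have -> : level j = z (Ordinal jlt) by rewrite /z /= prednK//; lia.
by rewrite (tower_diagz z_z) ?z_e// e_idem.
Qed.

Lemma tower_proj_star : cstar tower_proj = tower_proj. Proof. by rewrite tower_diag_star e_star. Qed.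

Lemma tower_proj_idem : tower_proj * tower_proj = tower_proj.
Proof. exact: (LL e_idem z_z). Qed.

Lemma brk_level j : (j <= N)%N -> brk (level j * cstar (level j)).
Proof. by move=> jN; apply: brkM; [|apply: brk_star]; exact: level_brk. Qed.

Lemma brk_tower_proj : brk tower_proj.
Proof.
rewrite tower_projE big_add1 big_mkord; apply: brk_sum => i; exact: brk_level.
Qed.

(** After conjugation by the Berg rotation this is close to [u]. It permutes the levels of the tower
    cyclically, picking up [w0] at the top, and therefore commutes with the tower projection. *)
Definition tower_shift : T := u * gam 0%N.

Lemma tower_shift_unitary : cstar tower_shift * tower_shift = 1 /\ tower_shift * cstar tower_shift = 1.
Proof.
have [h1 h2] := gam_unitary 0; rewrite /tower_shift starM; split; rewrite mulrA.
  by rewrite -[_ * cstar u * u]mulrA uu mulr1.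
by rewrite -[_ * gam 0%N * _]mulrA h2 mulr1 uu'.
Qed.

Lemma tower_shift_step j : (0 < j < N)%N -> tower_shift * level j = level j.+1.
Proof.
move=> jN; rewrite /tower_shift gam0 -mulrA exchange01_fix ?u_level//.
- by rewrite level_level//; [case: eqP => //; lia|lia].
- by rewrite level_level//; [case: eqP => //; lia|lia].
- by apply: kz; lia.
Qed.

Lemma tower_shift_top : tower_shift * level N = level 1 * w0.
Proof.
rewrite /tower_shift gam0 -mulrA (@exchange01_top _ _ e)//; last exact: shift_e.
by rewrite mulrA u_level.
Qed.

Lemma w0_unitary : [/\ cstar w0 * w0 = e, w0 * cstar w0 = e, e * w0 = w0 & w0 * e = w0].
Proof.
by apply: (@corner_unitaryP _ _ e a shift k0 y) => //; first [exact: shift_e|exact: shift_shift].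
Qed.

Lemma tower_shift_proj : tower_shift * tower_proj = tower_proj * tower_shift.
Proof.
have [W1 W2] := tower_shift_unitary; have [v1 v2 v3 v4] := w0_unitary; have N0 := od_N od.
suff Wc : tower_shift * tower_proj * cstar tower_shift = tower_proj by rewrite -{2}Wc -mulrA W1 mulr1.
rewrite tower_projE mulr_sumr mulr_suml.
have hW j : tower_shift * (level j * cstar (level j)) * cstar tower_shift =
    (tower_shift * level j) * cstar (tower_shift * level j).
  by rewrite starM !mulrA.
under eq_bigr do rewrite hW.
rewrite big_nat_recr//= tower_shift_top starM mulrA -[level 1 * w0 * _]mulrA v2 level_e.
rewrite [RHS]big_ltn; last by lia.
rewrite addrC; congr (_ + _); rewrite [RHS]big_add1 /= big_nat [RHS]big_nat.
by apply: eq_bigr => j hj; rewrite tower_shift_step.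
Qed.

(** A cyclic permutation matrix with one entry twisted by [w0]. Index [j] stands for level [j + 1],
    so the column with [j.+1 == N] is the top. *)
Definition shift_coef (i j : 'I_N) : T :=
  if j.+1 == N then (if i == 0%N :> nat then w0 else 0)
  else if i == j.+1 :> nat then e else 0.

Lemma tower_shiftE : tower_shift * tower_proj = tower z shift_coef.
Proof.
have N0 := od_N od; have [v1 v2 v3 v4] := w0_unitary.
have sc (i j : 'I_N) : i != j -> z i * (if i == j then e else 0) * cstar (z j) = 0.
  by move=> /negPf ->; rewrite mulr0 mul0r.
rewrite tower_projE mulr_sumr big_add1 big_mkord /tower exchange_big /=.
apply: eq_bigr => j _; rewrite mulrA -mulr_suml; congr (_ * _); rewrite /shift_coef.
have [jN|jN] := eqVneq j.+1 N.
  rewrite (big_only1 (Ordinal N0))//= => [|i i0 _]; first by rewrite jN tower_shift_top.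
  case: ifP => [hi|_]; last by rewrite mulr0.
  by case/eqP: i0; apply: val_inj; apply/eqP.
have jlt : (j.+1 < N)%N by have := ltn_ord j; lia.
rewrite (big_only1 (Ordinal jlt))//= => [|i i0 _].
  by rewrite eqxx z_e tower_shift_step//; lia.
case: ifP => [hi|_]; last by rewrite mulr0.
by case/eqP: i0; apply: val_inj; apply/eqP.
Qed.

Let P := 1 - tower_proj.

Lemma b_P : cstar b * P = 0.
Proof.
rewrite /P mulrBr mulr1 -{1}tower_proj_star -starM tower_proj_z ?subrr//.
by rewrite (od_N od) leqnn.
Qed.

Lemma away_idem : P * P = P.
Proof.
by rewrite /P mulrBr mulr1 mulrBl mul1r tower_proj_idem subrr subr0.
Qed.

Lemma away_star : cstar P = P. Proof. by rewrite starB star1 tower_proj_star. Qed.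

Let V : T := u * (1 + y) * turn a b 0 1.

(** Off the tower the arm of the exchange is trivial, and what is left is built from [u * (1 + y)]
    and the levels 0 and [N], all in [breaking]. *)
Lemma tower_shift_away : tower_shift * P = P * V * P.
Proof.
have WV : tower_shift * P = V * P by rewrite /tower_shift gam0 -mulrA exchange01_away ?b_P// !mulrA.
have WP : tower_shift * P = P * tower_shift by rewrite /P mulrBr mulrBl mulr1 mul1r tower_shift_proj.
by rewrite -[RHS]mulrA -WV [RHS]mulrA -WP -[RHS]mulrA away_idem.
Qed.

Lemma brk1 : brk 1. Proof. exact: brk_G. Qed.

Lemma brk_lin c x x' : brk x -> brk x' -> brk (c *: x + x').
Proof. by case: brk_star_algebra => _ + _ _; apply. Qed.

Lemma brk_V : brk V.
Proof.
have ha : brk a by exact: level_brk.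
have hb' : brk b by exact: level_brk.
have hM (x x' : T) : brk x -> brk x' -> brk (x * cstar x').
  by move=> hx hx'; apply: brkM => //; exact: brk_star.
apply: brkM => //; rewrite /turn [1 + _]addrC -addrA.
apply: (brk_lin) => [|].
  by rewrite -[a * cstar a]scale1r; apply: brk_lin; exact: hM.
rewrite addrC; apply: (brk_lin); last exact: brk1.
by rewrite addrC -scaleN1r; apply: brk_lin; exact: hM.
Qed.

Lemma brk_P : brk P.
Proof. by rewrite /P addrC -scaleN1r; apply: brk_lin; [exact: brk_tower_proj|exact: brk1]. Qed.

Let Cc : set T := bicommutant e w0.

Lemma g_y_star x : span_set g x -> x * cstar y = cstar y * x.
Proof. by move=> gx; exact: g_star. Qed.

Lemma g_w0 x : span_set g x -> x * w0 = w0 * x.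
Proof.
move=> gx; have hs := g_shift gx; have hss := g_star g_shift gx.
have hy := g_y_star gx.
rewrite mulrDr mulrDl gE//; congr (_ + _).
by rewrite !mulrA hs -[shift * x * _]mulrA hy !mulrA -[_ * x * cstar shift]mulrA hss !mulrA.
Qed.

Lemma g_Cc x c : span_set g x -> Cc c -> x * c = c * x.
Proof.
move=> gx [_ _ hC]; rewrite hC//; first exact: g_w0.
by apply: g_star => // x' gx'; exact: g_w0.
Qed.

Lemma Cc_star : star_algebra Cc.
Proof. exact: (bicommutant_star w0 e_star). Qed.

Lemma Cc_e : Cc e.
Proof. by have [v1 v2 v3 v4] := w0_unitary; apply: bicommutant_unit; rewrite ?e_idem. Qed.

Lemma eCc c : Cc c -> e * c = c. Proof. by case. Qed.

Definition orbit_algebra : set T := tower_algebra e z Cc g brk.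

Lemma brk_DL x x' : brk x -> brk x' -> brk (x * (1 - tower_diag z e) * x').
Proof. by move=> hx hx'; apply: brkM => //; apply: brkM => //; exact: brk_P. Qed.

Lemma orbit_algebra_star : star_algebra orbit_algebra.
Proof.
exact: (tower_algebra_star e_idem e_star z_z Cc_star eCc gstar g_Cc brk_star_algebra brk_DL).
Qed.

Lemma orbit_algebra_mem x q : brk x -> (forall i j, tower_coef Cc g (q i j)) ->
  orbit_algebra (P * x * P + tower z q).
Proof. by move=> hx hq; exists x => //; exists q. Qed.

Lemma coef_tower_proj q : (forall i j, tower_coef Cc g (q i j)) ->
  tower_proj * tower z q = tower z q /\ tower z q * tower_proj = tower z q.
Proof.
move=> hq; split; first exact: (L_tower z_z eCc).
exact: (tower_L e_idem e_star z_z Cc_star eCc gstar g_Cc).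
Qed.

Lemma Pcomm x q : brk x -> (forall i j, tower_coef Cc g (q i j)) ->
  P * (P * x * P + tower z q) = P * x * P /\ (P * x * P + tower z q) * P = P * x * P.
Proof.
move=> hx hq; have [l1 l2] := coef_tower_proj hq.
have PL : P * tower_proj = 0 by rewrite /P mulrBl mul1r tower_proj_idem subrr.
have LP : tower_proj * P = 0 by rewrite /P mulrBr mulr1 tower_proj_idem subrr.
split.
  by rewrite mulrDr -{1}l1 !mulrA away_idem PL mul0r addr0.
by rewrite mulrDl -{1}l2 -!mulrA away_idem LP mulr0 addr0.
Qed.

Lemma central_invariant c : invariant_fun eta c -> let r := phi (fun x => (c x)%:C) in
  P * r = r * P /\ central_multiplier (closure orbit_algebra) (P * r).
Proof.
move=> ic r; have hcomm := invariant_comm Gphi ic.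
have Pr : P * r = r * P by have [] := hcomm _ brk_P.
split => //; apply: central_closure => [|_ [x hx [q hq ->]]]; first exact: orbit_algebra_star.
rewrite -[tower_diag z e]/tower_proj -/P.
have [c1 c2] := Pcomm hx hq; have [rx rb] := hcomm _ hx; rewrite -/r in rx rb.
have e1 : P * r * (P * x * P + tower z q) = P * (r * x) * P.
  by rewrite Pr -[LHS]mulrA c1 !mulrA -Pr.
have e2 : (P * x * P + tower z q) * (P * r) = P * (r * x) * P.
  by rewrite mulrA c2 -[LHS]mulrA Pr !mulrA -[P * x * r]mulrA -rx mulrA.
rewrite e1 e2; split => //; exists (r * x) => //; exists (fun _ _ => 0).
  by move=> i j; apply: coef0; exact: Cc_star.
by rewrite /tower big1 ?addr0// => i _; rewrite big1// => j _; rewrite mulr0 mul0r.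
Qed.

Lemma orbit_algebra_subhomogeneous : subhomogeneous (closure orbit_algebra).
Proof.
have SA := closure_star_algebra orbit_algebra_star.
apply: (tower_subhomogeneous e_idem e_star z_e z_z Cc_star Cc_e eCc _ gstar g1 g_Cc
  brk_star_algebra brk_DL).
  by have [v1 v2 v3 v4] := w0_unitary; exact: bicommutant_comm.
move=> H pi irr L0.
apply: (breaking_coordinates (od_etac od) (od_hit od) (od_eta01 od) X_compact SA irr).
- exact: away_idem.
- exact: away_star.
- move=> x hx; apply: subset_closure; exists x => //; exists (fun _ _ => 0).
    by move=> i j; apply: coef0; exact: Cc_star.
  by rewrite /tower big1 ?addr0// => i _; rewrite big1// => j _; rewrite mulr0 mul0r.
- exact: central_invariant.
- move=> s x Ss.
  have SPs : closure orbit_algebra (P * s).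
    have [_ Pcent] := central_invariant (conj (contR_cst X 1) (fun x (_ : eta x = 0) => erefl (1 : R))).
    by have [] := Pcent _ Ss; rewrite phi1 mulr1.
  have SLs : closure orbit_algebra (tower_proj * s).
    have -> : tower_proj * s = s - P * s by rewrite /P mulrBl mul1r opprB addrC subrK.
    have [Scl _ _] := SA; apply: (closedD Scl) => //; rewrite -scaleN1r.
    exact: (closedZ _ Scl).
  have -> : P * s = s + (-1) *: (tower_proj * s) by rewrite scaleN1r /P mulrBl mul1r.
  have [Scl _ _] := SA.
  rewrite (repD irr)//; last exact: (closedZ _ Scl).
  by rewrite (repZ SA irr)// L0// scaler0 addr0.
Qed.

Lemma tower_shift_mem : orbit_algebra tower_shift.
Proof.
have -> : tower_shift = P * V * P + tower z shift_coef.
  by rewrite -tower_shift_away -tower_shiftE -mulrDr /P subrK mulr1.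
apply: orbit_algebra_mem; first exact: brk_V.
move=> i j; have [v1 v2 v3 v4] := w0_unitary.
have h0 : tower_coef Cc g 0 by apply: coef0; exact: Cc_star.
rewrite /shift_coef; case: eqP => _; case: eqP => _ //; rewrite -[X in tower_coef _ _ X]mulr1;
  apply: (coefC Cc_star) => //; [exact: bicommutant_mem|exact: Cc_e].
Qed.

Lemma orbit_algebra_g x : span_set g x -> orbit_algebra x.
Proof.
move=> gx; have gz i : x * z i = z i * x by exact: g_level.
have gsz i : x * cstar (z i) = cstar (z i) * x.
  by apply: g_star => // x' gx'; exact: g_level.
have [t1 t2] := tower_comm (fun i j => if i == j then e else 0) gz gsz.
have xL : x * tower_proj = tower_proj * x.
  rewrite /tower_proj /tower_diag t1 t2; apply: eq_tower => i j.
  by case: eqP => _; rewrite ?mulr0 ?mul0r// gE.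
have -> : x = P * x * P + tower z (fun i j => (if i == j then e else 0) * x).
  have xP : x * P = P * x by rewrite /P mulrBr mulrBl mulr1 mul1r xL.
  by rewrite -t2 -/(tower_diag z e) -/tower_proj -mulrA xP mulrA away_idem /P mulrBl mul1r subrK.
apply: orbit_algebra_mem; first by apply: brk_G; exact: gG.
move=> i j; apply: (coefC Cc_star) => //; case: eqP => _; first exact: Cc_e.
by case: Cc_star.
Qed.

Lemma g_berg_rotation x : span_set g x -> x * berg_rotation = berg_rotation * x.
Proof.
move=> gx; rewrite /berg_rotation /berg mulrDr mulrDl mulr1 mul1r; congr (_ + _).
rewrite mulr_sumr mulr_suml; apply: eq_bigr => j _.
have xg : x * gam j = gam j * x.
  apply: (exchange_comm sk) => v.
  have gcomm (v' : T) : (forall x', span_set g x' -> x' * v' = v' * x') ->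
      x * v' = v' * x /\ x * cstar v' = cstar v' * x.
    by move=> hv; split; [exact: hv|exact: g_star].
  case=> [->|[->|[->|[->|->]]]]; apply: gcomm => x' gx' //.
  - exact: g_level.
  - exact: g_level.
  - exact: g_shift.
  - exact: gphi.
  - exact: gy.
have xg1 : x * (gam j - 1) = (gam j - 1) * x by rewrite mulrBr mulrBl xg mulr1 mul1r.
have key v w t : x * v = v * x -> x * w = w * x -> x * t = t * x ->
    x * (v * w * t) = v * w * t * x.
  by move=> hv hw ht; rewrite !mulrA hv -[v * x * w]mulrA hw !mulrA -[_ * x * t]mulrA ht !mulrA.
by apply: (key) => //; exact: gupow.
Qed.

(** On each level the function is within [del / N] of a constant, so replacing it by constants on
    the tower costs [del] in all. With [L] the tower projection and [K] the replacement, the error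
    is the sum of [L f - K] and [f L - K] minus [(L f - K) L], whence the factor 3. *)
Lemma orbit_algebra_f r : exists2 s, orbit_algebra s & nrm (phi (f r) - s) <= 3%:R * del.
Proof.
have fc := od_f od r; have N0 := od_N od; have d0 := od_del od.
have /choice[c hcx] (i : 'I_N) : exists c : R[i]^o, forall x, tau x != 0 ->
    N%:R * nrm (f r (alz i.+1%:Z x) - c) <= del.
  by apply: (od_tau_f od r); exact: ltn_ord.
pose K := tower z (fun i j => if i == j then c i *: e else 0).
have KE : K = \sum_i c i *: (z i * cstar (z i)).
  apply: eq_bigr => i _; rewrite (big_only1 i) ?eqxx => [|//|j ji _].
    by rewrite scAr scAl z_e.
  by rewrite eq_sym (negPf ji) mulr0 mul0r.
have coefK (i j : 'I_N) : tower_coef Cc g (if i == j then c i *: e else 0).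
  case: eqP => _; last by apply: coef0; exact: Cc_star.
  rewrite -[X in tower_coef _ _ X]mulr1; apply: (coefC Cc_star) => //.
  by apply: star_algebraZ; [exact: Cc_star|exact: Cc_e].
have [LK KL] := coef_tower_proj coefK; rewrite -/K in LK KL.
have LE : tower_proj = \sum_i z i * cstar (z i) by rewrite tower_projE big_add1 big_mkord.
have nz i : nrm (z i) <= 1.
  by apply: (nrm_partial e_star e_idem); rewrite z_z eqxx.
have close i : N%:R * nrm (phi (f r) * z i - c i *: z i) <= del /\
    N%:R * nrm (cstar (z i) * phi (f r) - c i *: cstar (z i)) <= del.
  have key (f' : X -> R[i]^o) (c' : R[i]^o) : contC f' ->
      (forall x, tau x != 0 -> N%:R * nrm (f' (alz i.+1%:Z x) - c') <= del) ->
      N%:R * nrm (phi f' * z i - c' *: z i) <= del.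
    move=> fc' hc'.
    pose F x := (f' (alz i.+1%:Z x) - c') * (tau x)%:C.
    have fac : contC (fun x => f' (alz i.+1%:Z x)) by exact: (contC_alz _ fc').
    have fdc : contC (fun x => f' (alz i.+1%:Z x) - c').
      by apply: contC_add => //; exact: contC_cst.
    have Fc : contC F by apply: contC_mul => //; exact: contC_real.
    have nF : nrm (phi F) <= del / N%:R.
      apply: nrm_phi => // [|x]; first by rewrite divr_ge0// ltW.
      rewrite /F nrm_mulC nrm_realC; have := od_tau01 od x => t01.
      have [->|t0] := eqVneq (tau x) 0.
        by rewrite normr0 mulr0 divr_ge0// ltW.
      have := hc' x t0; rewrite mulrC -ler_pdivlMr ?ltr0n// ger0_norm; last by lra.
      by have := nrm_ge0 (f' (alz i.+1%:Z x) - c'); nra.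
    have -> : phi f' * z i - c' *: z i = upow i.+1%:Z * phi F * bottom.
      have Ft : phi F = phi (fun x => f' (alz i.+1%:Z x) - c') * rphi tau.
        by rewrite -phiM//; exact: contC_real.
      rewrite Ft -[RHS]mulrA -[_ * rphi tau * bottom]mulrA bottom_tau /z /level.
      have -> : phi (fun x => f' (alz i.+1%:Z x) - c') =
          phi (fun x => f' (alz i.+1%:Z x)) - c' *: (1 : T).
        rewrite -phi1 -phiZ; last exact: contC_cst.
        rewrite -phiN; last by apply: contC_mul; exact: contC_cst.
        rewrite -phiD//; last by apply/contC_opp/contC_mul; exact: contC_cst.
        by congr phi; apply/funext => x; rewrite mulr1.
      by rewrite mulrBl mulrBr scAl mul1r scAr [phi f' * _]mulrA phi_upow// -[_ * bottom]mulrA.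
    have nz0 : nrm bottom <= 1 by exact: (nrm_partial e_star e_idem bottom_bottom).
    rewrite mulrC -ler_pdivlMr ?ltr0n//; apply: le_trans nF.
    have h1 := nrmM (upow i.+1%:Z * phi F) bottom; have h2 := nrmM (upow i.+1%:Z) (phi F).
    have h3 := nrm_upow i.+1%:Z; have h4 := nrm_ge0 (phi F).
    have h5 := nrm_ge0 bottom; have h6 := nrm_ge0 (upow i.+1%:Z * phi F).
    have h7 : nrm (upow i.+1%:Z) * nrm (phi F) <= nrm (phi F) by rewrite ler_piMl.
    by apply: le_trans h1 _; apply: le_trans (ler_piMr h6 nz0) _; exact: le_trans h7.
  split; first by apply: key => // x; exact: hcx.
  (* The second estimate is the adjoint of the first one for the conjugate function. *)
  have fcc := contC_conj fc.
  have := key (fun x => Num.conj (f r x)) (Num.conj (c i)) fcc.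
  have -> : phi (fun x => Num.conj (f r x)) * z i - Num.conj (c i) *: z i =
      cstar (cstar (z i) * phi (f r) - c i *: cstar (z i)).
    by rewrite starB starM starK starZ starK -phi_star.
  rewrite nrm_star; apply => x t0.
  by rewrite -rmorphB nrm_conj; exact: hcx.
pose s := P * phi (f r) * P + K.
exists s; first by apply: orbit_algebra_mem => //; exact: brk_phi.
have sumN (F : 'I_N -> T) : (forall i, N%:R * nrm (F i) <= del) -> nrm (\sum_i F i) <= del.
  move=> hF; apply: le_trans (nrm_sum _ _ _) _.
  apply: le_trans (_ : _ <= \sum_(i < N) del / N%:R) _.
    by apply: ler_sum => i _; rewrite ler_pdivlMr ?ltr0n// mulrC.
  by rewrite sumr_const card_ord -[X in X <= _]mulr_natr divfK// pnatr_eq0 -lt0n.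
have mono (x x' : T) : N%:R * nrm x <= del -> nrm x' <= 1 ->
    N%:R * nrm (x * x') <= del /\ N%:R * nrm (x' * x) <= del.
  move=> hx hx'; have n0 := nrm_ge0 x.
  by split; apply: le_trans hx; apply: ler_wpM2l => //;
    apply: le_trans (nrmM _ _) _; [exact: ler_piMr|exact: ler_piMl].
have nzs i : nrm (cstar (z i)) <= 1 by rewrite nrm_star.
have D1 : nrm (phi (f r) * tower_proj - K) <= del.
  have -> : phi (f r) * tower_proj - K = \sum_i (phi (f r) * z i - c i *: z i) * cstar (z i).
    rewrite LE KE mulr_sumr -sumrB; apply: eq_bigr => i _.
    by rewrite mulrBl scAl mulrA.
  by apply: sumN => i; have [ci _] := close i; have [] := mono _ _ ci (nzs i).
have D2 : nrm (tower_proj * phi (f r) - K) <= del.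
  have -> : tower_proj * phi (f r) - K = \sum_i z i * (cstar (z i) * phi (f r) - c i *: cstar (z i)).
    rewrite LE KE mulr_suml -sumrB; apply: eq_bigr => i _.
    by rewrite mulrBr scAr mulrA.
  by apply: sumN => i; have [_ ci] := close i; have [] := mono _ _ ci (nz i).
have nL : nrm tower_proj <= 1 by exact: (nrm_proj tower_proj_star tower_proj_idem).
have -> : phi (f r) - s = (tower_proj * phi (f r) - K) + (phi (f r) * tower_proj - K) -
    (tower_proj * phi (f r) - K) * tower_proj.
  rewrite /s /P mulrBl [(tower_proj * phi (f r) - K) * tower_proj]mulrBl KL; move: (phi (f r)) => F.
  clearbody K; ncring.
apply: le_trans (nrmB _ _) _; have := nrmD (tower_proj * phi (f r) - K) (phi (f r) * tower_proj - K).
have := nrmM (tower_proj * phi (f r) - K) tower_proj.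
by have := ler_piMr (nrm_ge0 (tower_proj * phi (f r) - K)) nL; lra.
Qed.

End Defect.

Lemma main_algebra : exists S : set T, [/\ cstar_subalgebra S, subhomogeneous S,
  span_set g `<=` S, exists2 s, S s & nrm (u - s) <= 12%:R * Num.sqrt M%:R^-1 &
  forall r, exists2 s, S s & nrm (phi (f r) - s) <= (3%:R + 4%:R * M%:R) * del].
Proof.
have [y [[yy yy' ky yk] [vb gy]]] := defect.
have [Q1 Q2] := berg_rotation_unitary yy yy' ky yk.
pose B := orbit_algebra y; pose Q := berg_rotation y.
have SA : cstar_subalgebra (closure B) by apply: closure_star_algebra; exact: orbit_algebra_star.
have cQ w s c : nrm (w * Q - Q * w) <= c -> nrm (w - Q * s * cstar Q) <= c + nrm (w - s).
  move=> hc'; have nQ := nrm_isometry Q1.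
  have nQs : nrm (cstar Q) <= 1 by rewrite nrm_star.
  have -> : w - Q * s * cstar Q = (w * Q - Q * w) * cstar Q + Q * (w - s) * cstar Q.
    transitivity (w * (Q * cstar Q) - Q * s * cstar Q); first by rewrite Q2 mulr1.
    by clearbody Q; ncring.
  apply: le_trans (nrmD _ _) _; apply: lerD.
    by apply: le_trans (nrmM _ _) _; apply: le_trans hc'; rewrite ler_piMr ?nrm_ge0.
  apply: le_trans (nrmM _ _) _; apply: le_trans (ler_piMr (nrm_ge0 _) nQs) _.
  by apply: le_trans (nrmM _ _) _; rewrite ler_piMl ?nrm_ge0.
(* The algebra is conjugated by the Berg rotation, which commutes with the span of [g], almost
   commutes with the functions and almost carries [tower_shift] to [u]. *)
exists [set s | closure (orbit_algebra y) (cstar Q * s * Q)]; split.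
- exact: conj_cstar_subalgebra.
- by apply: conj_subhomogeneous => //; exact: orbit_algebra_subhomogeneous.
- move=> x gx /=; rewrite -mulrA g_berg_rotation// mulrA Q1 mul1r.
  by apply: subset_closure; exact: orbit_algebra_g.
- exists (Q * tower_shift y * cstar Q) => /=.
    have -> : cstar Q * (Q * tower_shift y * cstar Q) * Q = tower_shift y.
      by move: (tower_shift y) => w; rewrite !mulrA Q1 mul1r -mulrA Q1 mulr1.
    by apply: subset_closure; exact: tower_shift_mem.
  have nQs : nrm (cstar Q) <= 1 by rewrite nrm_star; exact: nrm_isometry.
  have -> : u - Q * tower_shift y * cstar Q = (u * Q - Q * tower_shift y) * cstar Q.
    by rewrite mulrBl -[u * Q * _]mulrA Q2 mulr1.
  apply: le_trans (nrmM _ _) _; apply: le_trans (ler_piMr (nrm_ge0 _) nQs) _.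
  exact: berg_rotation_conj.
- move=> r; have [s Bs sc] : exists2 s, B s & nrm (phi (f r) - s) <= 3%:R * del.
    exact: orbit_algebra_f.
  exists (Q * s * cstar Q) => /=.
    by rewrite !mulrA Q1 mul1r -mulrA Q1 mulr1; exact: subset_closure.
  have fQ : nrm (phi (f r) * Q - Q * phi (f r)) <= M%:R * (4%:R * del).
    exact: berg_rotation_comm.
  by have := cQ _ s _ fQ; rewrite mulrDl; lra.
Qed.

End MainAlgebra.

(** * The tower over a single finite orbit *)

Section Periodic.
Variables (d : nat) (g : 'I_d -> T).
Hypotheses (gstar : star_algebra (span_set g)) (g1 : span_set g 1)
  (gphi : forall x f, span_set g x -> contC f -> x * phi f = phi f * x)
  (gu : forall x, span_set g x -> x * u = u * x).
Variables (x0 : X) (N : nat) (delta : X -> R).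
Hypotheses (N0 : (0 < N)%N) (dc : contR delta) (d1 : delta x0 = 1)
  (d0 : forall x, x <> x0 -> delta x = 0)
  (surj : forall x, exists2 i : nat, (i < N)%N & x = alz i%:Z x0)
  (inj : forall i j : nat, (i < N)%N -> (j < N)%N -> alz i%:Z x0 = alz j%:Z x0 -> i = j)
  (per : alz N%:Z x0 = x0).

(** [delta] is the characteristic function of the isolated point [x0], so functions act on [e] by
    scalars. The ranges of the [z i] fill the whole space, and [w] is the unitary of the corner
    obtained by going once around the orbit. *)
Let e := rphi delta.
Let z (i : 'I_N) := upow i%:Z * e.
Let w := upow N%:Z * e.

Lemma per_delta_only (F G : X -> R[i]^o) : F x0 = G x0 ->
  (fun x => F x * (delta x)%:C) = (fun x => G x * (delta x)%:C).
Proof.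
move=> FG; apply/funext => x; have [->|xx0] := pselect (x = x0); first by rewrite FG.
by rewrite d0// !mulr0.
Qed.

Lemma phi_delta F : contC F -> phi F * e = F x0 *: e.
Proof.
move=> Fc; have ec := contC_real dc; rewrite -phiM// -phiZ//; congr phi.
exact: (per_delta_only (G := fun=> F x0)).
Qed.

Lemma per_e_star : cstar e = e. Proof. exact: rphi_star. Qed.

Lemma per_e_idem : e * e = e.
Proof. by rewrite {1}/e phi_delta ?d1 ?scale1r//; exact: contC_real. Qed.

Lemma per_z_e i : z i * e = z i. Proof. by rewrite /z -mulrA per_e_idem. Qed.

Lemma per_e_upow j : e * upow j * e = (delta (alz j x0))%:C *: (upow j * e).
Proof.
have ec := contC_real dc.
rewrite {1}/e /rphi phi_upow// -mulrA phi_delta ?scAr//.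
exact: (contC_alz _ ec).
Qed.

Lemma per_z_z i j : cstar (z i) * z j = if i == j then e else 0.
Proof.
have -> : cstar (z i) * z j = e * (upow (- i%:Z) * upow j%:Z) * e.
  by rewrite /z starM upow_star per_e_star !mulrA.
rewrite -upowD; case: eqP => [->|ij]; first by rewrite addNr upow0 mulr1 per_e_idem.
rewrite per_e_upow d0 ?scale0r// => h; apply: ij; apply: val_inj.
apply: inj; rewrite ?ltn_ord//.
by rewrite -[in LHS]h -alzD addrA addrN add0r.
Qed.

Lemma per_wwP : [/\ cstar w * w = e, w * cstar w = e, e * w = w & w * e = w].
Proof.
have ew : e * w = w by rewrite /w mulrA per_e_upow per d1 scale1r.
have dN x : delta (alz N%:Z x) = delta x.
  have [i iN ->] := surj x; rewrite -alzD addrC alzD per//.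
have eN : e * upow N%:Z = upow N%:Z * e.
  by rewrite /e rphi_upow//; congr (_ * _); apply: rphi_eq.
split => //; last by rewrite /w -mulrA per_e_idem.
  by rewrite /w starM upow_star per_e_star mulrA -[e * _ * _]mulrA upowK mulr1 per_e_idem.
rewrite /w starM upow_star per_e_star -eN.
by rewrite mulrA -[e * _ * e]mulrA -eN mulrA per_e_idem -mulrA upowNK mulr1.
Qed.

Lemma per_L1 : tower_diag z e = 1.
Proof.
have -> : tower_diag z e = \sum_(i < N) rphi (fun x => delta (alz (- i%:Z) x)).
  rewrite /tower_diag /tower; apply: eq_bigr => i _.
  rewrite (big_only1 i) ?eqxx => [|//|j ji _]; last by rewrite eq_sym (negPf ji) mulr0 mul0r.
  rewrite per_z_e /z starM upow_star per_e_star mulrA -[_ * e * e]mulrA per_e_idem.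
  rewrite /e -mulrA rphi_upow// mulrA upowNK mul1r//.
rewrite rphi_sum => [|i]; last exact: contR_alz.
apply: rphi1 => x; have [i iN ->] := surj x.
rewrite (big_only1 (Ordinal iN))//= => [|j ji _].
  by rewrite (zitK alK beK) d1.
rewrite d0// => h; case/eqP: ji; apply: val_inj => /=.
apply/esym; apply: inj => //.
by rewrite -[in RHS]h (zitNK alK beK).
Qed.

Let Cc := bicommutant e w.
Let Dz : set T := [set 0].

Lemma per_Dz_star : star_algebra Dz.
Proof.
split => //.
- by move=> a x y -> ->; rewrite /Dz /= scaler0 addr0.
- by move=> x y -> ->; rewrite /Dz /= mulr0.
- by move=> x ->; rewrite /Dz /= star0.
Qed.

Lemma per_gupow x j : span_set g x -> x * upow j = upow j * x.
Proof. exact: (Gupow gstar gu). Qed.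

Lemma per_ge x : span_set g x -> x * e = e * x.
Proof. by move=> gx; apply: gphi => //; exact: contC_real. Qed.

Lemma per_gw x : span_set g x -> x * w = w * x.
Proof. by move=> gx; rewrite /w mulrA per_gupow// -mulrA per_ge// mulrA. Qed.

Lemma per_gC x c : span_set g x -> Cc c -> x * c = c * x.
Proof.
move=> gx [_ _ hC]; rewrite hC//; first exact: per_gw.
have gs : span_set g (cstar x) by case: gstar => _ _ _; exact.
by rewrite -{1}[x]starK -starM -(per_gw gs) starM starK.
Qed.

Lemma per_DL y y' : Dz y -> Dz y' -> Dz (y * (1 - tower_diag z e) * y').
Proof. by move=> -> ->; rewrite /Dz /= mulr0. Qed.

Let base0 := tower_algebra e z Cc g Dz.

Lemma per_Cstar : star_algebra Cc. Proof. exact: (bicommutant_star w per_e_star). Qed.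

Lemma per_Ce : Cc e.
Proof. by have [v1 v2 v3 v4] := per_wwP; apply: bicommutant_unit; rewrite ?per_e_idem. Qed.

Lemma per_tower_base q : (forall i j, tower_coef Cc g (q i j)) -> base0 (tower z q).
Proof.
by move=> hq; exists 0 => //; exists q => //; rewrite mulr0 mul0r add0r.
Qed.

(** Since the tower projection is 1 by [per_L1], an element is determined by its products with the
    [z j]. *)
Lemma per_resolve x q : (forall j, x * z j = \sum_i z i * q i j) -> x = tower z q.
Proof.
move=> hx; rewrite -[LHS]mulr1 -per_L1 /tower_diag /tower exchange_big /= mulr_sumr.
rewrite [RHS]exchange_big; apply: eq_bigr => j _ /=.
rewrite (big_only1 j) ?eqxx => [|//|i ij _]; last by rewrite (negPf ij) mulr0 mul0r.
by rewrite per_z_e mulrA hx mulr_suml.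
Qed.

Lemma periodic_algebra : exists S : set T, [/\ cstar_subalgebra S, subhomogeneous S,
  span_set g `<=` S, S u & forall f, contC f -> S (phi f)].
Proof.
have [v1 v2 v3 v4] := per_wwP.
have eC c : Cc c -> e * c = c by case.
have CC c c' : Cc c -> Cc c' -> c * c' = c' * c by exact: bicommutant_comm.
have base_star : star_algebra base0.
  exact: (tower_algebra_star per_e_idem per_e_star per_z_z per_Cstar eC gstar per_gC
    per_Dz_star per_DL).
have h0 : tower_coef Cc g 0 by apply: coef0; exact: per_Cstar.
have coef c : Cc c -> tower_coef Cc g c.
  by move=> hc; rewrite -[c]mulr1; apply: coefC => //; exact: per_Cstar.
exists (closure base0); split.
- exact: closure_star_algebra.
- apply: (tower_subhomogeneous (J := 'I_0) per_e_idem per_e_star per_z_e per_z_z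
    per_Cstar per_Ce eC CC gstar g1 per_gC
    per_Dz_star per_DL) => H pi irr _.
  exists (fun _ _ => 0) => n y c hy _ x.
  rewrite big1 ?mulr0 ?mul0r => [|i _]; last by rewrite hy scaler0.
  exact: (rep0 (closure_star_algebra base_star) irr).
- move=> x gx; apply: subset_closure.
  have -> : x = tower z (fun i j => if i == j then e * x else 0).
    apply: per_resolve => j; rewrite (big_only1 j) ?eqxx => [|//|i ij _].
      by rewrite mulrA per_z_e /z mulrA per_gupow// -mulrA per_ge// mulrA.
    by rewrite (negPf ij) mulr0.
  by apply: per_tower_base => i j; case: eqP => _ //; apply: coefC => //;
    [exact: per_Cstar|exact: per_Ce].
- apply: subset_closure.
  pose q (i j : 'I_N) := if j.+1 == N then (if i == 0%N :> nat then w else 0)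
    else if i == j.+1 :> nat then e else 0.
  have -> : u = tower z q.
    apply: per_resolve => j; rewrite /q.
    have -> : u * z j = upow j.+1%:Z * e.
      by rewrite /z mulrA -upowS; congr (upow _ * _); lia.
    have [jN|jN] := eqVneq j.+1 N.
      rewrite (big_only1 (Ordinal N0))// => [|i i0 _].
        have -> : (Ordinal N0 == 0%N :> nat) = true by [].
        have -> : z (Ordinal N0) = e by exact: mul1r.
        by rewrite v3 /w -[in RHS]jN.
      case: ifP => [hi|_]; last by rewrite mulr0.
      by case/eqP: i0; apply: val_inj; apply/eqP.
    have jlt : (j.+1 < N)%N by have := ltn_ord j; lia.
    rewrite (big_only1 (Ordinal jlt))//= => [|i i0 _]; first by rewrite eqxx per_z_e.
    case: ifP => [hi|_]; last by rewrite mulr0.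
    by case/eqP: i0; apply: val_inj; apply/eqP.
  apply: per_tower_base => i j; rewrite /q; case: eqP => _; case: eqP => _ //;
    apply: coef => //; last exact: per_Ce.
  exact: bicommutant_mem.
- move=> f fc; apply: subset_closure.
  have -> : phi f = tower z (fun i j => if i == j then f (alz i%:Z x0) *: e else 0).
    apply: per_resolve => j; rewrite (big_only1 j) ?eqxx => [|//|i ij _].
      rewrite scAr per_z_e /z mulrA phi_upow// -mulrA phi_delta ?scAr//.
      exact: (contC_alz _ fc).
    by rewrite (negPf ij) mulr0.
  apply: per_tower_base => i j; case: eqP => _ //; apply: coef.
  by apply: star_algebraZ; [exact: per_Cstar|exact: per_Ce].
Qed.

End Periodic.

End CovariantPair.
Lemma nat_window (j : int) (n : nat) : `|j| <= n%:Z ->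
  exists2 i : nat, (i < (n + n).+1)%N & i%:Z = j + n%:Z.
Proof. by move=> jn; exists (absz (j + n%:Z)%R); lia. Qed.

(** * Minimal dynamics *)

Section Dynamics.
Variables (R : realType) (X : topologicalType) (d : X -> X -> R).
Hypotheses (d_eq0 : forall x y, d x y = 0 <-> x = y) (d_sym : forall x y, d x y = d y x)
  (d_tri : forall x y z, d x z <= d x y + d y z)
  (d_nbhs : forall (x : X) (V : set X),
     nbhs x V <-> exists2 e : R, 0 < e & [set y | d x y < e] `<=` V).
Hypothesis X_compact : compact [set: X].

Lemma dist_ge0 x y : 0 <= d x y.
Proof.
have := d_tri x y x; rewrite (d_sym y).
have -> : d x x = 0 by apply/d_eq0.
lra.
Qed.

Lemma dist_gt0 x y : x <> y -> 0 < d x y.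
Proof. by move=> xy; rewrite lt_def dist_ge0 andbT; apply/eqP => /d_eq0. Qed.

Lemma distxx x : d x x = 0. Proof. exact/d_eq0. Qed.

Lemma contR_dist p : contR (fun x => d x p).
Proof.
split; apply/cont_absP => x e e0; apply/d_nbhs; exists e => // y xy /=.
have h1 := d_tri x y p; have h2 := d_tri y x p; rewrite (d_sym y x) in h2.
by rewrite ltr_norml; apply/andP; split; move: xy => /=; lra.
Qed.

Lemma contR_near (r : X -> R) p (e : R) : contR r -> 0 < e ->
  exists2 rho : R, 0 < rho & forall x, d x p < rho -> `|r x - r p| < e.
Proof.
move=> [/cont_absP rc] e0; have /d_nbhs[rho rho0 h] := rc p e e0.
by exists rho => // x; rewrite d_sym => /h /=; rewrite distrC.
Qed.

Lemma contC_near (f : X -> R[i]^o) p (e : R) : contC f -> 0 < e ->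
  exists2 rho : R, 0 < rho & forall x, d x p < rho -> nrm (f x - f p) < e.
Proof.
move=> [/cont_nrmP fc] e0; have /d_nbhs[rho rho0 h] := fc p e e0.
by exists rho => // x; rewrite d_sym => /h /=; rewrite nrmBC.
Qed.

Lemma finite_radius (I : eqType) (s : seq I) (P : I -> R -> Prop) :
  (forall i r r', 0 < r -> r <= r' -> P i r' -> P i r) ->
  (forall i, i \in s -> exists2 r, 0 < r & P i r) ->
  exists2 r, 0 < r & forall i, i \in s -> P i r.
Proof.
move=> Pm; elim: s => [|i s ih] h; first by exists 1.
have [|r r0 hr] := ih; first by move=> j js; apply: h; rewrite inE js orbT.
have [|r' r0' hr'] := h i; first by rewrite inE eqxx.
exists (Num.min r r'); first by rewrite lt_min r0.
move=> j; rewrite inE => /orP[/eqP ->|js].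
  by apply: Pm hr'; rewrite ?lt_min ?r0// ge_min lexx orbT.
by apply: Pm (hr j js); rewrite ?lt_min ?r0// ge_min lexx.
Qed.

Lemma int_radius (K : nat) (P : int -> R -> Prop) :
  (forall i r r', 0 < r -> r <= r' -> P i r' -> P i r) ->
  (forall i, `|i| <= K%:Z -> exists2 r, 0 < r & P i r) ->
  exists2 r, 0 < r & forall i, `|i| <= K%:Z -> P i r.
Proof.
move=> Pm h; pose s := [seq i%:Z - K%:Z | i <- iota 0 (K + K).+1].
have sK i : (i \in s) = (`|i| <= K%:Z).
  apply/mapP/idP => [[j]|iK]; first by rewrite mem_iota => jK ->; lia.
  by exists (absz (i + K%:Z)%R); [rewrite mem_iota|]; lia.
have [|r r0 hr] := @finite_radius _ s P Pm; first by move=> i; rewrite sK; exact: h.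
by exists r => // i; rewrite -sK; exact: hr.
Qed.

Lemma ord_radius n (P : 'I_n -> R -> Prop) :
  (forall i r r', 0 < r -> r <= r' -> P i r' -> P i r) ->
  (forall i, exists2 r, 0 < r & P i r) -> exists2 r, 0 < r & forall i, P i r.
Proof.
move=> Pm h; have [|r r0 hr] := @finite_radius _ (enum 'I_n) P Pm; first by move=> i _.
by exists r => // i; apply: hr; rewrite mem_enum.
Qed.

Definition clip (t : R) : R := Num.max 0 (Num.min 1 t).

Lemma clip01 t : 0 <= clip t <= 1.
Proof. by rewrite le_max lexx /= ge_max ler01 ge_min lexx. Qed.

Lemma clip1 t : 1 <= t -> clip t = 1.
Proof. by move=> t1; rewrite /clip min_l// max_r. Qed.

Lemma clip0 t : t <= 0 -> clip t = 0.
Proof. by move=> t0; rewrite /clip min_r ?max_l//; lra. Qed.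

Lemma contR_clip r : contR r -> contR (fun x : X => clip (r x)).
Proof.
by move=> rc; apply: contR_max; [exact: contR_cst|apply: contR_min => //; exact: contR_cst].
Qed.

(** Equal to 1 up to distance [(c - 1) * rho] and to 0 from [c * rho] on. For fixed [rho], raising
    [c] by 1 gives a bump that is 1 wherever the previous one is nonzero. *)
Definition bump (c : R) (p : X) (rho : R) x := clip (c - d x p / rho).

Lemma contR_bump c p rho : contR (bump c p rho).
Proof.
apply: contR_clip; apply: contR_add; first exact: contR_cst.
by apply/contR_opp/contR_mul; [exact: contR_dist|exact: contR_cst].
Qed.

Lemma bump1 c p rho x : 0 < rho -> d x p <= (c - 1) * rho -> bump c p rho x = 1.
Proof.
move=> r0 h; apply: clip1; have : d x p / rho <= c - 1 by rewrite ler_pdivrMr.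
lra.
Qed.

Lemma bump0 c p rho x : 0 < rho -> bump c p rho x != 0 -> d x p < c * rho.
Proof.
move=> r0; apply: contraR; rewrite -leNgt => h; apply/eqP; apply: clip0.
have : c <= d x p / rho by rewrite ler_pdivlMr.
lra.
Qed.

Variables (al be : X -> X).
Hypotheses (alK : cancel al be) (beK : cancel be al)
  (alc : continuous al) (bec : continuous be) (al_minimal : minimal al).
Local Notation alz := (zit al be).
Lemma orbit_dense p (rho : R) x : 0 < rho -> exists j : int, d (alz j x) p < rho.
Proof.
move=> r0; have : closure (full_orbit al x) p by rewrite al_minimal.
have Bp : nbhs p [set y | d p y < rho] by apply/d_nbhs; exists rho.
move=> /(_ _ Bp)[y [[n [->|xy]] /= yp]].
  by exists n%:Z; rewrite d_sym.
exists (- n%:Z); rewrite d_sym.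
suff -> : alz (- n%:Z) x = y by [].
by rewrite xy; exact: (zitK alK beK n%:Z).
Qed.

(** A periodic orbit is finite, so a point outside it would have a positive distance from it,
    against minimality. A bump narrower than the distances from [x] to the other points isolates
    [x]. *)
Lemma periodic_points x n : (0 < n)%N -> iter n al x = x -> exists (N : nat) (delta : X -> R),
  [/\ (0 < N)%N, contR delta, delta x = 1 & forall y, y <> x -> delta y = 0] /\
  [/\ forall y, exists2 i : nat, (i < N)%N & y = alz i%:Z x,
    forall i j : nat, (i < N)%N -> (j < N)%N -> alz i%:Z x = alz j%:Z x -> i = j &
    alz N%:Z x = x].
Proof.
move=> n0 nx.
have exN : exists N : nat, `[< (0 < N)%N /\ iter N al x = x >].
  by exists n; apply/asboolP.
case: (ex_minnP exN) => N /asboolP[N0 Nx] Nmin.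
have inF j : exists2 i : nat, (i < N)%N & alz j x = alz i%:Z x.
  elim/int_ind: j => [|k [i iN ih]|k [i iN ih]]; first by exists 0%N.
    have -> : alz k.+1%:Z x = al (alz k%:Z x) by [].
    rewrite ih; have [iN'|iN'] := ltnP i.+1 N; first by exists i.+1.
    by exists 0%N => //; rewrite -[RHS]Nx; have -> : N = i.+1 by lia.
  have -> : - k.+1%:Z = - k%:Z - 1 by lia.
  rewrite (zitP alK beK) ih; case: i iN {ih} => [|i] iN.
    exists N.-1; first by lia.
    rewrite -{1}[x]Nx; have -> : N = N.-1.+1 by lia.
    by rewrite /= alK.
  by exists i; [lia|rewrite /= alK].
have surj y : exists2 i : nat, (i < N)%N & y = alz i%:Z x.
  apply: contrapT => ny.
  have [||r r0 hr] := @ord_radius N (fun i r => r <= d (alz i%:Z x) y).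
  - by move=> i r r' _; exact: le_trans.
  - move=> i; exists (d (alz i%:Z x) y) => //; apply: dist_gt0 => iy.
    by apply: ny; exists i.
  have [j] := orbit_dense y x r0; have [i iN ->] := inF j.
  by have := hr (Ordinal iN) => /=; lra.
have inj (i j : nat) : (i < j)%N -> (j < N)%N -> alz i%:Z x <> alz j%:Z x.
  move=> ij jN h; have : (N <= j - i)%N; last by lia.
  apply: Nmin; apply/asboolP; split; first by lia.
  rewrite -[LHS]/(alz (j - i)%N%:Z x).
  have -> : (j - i)%N%:Z = - i%:Z + j%:Z by lia.
  by rewrite (alzD alK beK) -h (zitK alK beK).
have [||r r0 hr] := @ord_radius N (fun i r => (0 < i)%N -> r <= d (alz i%:Z x) x).
- by move=> i r r' _ rr h /h; exact: le_trans.
- move=> i; exists (if (0 < i)%N then d (alz i%:Z x) x else 1); last by move=> ->.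
  case: posnP => // i0; apply: dist_gt0 => h; apply: (inj 0%N i) => //.
exists N, (bump 2%:R x (r / 2%:R)); split; split => //.
- exact: contR_bump.
- by apply: bump1; rewrite ?distxx; lra.
- move=> y yx; apply/eqP; apply: contraT => /bump0 h.
  have [i iN yi] := surj y; case: i iN yi => [|i] iN yi; first by case: yx.
  have := hr (Ordinal iN) isT; rewrite -[nat_of_ord (Ordinal iN)]/i.+1 -yi.
  by have := h _; lra.
- move=> i j iN jN h; have [ij|ij|//] := ltngtP i j.
    by case: (inj i j ij jN).
  by case: (inj j i ij iN).
Qed.

Hypothesis aperiodic : forall x n, (0 < n)%N -> iter n al x <> x.

Lemma alz_free (i j : int) x : alz i x = alz j x -> i = j.
Proof.
have key (n : nat) (k k' : int) y : k = k' + n%:Z -> alz k y = alz k' y -> k = k'.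
  move=> ->; rewrite addrC (alzD alK beK).
  case: n => [|n]; first by rewrite add0r.
  by move=> /(aperiodic (ltn0Sn n)).
move=> h; have [ij|ij] := lerP j i.
  by apply: (key (absz (i - j)%R) _ _ x) => //; lia.
by apply/esym; apply: (key (absz (j - i)%R) _ _ x) => //; lia.
Qed.

Lemma contR_dist_alz j p : contR (fun x => d (alz j x) p).
Proof. by apply: (contR_comp (contR_dist p)); exact: alz_cont. Qed.

Lemma alz_near j p (e : R) : 0 < e ->
  exists2 rho : R, 0 < rho & forall x, d x p < rho -> d (alz j x) (alz j p) < e.
Proof.
move=> e0; have [rho r0 h] := contR_near p (contR_dist_alz j (alz j p)) e0.
exists rho => // x /h; rewrite distxx subr0 ger0_norm//; exact: dist_ge0.
Qed.

Lemma disjoint_radius p K : exists2 rho : R, 0 < rho &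
  forall j : int, `|j| <= K%:Z -> j != 0 -> forall x, d x p < rho -> rho <= d (alz j x) p.
Proof.
apply: (int_radius (P := fun j rho => j != 0 -> forall x, d x p < rho -> rho <= d (alz j x) p)).
  move=> j r r' r0 rr h j0 x xr; apply: (le_trans rr); apply: h => //.
  exact: lt_le_trans rr.
move=> j _; have [->|j0] := eqVneq j 0; first by exists 1.
have e0 : 0 < d (alz j p) p.
  by apply: dist_gt0 => /(@alz_free j 0)/eqP; rewrite (negPf j0).
pose e := d (alz j p) p / 2%:R.
have [|rho r0 h] := @alz_near j p e; first by rewrite /e; lra.
exists (Num.min rho e); first by rewrite lt_min r0 /e; lra.
move=> _ x; rewrite lt_min => /andP[/h h1 _].
have := d_tri (alz j p) (alz j x) p; rewrite (d_sym (alz j p) (alz j x)).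
have := ge_min e rho e; rewrite lexx orbT.
by rewrite /e in h1 *; lra.
Qed.

Lemma return_time p (rho : R) : 0 < rho ->
  exists n : nat, forall x, exists2 j : int, `|j| <= n%:Z & d (alz j x) p < rho.
Proof.
move=> r0.
pose Q (A : set X) := exists n : nat, forall x, A x ->
  exists2 j : int, `|j| <= n%:Z & d (alz j x) p < rho.
suff [n hn] : Q [set: X] by exists n => x; exact: hn.
apply: compact_induction => //.
- by exists 0%N.
- move=> A B [n hn] [n' hn']; exists (n + n')%N => x [/hn[j jn h]|/hn'[j jn h]].
    by exists j => //; lia.
  by exists j => //; lia.
- by move=> A B AB [n hn]; exists n => x /AB; exact: hn.
- move=> x; have [j xj] := orbit_dense p x r0.
  have [|e e0 h] := contR_near x (contR_dist_alz j p) (e := rho - d (alz j x) p).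
    by lra.
  exists [set y | d x y < e]; first by apply/d_nbhs; exists e.
  exists (absz j) => y; rewrite /= d_sym => /h hy; exists j; first by lia.
  by move: hy; rewrite ltr_norml => /andP[_]; lra.
Qed.

Lemma return_after p (rho : R) : 0 < rho ->
  forall (k : int) x, exists2 j : int, k <= j & d (alz j x) p < rho.
Proof.
move=> r0; have [n hn] := return_time p r0 => k x.
have [j jn h] := hn (alz (k + n%:Z) x).
by exists (j + (k + n%:Z)); [lia|rewrite (alzD alK beK)].
Qed.

Lemma return_before p (rho : R) : 0 < rho ->
  forall (k : int) x, exists2 j : int, j <= k & d (alz j x) p < rho.
Proof.
move=> r0; have [n hn] := return_time p r0 => k x.
have [j jn h] := hn (alz (k - n%:Z) x).
by exists (j + (k - n%:Z)); [lia|rewrite (alzD alK beK)].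
Qed.

Definition onpath (j i : int) := ((0 <= i) && (i < j)) || ((j <= i) && (i < 0)).

(* Moving forward, or else backward, from [x] into the ball around [p] avoids
   the edge at [q], since the orbit of [x] meets [q] at most once. *)
Lemma path_avoiding p q (rho : R) x : 0 < rho ->
  exists2 j : int, d (alz j x) p < rho & forall i, onpath j i -> alz i x <> q.
Proof.
move=> r0; have [[i0 i00 qi]|noq] := pselect (exists2 i : int, 0 <= i & alz i x = q).
  have [j j0 h] := return_before p r0 (-1) x.
  exists j => // i /orP[]; first by lia.
  by move=> ij; rewrite -qi => /alz_free; lia.
have [j j0 h] := return_after p r0 0 x; exists j => // i /orP[] hi xq.
  by apply: noq; exists i => //; lia.
by lia.
Qed.

Lemma inv_succ_lt (e : R) : 0 < e -> exists n : nat, n.+1%:R^-1 < e.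
Proof.
move=> e0; exists (Num.bound e^-1).
have h : e^-1 < (Num.bound e^-1).+1%:R.
  apply: lt_le_trans (archi_boundP _) _; first by rewrite invr_ge0 ltW.
  by rewrite ler_nat.
by rewrite invf_plt ?posrE// ltr0n.
Qed.

(** The same [n] later bounds the length of the path too. Both conditions weaken as [n] grows, so
    finitely many local choices can be merged by compactness. *)
Definition reaches p q (rho : R) (n : nat) (j : int) x :=
  d (alz j x) p < rho /\ forall i, onpath j i -> n.+1%:R^-1 < d (alz i x) q.

Lemma uniform_path p q (rho : R) : 0 < rho ->
  exists n : nat, forall x, exists2 j : int, `|j| <= n%:Z & reaches p q rho n j x.
Proof.
move=> r0.
have le_inv (m n : nat) : (m <= n)%N -> n.+1%:R^-1 <= m.+1%:R^-1 :> R.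
  by move=> mn; rewrite lef_pV2 ?posrE ?ltr0n// ler_nat.
have reaches_le (m n : nat) j x : (m <= n)%N -> reaches p q rho m j x ->
    reaches p q rho n j x.
  move=> mn [h1 h2]; split => // i /h2; apply: le_lt_trans; exact: le_inv.
pose Q (A : set X) := exists n : nat, forall x, A x ->
  exists2 j : int, `|j| <= n%:Z & reaches p q rho n j x.
suff [n hn] : Q [set: X] by exists n => x; exact: hn.
apply: compact_induction => //.
- by exists 0%N.
- move=> A B [n hn] [n' hn']; exists (n + n')%N => x [/hn[j jn h]|/hn'[j jn h]].
    by exists j; [lia|apply: reaches_le h; exact: leq_addr].
  by exists j; [lia|apply: reaches_le h; exact: leq_addl].
- by move=> A B AB [n hn]; exists n => x /AB; exact: hn.
- move=> x; have [j xj avoid] := path_avoiding p q x r0.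
  have [|e e0 h] := contR_near x (contR_dist_alz j p) (e := rho - d (alz j x) p).
    by lra.
  have [||e' e0' h'] := @int_radius (absz j) (fun i r => onpath j i ->
      forall y, d y x < r -> r < d (alz i y) q).
  + move=> i r r' r1 rr hi /hi{}hi y yr; apply: (le_lt_trans rr); apply: hi.
    exact: lt_le_trans rr.
  + move=> i _; have [hi|hi] := boolP (onpath j i); last by exists 1.
    have q0 := dist_gt0 (avoid i hi); pose b := d (alz i x) q / 2%:R.
    have [|b' b0' hb] := contR_near x (contR_dist_alz i q) (e := b).
      by rewrite /b; lra.
    exists (Num.min b' b); first by rewrite lt_min b0' /b; lra.
    move=> _ y; rewrite lt_min => /andP[/hb + _]; rewrite ltr_norml => /andP[+ _].
    by have := ge_min b b' b; rewrite lexx orbT /b; lra.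
  have [n hn] := inv_succ_lt e0'.
  exists [set y | d x y < Num.min e e'].
    by apply/d_nbhs; exists (Num.min e e') => //; rewrite lt_min e0.
  exists (absz j + n)%N => y; rewrite /= d_sym lt_min => /andP[/h hy ye].
  exists j; first by lia.
  split; first by move: hy; rewrite ltr_norml => /andP[_]; lra.
  move=> i hi; apply: (le_lt_trans (le_inv _ _ (leq_addl _ n))).
  apply: (lt_trans hn); apply: h' => //.
  by move: hi; rewrite /onpath; lia.
Qed.

(** A continuous weight, positive exactly where the path of [t - n] steps satisfies [reaches].
    Dividing by the total weight and taking square roots gives the functions [mu]. *)
Definition mu_weight p q (rho : R) n (t : 'I_(n + n).+1) x : R :=
  Num.max 0 (rho - d (alz (t%:Z - n%:Z) x) p) *
  \prod_(s < (n + n).+1 | onpath (t%:Z - n%:Z) (s%:Z - n%:Z))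
    Num.max 0 (d (alz (s%:Z - n%:Z) x) q - n.+1%:R^-1).

Lemma contR_mu_weight p q rho n t : contR (@mu_weight p q rho n t).
Proof.
apply: contR_mul; last apply: contR_prod => i.
  apply: contR_max; first exact: contR_cst.
  by apply: contR_add; [exact: contR_cst|exact/contR_opp/contR_dist_alz].
apply: contR_max; first exact: contR_cst.
by apply: contR_add; [exact: contR_dist_alz|exact: contR_cst].
Qed.

Lemma mu_weight_ge0 p q rho n t x : 0 <= @mu_weight p q rho n t x.
Proof.
by apply: mulr_ge0; [|apply: prodr_ge0 => i _]; rewrite le_max lexx.
Qed.

Lemma mu_weight_gt0 p q (rho : R) n j x : `|j| <= n%:Z -> reaches p q rho n j x ->
  exists t, 0 < @mu_weight p q rho n t x.
Proof.
move=> jn [h1 h2]; have tlt : (absz (j + n%:Z)%R < (n + n).+1)%N by lia.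
exists (Ordinal tlt); rewrite /mu_weight /=.
have -> : (absz (j + n%:Z)%R)%:Z - n%:Z = j by lia.
apply: mulr_gt0; first by rewrite lt_max subr_gt0 h1 orbT.
by apply: prodr_gt0 => i hi; rewrite lt_max subr_gt0 h2// orbT.
Qed.

Lemma mu_weight_near p q (rho : R) n t x : @mu_weight p q rho n t x != 0 ->
  d (alz (t%:Z - n%:Z) x) p < rho.
Proof.
apply: contraR; rewrite -leNgt => h; rewrite /mu_weight max_l ?mul0r//.
by rewrite subr_le0.
Qed.

Lemma mu_weight_far p q (rho : R) n (t : 'I_(n + n).+1) x i : onpath (t%:Z - n%:Z) i ->
  d (alz i x) q <= n.+1%:R^-1 -> @mu_weight p q rho n t x = 0.
Proof.
move=> hi h; have slt : (absz (i + n%:Z)%R < (n + n).+1)%N.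
  by move: hi; rewrite /onpath; have := ltn_ord t; lia.
have si : (Ordinal slt)%:Z - n%:Z = i by move: hi; rewrite /onpath /=; lia.
rewrite /mu_weight (bigD1 (Ordinal slt))/= ?si//.
by rewrite [Num.max 0 (d _ q - _)]max_l ?mul0r ?mulr0// subr_le0.
Qed.

Variables (nf : nat) (f : 'I_nf -> X -> R[i]^o) (M : nat) (del : R) (y0 : X).
Hypotheses (fc : forall a, contC (f a)) (M0 : (0 < M)%N) (del0 : 0 < del).

Lemma xi_exists : exists rho : R, [/\ 0 < rho,
  forall (j : int) x, j != 0 -> `|j| <= M%:Z ->
    bump 2%:R y0 rho x * bump 2%:R y0 rho (alz j x) = 0 &
  forall a j, (j < M)%N -> exists c : R[i]^o,
    forall x, bump 2%:R y0 rho x != 0 -> nrm (f a (alz (- j%:Z) x) - c) <= del].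
Proof.
have [r1 r10 h1] := disjoint_radius y0 M.
have [||r2 r20 h2] := @int_radius M (fun j r => forall a x, d x y0 < r ->
    nrm (f a (alz j x) - f a (alz j y0)) <= del).
- move=> j r r' r0 rr h a x xr; apply: h; exact: lt_le_trans rr.
- move=> j _; apply: ord_radius.
    move=> a r r' r0 rr h x xr; apply: h; exact: lt_le_trans rr.
  move=> a; have [r r0 h] := contC_near y0 (contC_alz alK beK alc bec j (fc a)) del0.
  by exists r => // x /h /ltW.
pose rho : R := Num.min r1 r2 / 2%:R.
have rho0 : 0 < rho by rewrite divr_gt0// lt_min r10.
have rho2 : 2%:R * rho = Num.min r1 r2 by rewrite /rho mulrC divfK.
have supp x : bump 2%:R y0 rho x != 0 -> d x y0 < r1 /\ d x y0 < r2.
  by move=> /(bump0 rho0); rewrite rho2 lt_min => /andP[].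
exists rho; split => //.
- move=> j x j0 jM; apply/eqP; rewrite mulf_eq0; apply/orP.
  have [_|nz] := eqVneq (bump 2%:R y0 rho x) 0; [by left|right].
  apply: contraT => nz'; have [x1 _] := supp _ nz; have [x2 _] := supp _ nz'.
  by have := h1 j jM j0 x x1; lra.
- move=> a j jM; exists (f a (alz (- j%:Z) y0)) => x /supp[_ x2].
  by apply: h2 => //; lia.
Qed.

(** The base [x0], its return at height [N] and the point [y] to be cut lie on one orbit, all close
    to [y0], with [y] strictly later than the return. By aperiodicity [y] is then none of the points
    of the tower over [x0], and [e] records the distance. *)
Lemma tower_exists (rho : R) : 0 < rho -> exists (x0 y : X) (N : nat) (rho1 e : R),
  [/\ 0 < rho1, 0 < e & (0 < N)%N] /\
  [/\ d y y0 < rho,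
    forall (j : int) x, j != 0 -> `|j| <= N%:Z ->
      bump 2%:R x0 rho1 x * bump 2%:R x0 rho1 (alz j x) = 0,
    forall x, bump 2%:R x0 rho1 x != 0 -> d x y0 < rho /\ d (alz N%:Z x) y0 < rho,
    forall a i, (i <= N)%N -> exists c : R[i]^o,
      forall x, bump 2%:R x0 rho1 x != 0 -> N%:R * nrm (f a (alz i%:Z x) - c) <= del &
    forall i x, (i <= N)%N -> bump 2%:R x0 rho1 x != 0 -> e <= d x (alz (- i%:Z) y)].
Proof.
move=> rho0; have [j0 _ x0y0] := return_after y0 rho0 0 y0.
set x0 := alz j0 y0 in x0y0.
have [N1 N10 xN] := return_after y0 rho0 1 x0.
have /nat_of_nneg[N NE] : 0 <= N1 by lia.
have N0 : (0 < N)%N by lia.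
have [N2 N20 yy0] := return_after y0 rho0 (N%:Z + 1) x0.
set y := alz N2 x0 in yy0.
have sep i : (i <= N)%N -> 0 < d x0 (alz (- i%:Z) y).
  move=> iN; apply: dist_gt0; rewrite -(alzD alK beK) => /(@alz_free 0); lia.
pose xd i := d x0 (alz (- i%:Z) y).
have del' : 0 < del / N%:R by rewrite divr_gt0// ltr0n.
have [e e0 he] : exists2 e, 0 < e & forall i : 'I_N.+1, e <= xd i / 2%:R.
  apply: ord_radius => [i r r' r0 rr|i]; first exact: le_trans.
  by exists (xd i / 2%:R) => //; rewrite divr_gt0// sep// -ltnS.
have [r1 r10 h1] := disjoint_radius x0 N.
have [||r2 r20 h2] := @int_radius N (fun j r => forall a x, d x x0 < r ->
    N%:R * nrm (f a (alz j x) - f a (alz j x0)) <= del).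
- move=> j r r' r0 rr h a x xr; apply: h; exact: lt_le_trans rr.
- move=> j _; apply: ord_radius.
    move=> a r r' r0 rr h x xr; apply: h; exact: lt_le_trans rr.
  move=> a; have [r r0 h] := contC_near x0 (contC_alz alK beK alc bec j (fc a)) del'.
  by exists r => // x /h; rewrite ltr_pdivlMr ?ltr0n// mulrC => /ltW.
have [|r3 r30 h3] := @contR_near (fun x => d x y0) x0 (rho - d x0 y0) (contR_dist y0).
  by lra.
have [|r4 r40 h4] := @contR_near (fun x => d (alz N%:Z x) y0) x0 (rho - d (alz N%:Z x0) y0)
    (contR_dist_alz N%:Z y0).
  by rewrite -NE; lra.
pose r := Num.min (Num.min r1 r2) (Num.min (Num.min r3 r4) e).
have r0 : 0 < r by rewrite !lt_min r10 r20 r30 r40.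
have rho1 : 0 < r / 2%:R by rewrite divr_gt0.
have supp x : bump 2%:R x0 (r / 2%:R) x != 0 ->
    [/\ d x x0 < r1, d x x0 < r2, d x x0 < r3, d x x0 < r4 & d x x0 < e].
  move=> /(bump0 rho1); have -> : 2%:R * (r / 2%:R) = r by rewrite mulrC divfK.
  by rewrite !lt_min => /andP[/andP[-> ->] /andP[/andP[-> ->] ->]].
exists x0, y, N, (r / 2%:R), e; split; [by split|split => //].
- move=> j x jn0 jN; apply/eqP; rewrite mulf_eq0; apply/orP.
  have [_|nz] := eqVneq (bump 2%:R x0 (r / 2%:R) x) 0; [by left|right].
  apply: contraT => nz'; have [x1 _ _ _ _] := supp _ nz.
  have [x2 _ _ _ _] := supp _ nz'.
  by have := h1 j jN jn0 x x1; lra.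
- move=> x /supp[_ _ /h3 x3 /h4 x4 _]; move: x3 x4; rewrite !ltr_norml.
  by move=> /andP[_ x3] /andP[_ x4]; split; lra.
- move=> a i iN; exists (f a (alz i%:Z x0)) => x /supp[_ x2 _ _ _].
  by apply: h2 => //; lia.
- move=> i x iN /supp[_ _ _ _ xe].
  have iN' : (i < N.+1)%N by [].
  have := he (Ordinal iN'); rewrite /xd /=.
  have := d_tri x0 x (alz (- i%:Z) y); rewrite (d_sym x0 x); lra.
Qed.

(** Only the size of the cut and the return bound [m] depend on [l]. The radius [r] makes the
    translates by up to [l] steps disjoint, keeps the cut off the tower and within the ball where
    [xi] is 1, and is at most the distance [1 / (n + 1)] that the paths keep from [y]. *)
Lemma orbit_data_exists : exists N n : nat, forall l, (n + n <= l)%N ->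
  exists (m : nat) (xi tau eta h zeta : X -> R) (mu : 'I_(n + n).+1 -> X -> R),
    orbit_data al be l f M N m del xi tau eta h zeta mu.
Proof.
have [rho [rho0 xi_orth xi_f]] := xi_exists.
have [x0 [y [N [rho1 [e [[rho10 e0 N0] [yy0 tau_orth tau_xi tau_f tau_y]]]]]]] :=
  tower_exists rho0.
have [n hn] := uniform_path x0 y rho10.
exists N, n => l nl.
have [r1 r10 h1] := disjoint_radius y l.
have [||r2 r20 h2] := @int_radius N (fun j r => forall z, d z y < r ->
    d (alz j z) (alz j y) < e).
- move=> j r r' r0 rr h z zr; apply: h; exact: lt_le_trans rr.
- by move=> j _; have [r r0 h] := alz_near j y e0; exists r.
pose i1 : R := n.+1%:R^-1; have i10 : 0 < i1 by rewrite invr_gt0.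
pose r := Num.min (Num.min r1 r2) (Num.min (rho - d y y0) i1).
have r0 : 0 < r by rewrite !lt_min r10 r20 subr_gt0 yy0.
(* In units of [s], bumps with parameters 2, 3 and 4 give [eta], [1 - h] and [zeta], nested inside
   the ball of radius [r]. *)
pose s : R := r / 4%:R; have s0 : 0 < s by rewrite divr_gt0.
have s4 : 4%:R * s = r by rewrite /s mulrC divfK.
have near_y x : d x y < r ->
    [/\ d x y < r1, d x y < r2, d x y < rho - d y y0 & d x y < i1].
  by rewrite !lt_min => /andP[/andP[-> ->] /andP[-> ->]].
have zsupp x : bump 4%:R y s x != 0 -> d x y < r by move=> /(bump0 s0); rewrite s4.
pose h x := 1 - bump 3%:R y s x.
have [n' hn'] := return_time y s0.
pose w := @mu_weight x0 y rho1 n.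
pose W x := \sum_t w t x.
have w0 t x : 0 <= w t x by exact: mu_weight_ge0.
have Wc : contR W by apply: contR_sum => t; exact: contR_mu_weight.
have W0 x : 0 < W x.
  have [j jn jr] := hn x; have [t wt] := mu_weight_gt0 jn jr.
  by rewrite /W (bigD1 t)//=; apply: ltr_wpDr => //; exact: sumr_ge0.
have Wn x : W x != 0 by rewrite gt_eqF.
pose mu t x := Num.sqrt (w t x / W x).
have mu0 t x : w t x = 0 -> mu t x = 0 by move=> wt; rewrite /mu wt mul0r sqrtr0.
have tau1 x : d x x0 < rho1 -> bump 2%:R x0 rho1 x = 1.
  by move=> hx; apply: bump1 => //; lra.
have xi1 x : d x y0 < rho -> bump 2%:R y0 rho x = 1.
  by move=> hx; apply: bump1 => //; lra.
have eta_near x : bump 2%:R y s x != 0 -> d x y < 2%:R * s by move=> /(bump0 s0).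
exists (n' + n').+1, (bump 2%:R y0 rho), (bump 2%:R x0 rho1), (bump 2%:R y s), h,
  (bump 4%:R y s), mu.
split => //.
- exact: contR_bump.
- by move=> x; exact: clip01.
- exact: contR_bump.
- by move=> x; exact: clip01.
- move=> x; have [->|/tau_xi[hx _]] := eqVneq (bump 2%:R x0 rho1 x) 0; first by rewrite mulr0.
  by rewrite xi1// mul1r.
- move=> x; have [->|/tau_xi[_ hx]] := eqVneq (bump 2%:R x0 rho1 x) 0; first by rewrite mulr0.
  by rewrite xi1// mul1r.
- exact: contR_bump.
- by move=> x; exact: clip01.
(* The return time may be as low as [- n']. Starting [n'] steps ahead makes it a forward return
   within [n' + n'] steps, hence [m = (n' + n').+1]. *)
- move=> x; have [j jn jy] := hn' (alz n'%:Z x).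
  have [i ilt ij] := nat_window jn.
  exists i => //; rewrite -[iter _ al x]/(alz i%:Z x) ij (alzD alK beK).
  by apply: bump1 => //; lra.
- apply: contR_add; first exact: contR_cst.
  by apply: contR_opp; exact: contR_bump.
- by move=> x; have := clip01 (3%:R - d x y / s); rewrite /h /bump; lra.
- move=> x /eta_near hx; rewrite /h bump1 ?subrr//; lra.
- exact: contR_bump.
- by move=> x; exact: clip01.
- move=> x hx; apply: bump1 => //.
  have : bump 3%:R y s x != 0.
    by apply: contra_neq hx => b0; rewrite /h b0 subr0.
  by move=> /(bump0 s0); lra.
- move=> j x j0 jl; apply/eqP; rewrite mulf_eq0; apply/orP.
  have [_|nz] := eqVneq (bump 4%:R y s x) 0; [by left|right].
  apply: contraT => /zsupp/near_y[x2 _ _ _]; have /zsupp/near_y[x1 _ _ _] := nz.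
  by have := h1 j jl j0 x x1; lra.
- move=> x; have [->|/zsupp/near_y[_ _ hx _]] := eqVneq (bump 4%:R y s x) 0.
    by rewrite mulr0.
  by rewrite xi1 ?mul1r//; have := d_tri x y y0; lra.
- move=> i x iN; apply/eqP; rewrite mulf_eq0; apply/orP.
  have [_|/zsupp/near_y[_ hx _ _]] := eqVneq (bump 4%:R y s (alz i%:Z x)) 0.
    by left.
  right; apply: contraT => /(tau_y i x iN).
  have hi : `|- i%:Z| <= N%:Z by rewrite normrN ger0_norm// lez_nat.
  by have := h2 _ hi _ hx; rewrite (zitK alK beK); lra.
- move=> t; apply/contR_sqrt/contR_mul; first exact: contR_mu_weight.
  exact: contR_inv.
- move=> x; have -> : \sum_t mu t x * mu t x = \sum_t w t x / W x.
    by apply: eq_bigr => t _; rewrite -expr2 sqr_sqrtr// divr_ge0// ltW.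
  by rewrite -mulr_suml -/(W x) mulfV.
- move=> t x; have [/mu0 ->|/mu_weight_near hx] := eqVneq (w t x) 0; first by rewrite mulr0.
  by rewrite tau1 ?mul1r.
- move=> t x i hi /eta_near hx; apply: mu0; apply: (@mu_weight_far x0 y rho1 n t x i hi).
  have [_ _ _ h4] : [/\ d (alz i x) y < r1, d (alz i x) y < r2,
    d (alz i x) y < rho - d y y0 & d (alz i x) y < i1] by apply: near_y; lra.
  exact: ltW.
Qed.

End Dynamics.

(** * Approximation of finitely many functions and of the unitary *)

Section LocalAlgebra.
Variables (R : realType) (X : topologicalType).
Hypotheses (X_compact : compact [set: X]) (X_metrizable : metrizable R X).
Variables (al : X -> X).
Hypotheses (al_homeo : homeomorphism al) (al_minimal : minimal al).
Variables (T : cstarType R) (phi : (X -> R[i]^o) -> T) (u : T).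
Hypothesis cov : covariant_pair al phi u.

Lemma zero_subhomogeneous : (1 : T) = 0 -> subhomogeneous [set: T].
Proof.
move=> T0; exists 0%N => H pi irr; exfalso.
case: (irr) => _ [a _ [x ax]] _; case/eqP: ax.
have -> : a = 0 by rewrite -[a]mulr1 T0 mulr0.
by apply: (rep0 _ irr); split => //; split.
Qed.

(** The threshold [n0] depends only on the functions and the tolerance, so the matrix units can be
    requested from the UHF algebra afterwards. *)
Lemma local_algebra nf (f : 'I_nf -> X -> R[i]^o) (eps : R) :
  (forall a, contC (f a)) -> 0 < eps -> exists n0 : nat, forall l, (n0 <= l)%N ->
  forall k (hb : 'I_k -> T), star_algebra (span_set hb) -> span_set hb 1 ->
  (forall x f, span_set hb x -> contC f -> x * phi f = phi f * x) ->
  (forall x, span_set hb x -> x * u = u * x) ->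
  forall d (g : 'I_d -> T), star_algebra (span_set g) -> span_set g 1 ->
  span_set g `<=` span_set hb ->
  forall E : 'I_l.+1 -> 'I_l.+1 -> T, (forall a b, span_set hb (E a b)) ->
  (forall a b a' b', E a b * E a' b' = if b == a' then E a b' else 0) ->
  (forall a b, cstar (E a b) = E b a) -> \sum_a E a a = 1 ->
  (forall x a b, span_set g x -> x * E a b = E a b * x) ->
  exists S : set T, [/\ cstar_subalgebra S, subhomogeneous S, span_set g `<=` S,
    exists2 s, S s & nrm (u - s) < eps &
    forall r, exists2 s, S s & nrm (phi (f r) - s) < eps].
Proof.
move=> fc eps0; have [alc [be [bec alK beK]]] := al_homeo.
have [d [d1 d2 d3 d4]] := X_metrizable.
have [[x0]|noX] := pselect (inhabited X); last first.
  exists 0%N => l _ k hb _ _ _ _ n g _ _ _ E _ _ _ _ _.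
  (* On the empty space the constant functions 0 and 1 coincide. *)
  have T0 : (1 : T) = 0.
    rewrite -(phi1 cov) -(phi0 cov); congr phi; apply/funext => x.
    by case: noX; exists.
  have allS (x : T) : x = 0 by rewrite -[x]mulr1 T0 mulr0.
  exists [set: T]; split => //.
  - exact: zero_subhomogeneous.
  - by exists u => //; rewrite subrr nrm0.
  - by move=> r; exists (phi (f r)) => //; rewrite subrr nrm0.
have [[x [n [n0 nx]]]|noper] := pselect (exists x n, (0 < n)%N /\ iter n al x = x).
  exists 0%N => l _ k hb hstar h1 hphi hu m g gstar g1 gh E _ _ _ _ _.
  have [N [delta [[N0 dc dx dy] [surj inj per]]]] :=
    periodic_points d1 d2 d3 d4 alK beK al_minimal n0 nx.
  have [S [SA Ssub gS Su Sphi]] := periodic_algebra alK beK alc bec cov gstar g1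
    (fun x f hx => hphi x f (gh _ hx)) (fun x hx => hu x (gh _ hx)) N0 dc dx dy surj inj per.
  exists S; split => //; first by exists u => //; rewrite subrr nrm0.
  by move=> r; exists (phi (f r)); [exact: Sphi|rewrite subrr nrm0].
have aper y n : (0 < n)%N -> iter n al y <> y.
  by move=> n0 ny; apply: noper; exists y, n.
have [M M0 hM] : exists2 M : nat, (0 < M)%N & 12%:R * Num.sqrt M%:R^-1 < eps :> R.
  pose t : R := (eps / 12%:R) ^+ 2; have t0 : 0 < t by rewrite exprn_gt0// divr_gt0.
  have [M hM] := inv_succ_lt t0; exists M.+1 => //.
  have e12 : 0 < eps / 12%:R by rewrite divr_gt0.
  have : Num.sqrt M.+1%:R^-1 < eps / 12%:R.
    rewrite -[ltRHS]gtr0_norm// -sqrtr_sqr ltr_sqrt//.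
  by rewrite ltr_pdivlMr// mulrC.
(* The factor of [del] in [main_algebra]; halving in [del] makes the estimate strict. *)
pose K : R := 3%:R + 4%:R * M%:R.
have K0 : 0 < K by apply: ltr_wpDr => //; exact: mulr_ge0.
pose del : R := eps / (2%:R * K); have del0 : 0 < del by rewrite divr_gt0// mulr_gt0.
have Kdel : K * del < eps.
  have -> : K * del = eps / 2%:R.
    by rewrite /del invfM mulrCA mulrA; field; rewrite gt_eqF.
  by rewrite ltr_pdivrMr//; lra.
have [N [n hn]] := orbit_data_exists d1 d2 d3 d4 X_compact alK beK alc bec al_minimal
  aper x0 fc M0 del0.
exists (n + n)%N => l nl k hb hstar h1 hphi hu m g gstar g1 gh E EG EM Es E1 gE.
have [m' [xi [tau [eta [h [zeta [mu od]]]]]]] := hn l nl.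
have [S [SA Ssub gS [s Ss us] Sf]] := main_algebra alK beK alc bec cov X_compact hstar h1 hphi hu
  gstar g1 gh EG EM Es E1 gE od.
exists S; split => //; first by exists s => //; exact: le_lt_trans hM.
by move=> r; have [s' Ss' fs] := Sf r; exists s' => //; apply: le_lt_trans Kdel.
Qed.

End LocalAlgebra.

(** * Matrix units in UHF algebras *)

Section ProjectionFactor.
Variable C : numClosedFieldType.

Definition madj m n (M : 'M[C]_(m, n)) : 'M[C]_(n, m) := map_mx Num.conj M^T.

Lemma madjK m n (M : 'M[C]_(m, n)) : madj (madj M) = M.
Proof. by apply/matrixP => i j; rewrite !mxE conjCK. Qed.

Lemma madjM m n p (M : 'M[C]_(m, n)) (N : 'M[C]_(n, p)) :
  madj (M *m N) = madj N *m madj M.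
Proof. by rewrite /madj trmx_mul map_mxM. Qed.

Lemma madj_delta m n i j : madj (delta_mx i j : 'M[C]_(m, n)) = delta_mx j i.
Proof. by rewrite /madj trmx_delta map_delta_mx. Qed.

(* An orthonormal basis [B] of the row space of a projection [p] factors it as
   [B^* B], since both sides are projections with the same row space. *)
Lemma projection_factor n (p : 'M[C]_n) : p *m p = p -> madj p = p ->
  exists t (V : 'M[C]_(n, t)), V *m madj V = p /\ madj V *m V = 1%:M.
Proof.
move=> pp sp; pose B := schmidt (row_base p).
have Bu : B *m madj B = 1%:M.
  by apply/unitarymxP/schmidt_unitarymx; exact: rank_leq_col.
have Bp : (B :=: p)%MS.
  exact: eqmx_trans (eqmx_schmidt_free (row_base_free p)) (eq_row_base p).
exists (\rank p), (madj B); rewrite madjK; split => //.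
have /submxP[X pX] : (p <= B)%MS by rewrite Bp.
have /submxP[Y BY] : (B <= p)%MS by rewrite Bp.
have pq : p *m (madj B *m B) = p.
  by rewrite {1}pX -!mulmxA (mulmxA B) Bu mul1mx -pX.
have qp : (madj B *m B) *m p = madj B *m B.
  have Bpp : B *m p = B by rewrite {1}BY -mulmxA pp -BY.
  by rewrite -mulmxA Bpp.
have h := congr1 (@madj n n) pq; rewrite madjM madjM madjK sp in h.
by rewrite -[LHS]qp.
Qed.

End ProjectionFactor.

Section UHF.
Variables (R : realType) (U : cstarType R).
Variables (k : nat -> nat) (phi : forall m, 'M[R[i]]_(k m) -> U).
Arguments phi : clear implicits.
Hypotheses (k0 : forall m, (0 < k m)%N)
  (phiP : forall m, [/\ linear (phi m), monoid_morphism (phi m), injective (phi m) &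
     forall M, phi m (map_mx Num.conj M^T) = cstar (phi m M)])
  (phi_range : forall m, range (phi m) `<=` range (phi m.+1))
  (phi_dense : closure (\bigcup_m range (phi m)) = [set: U])
  (U_inf : infinite_dimensional U).

Lemma uhf_lin m a x y : phi m (a *: x + y) = a *: phi m x + phi m y.
Proof. by case: (phiP m) => h _ _ _; exact: h. Qed.

Lemma uhfM m x y : phi m (x *m y) = phi m x * phi m y.
Proof. by case: (phiP m) => _ [_ h] _ _; exact: h. Qed.

Lemma uhf1 m : phi m 1%:M = 1.
Proof. by case: (phiP m) => _ [h _] _ _; exact: h. Qed.

Lemma uhf_inj m : injective (phi m). Proof. by case: (phiP m). Qed.

Lemma uhf_star m x : phi m (madj x) = cstar (phi m x).
Proof. by case: (phiP m) => _ _ _ h; exact: h. Qed.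

Lemma uhfD m x y : phi m (x + y) = phi m x + phi m y.
Proof. by rewrite -[x]scale1r uhf_lin !scale1r. Qed.

Lemma uhf0 m : phi m 0 = 0.
Proof. by have := uhfD (0 : 'M[R[i]]_(k m)) 0; rewrite addr0 -{1}[phi m 0]addr0 => /addrI. Qed.

Lemma uhfZ m a x : phi m (a *: x) = a *: phi m x.
Proof. by rewrite -[_ *: x]addr0 uhf_lin uhf0 addr0. Qed.

Lemma uhf_sum m (I : Type) (r : seq I) (P : pred I) F :
  phi m (\sum_(i <- r | P i) F i) = \sum_(i <- r | P i) phi m (F i).
Proof. by apply: (big_morph (phi m)) => [x y|]; [exact: uhfD|exact: uhf0]. Qed.

Lemma uhf_range_le m n : (m <= n)%N -> range (phi m) `<=` range (phi n).
Proof.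
move=> mn; have -> : n = (n - m + m)%N by lia.
by elim: (n - m)%N => [//|j ih]; apply: subset_trans ih _; exact: phi_range.
Qed.

(** If all sizes from [m0] on were below [n], any [n ^ 2 + 1] elements of the union would lie in a
    common matrix algebra and be dependent. The union would then span a finite-dimensional, hence
    closed, subspace, which by density is [U]. *)
Lemma uhf_unbounded m0 n : exists2 m, (m0 <= m)%N & (n <= k m)%N.
Proof.
apply: contrapT => /forall2NP kn; pose D := (n * n)%N.
pose W := \bigcup_m range (phi m).
have common (v : 'I_D.+1 -> U) : (forall i, W (v i)) ->
    exists2 m, (m0 <= m)%N & forall i, range (phi m) (v i).
  move=> Wv; have /choice[ms hms] i : exists m, range (phi m) (v i).
    by have [m _ h] := Wv i; exists m.
  exists (maxn m0 (\max_i ms i)); first exact: leq_maxl.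
  move=> i; apply: uhf_range_le (hms i).
  exact: leq_trans (leq_bigmax i) (leq_maxr _ _).
have dep (v : 'I_D.+1 -> U) : (forall i, W (v i)) ->
    exists c : 'I_D.+1 -> R[i], (exists i, c i != 0) /\ \sum_i c i *: v i = 0.
  move=> /common[m m0m hm]; have kmn : (k m <= n)%N.
    by have [//|/negP] := kn m; rewrite -ltnNge => /ltnW.
  have /choice[x hx] i : exists x, phi m x = v i by have [x _ <-] := hm i; exists x.
  have Jle : (#|{: 'I_(k m) * 'I_(k m)}| < D.+1)%N.
    rewrite ltnS card_prod card_ord; exact: leq_mul.
  have [c [[i ci] hc]] := @kernel_vector _ {: 'I_(k m) * 'I_(k m)}
    (fun i t => x (widen_ord Jle i) t.1 t.2).
  pose c' (j : 'I_D.+1) := if insub (val j) is Some i then c i else 0.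
  have c'c i' : c' (widen_ord Jle i') = c i' by rewrite /c' /= valK.
  exists c'; split; first by exists (widen_ord Jle i); rewrite c'c.
  have -> : \sum_j c' j *: v j = phi m (\sum_j c' j *: x j).
    by rewrite uhf_sum; apply: eq_bigr => j _; rewrite uhfZ hx.
  suff -> : \sum_j c' j *: x j = 0 by rewrite uhf0.
  apply/matrixP => a b; rewrite summxE mxE.
  rewrite (bigID (fun j : 'I_D.+1 => (j < #|{: 'I_(k m) * 'I_(k m)}|.+1)%N))/=.
  rewrite [X in _ + X]big1 ?addr0 => [|j /negPf jn]; last first.
    by rewrite mxE /c' insubF ?mul0r.
  rewrite -[RHS](hc (a, b)) (big_ord_narrow Jle).
  by apply: eq_bigr => j _; rewrite mxE c'c.
have [m [v [mD Wv sp]]] := max_indep dep.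
apply: (U_inf (n := m)); exists v => x.
suff : [set: U] `<=` span_set v by apply.
rewrite -phi_dense; apply: subset_trans (closureS sp) _.
by have [/closure_id <- _ _] := span_closed v.
Qed.

(** The first column of matrix units of level [m] becomes [t i] at level [m']. Matrix units [v a b]
    of the corner of the projection [t o] are spread over all diagonal corners by [t i], and the
    sums commute with level [m]. *)
Lemma uhf_commutant_units m n : exists l m' (E : 'I_l.+1 -> 'I_l.+1 -> U),
  [/\ (n <= l)%N, (m <= m')%N & forall a b, range (phi m') (E a b)] /\
  [/\ forall a b a' b', E a b * E a' b' = if b == a' then E a b' else 0,
    forall a b, cstar (E a b) = E b a, \sum_a E a a = 1 &
    forall x a b, range (phi m) x -> x * E a b = E a b * x].
Proof.
(* The commutant of level [m] in level [m'] has size [k m' / k m], which must be at least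
   [n + 1]. *)
have [m' mm' Kn] := uhf_unbounded m (k m * n.+1).
pose o := Ordinal (k0 m).
have /choice[t ht] (i : 'I_(k m)) : exists x, phi m' x = phi m (delta_mx i o).
  have [|x _ <-] := uhf_range_le mm' (t := phi m (delta_mx i o)); last by exists x.
  by exists (delta_mx i o).
have tt i j : madj (t i) *m t j = if i == j then t o else 0.
  apply: (@uhf_inj m'); rewrite uhfM uhf_star !ht -uhf_star madj_delta -uhfM.
  rewrite mul_delta_mx_cond; case: eqP => _; last by rewrite !uhf0.
  by rewrite mulr1n ht.
have st : madj (t o) = t o.
  by apply: (@uhf_inj m'); rewrite uhf_star ht -uhf_star madj_delta.
have to i : t i *m t o = t i.
  by apply: (@uhf_inj m'); rewrite uhfM !ht -uhfM mul_delta_mx.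
have tsum : \sum_i t i *m madj (t i) = 1%:M.
  apply: (@uhf_inj m'); rewrite uhf_sum uhf1 -(uhf1 m).
  rewrite mx1_sum_delta [RHS]uhf_sum.
  apply: eq_bigr => i _.
  by rewrite uhfM uhf_star !ht -uhf_star madj_delta -uhfM mul_delta_mx.
have [|s [V [VV V1]]] := projection_factor _ st; first by exact: to.
pose v (a b : 'I_s) : 'M[R[i]]_(k m') := V *m delta_mx a b *m madj V.
pose E a b := \sum_i t i *m v a b *m madj (t i).
have VVV : V *m madj V *m V = V by rewrite -mulmxA V1 mulmx1.
have pv a b : t o *m v a b = v a b.
  by rewrite /v -VV !mulmxA VVV.
have vs a b : madj (v a b) = v b a.
  by rewrite /v !madjM madjK madj_delta mulmxA.
have vv a b a' b' : v a b *m v a' b' = if b == a' then v a b' else 0.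
  rewrite /v !mulmxA -(mulmxA _ (madj V)) V1 mulmx1 -[V *m _ *m delta_mx a' b']mulmxA.
  rewrite mul_delta_mx_cond; case: eqP => _; rewrite ?mulr1n// mulr0n.
  by rewrite mulmx0 mul0mx.
have vsum : \sum_a v a a = t o.
  by rewrite /v -mulmx_suml -mulmx_sumr -mx1_sum_delta mulmx1.
(* By traces: the identity of level [m'] is a sum of [k m] projections, each of trace [s]. *)
have sE : (k m * s = k m')%N.
  apply/eqP; rewrite -(eqr_nat R[i]) -[X in _ == X]mxtrace1 -tsum raddf_sum /=.
  under eq_bigr => i _ do rewrite mxtrace_mulC tt eqxx -VV mxtrace_mulC V1 mxtrace1.
  by rewrite sumr_const card_ord -mulrnA mulnC.
case: s V VV V1 @v @E VVV pv vs vv vsum sE => [|l] V VV V1 v E VVV pv vs vv vsum sE.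
  by move: Kn (k0 m'); rewrite -sE muln0 leqn0 muln_eq0 /= orbF; lia.
clearbody v; clear V VV V1 VVV.
have EE a b a' b' : E a b *m E a' b' = if b == a' then E a b' else 0.
  rewrite /E mulmx_suml (eq_bigr (fun i => if b == a' then t i *m v a b' *m madj (t i) else 0)).
    by case: eqP => // _; rewrite big1.
  move=> i _; rewrite mulmx_sumr (big_only1 i)// => [|j ji _].
    rewrite !mulmxA -(mulmxA _ (madj (t i))) tt eqxx -(mulmxA _ (t o)) pv.
    rewrite -(mulmxA (t i)) vv; case: eqP => _ //.
    by rewrite mulmx0 mul0mx.
  by rewrite !mulmxA -(mulmxA _ (madj (t i))) tt eq_sym (negPf ji) mulmx0 !mul0mx.
exists l, m', (fun a b => phi m' (E a b)); split; split => //.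
- by rewrite -ltnS -(leq_pmul2l (k0 m)) sE.
- by move=> a b a' b'; rewrite -uhfM EE; case: eqP => _ //; exact: uhf0.
- move=> a b; rewrite -uhf_star; congr (phi m' _).
  rewrite /E /madj linear_sum /= map_mx_sum; apply: eq_bigr => i _.
  by rewrite -/(madj _) !madjM madjK vs mulmxA.
- rewrite -uhf_sum -(uhf1 m') -tsum; congr (phi m' _); rewrite exchange_big.
  apply: eq_bigr => i _; rewrite -mulmx_suml -mulmx_sumr; congr (_ *m _).
  by rewrite vsum; exact: to.
- move=> _ a b [x _ <-].
  have xE : phi m x = phi m' (\sum_i \sum_j x i j *: (t i *m madj (t j))).
    rewrite {1}[x]matrix_sum_delta !uhf_sum; apply: eq_bigr => i _.
    rewrite !uhf_sum; apply: eq_bigr => j _.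
    by rewrite !uhfZ uhfM uhf_star !ht -uhf_star madj_delta -uhfM mul_delta_mx.
  rewrite xE -!uhfM; congr (phi m' _).
  rewrite mulmx_suml mulmx_sumr; apply: eq_bigr => i _.
  rewrite mulmx_suml mulmx_sumr; apply: eq_bigr => j _.
  rewrite -scalemxAl -scalemxAr; congr (_ *: _).
  rewrite /E mulmx_sumr mulmx_suml (big_only1 j)// => [|i' ji _]; last first.
    by rewrite !mulmxA -(mulmxA _ (madj (t j))) tt eq_sym (negPf ji) mulmx0 !mul0mx.
  rewrite (big_only1 i)// => [|i' ji _]; last first.
    by rewrite !mulmxA -(mulmxA _ (madj (t i'))) tt (negPf ji) mulmx0 !mul0mx.
  rewrite !mulmxA -!(mulmxA _ (madj (t _)) (t _)) !tt !eqxx -(mulmxA (t i)) pv.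
  have vo : v a b *m t o = v a b by rewrite -[LHS]madjK madjM st vs pv vs.
  by rewrite -[t i *m v a b *m t o]mulmxA vo.
Qed.

End UHF.

Lemma linear_fun0 (K : pzRingType) (V W : lmodType K) (f : V -> W) : linear f -> f 0 = 0.
Proof. by move=> lf; have := lf 1 0 0; rewrite !scale1r addr0 -{1}[f 0]addr0 => /addrI. Qed.

(** * The tensor product *)

Section Tensor.
Variables (R : realType) (A B T : cstarType R) (t : A -> B -> T).
Hypothesis T_tensor : is_tensor_product t.

Lemma rdot_sym (H : hilbertType R) (x y : H) : rdot y x = rdot x y.
Proof.
rewrite /rdot hermC /= expr0 mul1r; by case: (dotp x y).
Qed.

Lemma rdot0l (H : hilbertType R) (z : H) : rdot 0 z = 0.
Proof. by rewrite rdot_sym rdot0r. Qed.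

Lemma rdotZr (H : hilbertType R) (k : R) (x z : H) : rdot z (k%:C *: x) = k * rdot z x.
Proof. by rewrite rdot_sym rdotZl rdot_sym. Qed.

Lemma rdot_CS (H : hilbertType R) (x y : H) : rdot x y <= nrm x * nrm y.
Proof.
have sym : rdot y x = rdot x y by exact: rdot_sym.
have key (s r : R) : 2%:R * (s * r) * rdot x y <= s ^+ 2 * nrm x ^+ 2 + r ^+ 2 * nrm y ^+ 2.
  have := sqr_ge0 (nrm (s%:C *: x - r%:C *: y)).
  rewrite -(rdot_nrm (s%:C *: x - r%:C *: y))
    rdotDl rdotNl !rdotDr !rdotNr !rdotZl !rdotZr sym !rdot_nrm.
  by rewrite !expr2; lra.
have [x0|x0] := eqVneq (nrm x) 0.
  by rewrite (nrm_eq0 x0) rdot0l nrm0 mul0r.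
have [y0|y0] := eqVneq (nrm y) 0.
  by rewrite (nrm_eq0 y0) rdot0r nrm0 mulr0.
have xp : 0 < nrm x by rewrite lt_def x0 nrm_ge0.
have yp : 0 < nrm y by rewrite lt_def y0 nrm_ge0.
have := key (nrm y) (nrm x).
have xy0 : 0 < nrm x * nrm y by exact: mulr_gt0.
rewrite !expr2; nra.
Qed.

Lemma total_orth (H : hilbertType R) (S : set H) v : total_set S ->
  (forall s, S s -> dotp s v = 0) -> v = 0.
Proof.
(* Quantifying over [c] makes this a complex subspace although [rdot] keeps only the real part. *)
move=> tS Sv; pose W := [set z : H | forall c : R[i], rdot (c *: z) v = 0].
have Wc : closed_subspace W.
  split.
  - apply/closedE => x hx c /=; apply/eqP; rewrite eq_le.
    have bound (c' : R[i]) : rdot (c' *: x) v <= 0.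
      apply/ler_addgt0Pr => e e0; rewrite add0r.
      pose k := complex.Re `|c'| * nrm v + 1.
      have k0 : 0 < k by have := Re_norm_ge0 c'; have := nrm_ge0 v; rewrite /k; nra.
      have [|y Wy xy] := hx (e / k); first exact: divr_gt0.
      have -> : rdot (c' *: x) v = rdot (c' *: (x - y)) v.
        by rewrite scalerBr rdotDl rdotNl Wy subr0.
      apply: le_trans (rdot_CS _ _) _; rewrite nrmZ.
      move: xy; rewrite ltr_pdivlMr//.
      have := Re_norm_ge0 c'; have := nrm_ge0 v; have := nrm_ge0 (x - y).
      rewrite /k; nra.
    rewrite bound /=; have := bound (- c).
    by rewrite scaleNr rdotNl oppr_le0.
  - by move=> c /=; rewrite scaler0 rdot0l.
  - move=> a x y Wx Wy c /=.
    by rewrite scalerDr scalerA rdotDl Wx Wy addr0.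
have : W v.
  rewrite (tS W Wc)// => s Ss c /=; rewrite /rdot linearZl_LR /= (Sv s Ss) mulr0.
  by [].
move=> /(_ 1); rewrite scale1r rdot_nrm => /eqP; rewrite sqrf_eq0 => /eqP.
exact: nrm_eq0.
Qed.

Section Operations.
Variables (H K L : hilbertType R) (ten : H -> K -> L).
Variables (pi : A -> H -> H) (rho : B -> K -> K) (sigma : T -> L -> L).
Hypotheses (tenL : forall y, linear (ten^~ y)) (tenR : forall x, linear (ten x))
  (ten_dot : forall x x' y y', dotp (ten x y) (ten x' y') = dotp x x' * dotp y y')
  (ten_total : total_set [set z | exists x y, z = ten x y])
  (piF : faithful_representation pi) (rhoF : faithful_representation rho)
  (sigmaF : faithful_representation sigma)
  (sigma_t : forall a b x y, sigma (t a b) (ten x y) = ten (pi a x) (rho b y))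
  (t_total : total_set [set z | exists a b, z = t a b]).

(** The vectors on which two operators agree form a closed subspace, and [sigma] is injective. Every
    algebraic identity for [t] is thereby checked on elementary tensors. *)
Lemma sigma_ext s s' : (forall x y, sigma s (ten x y) = sigma s' (ten x y)) -> s = s'.
Proof.
case: sigmaF => [[sc slin _ _] inj] h; apply: inj; apply/funext => z.
have [ls cs] := sc s I; have [ls' cs'] := sc s' I.
suff : [set z | sigma s z = sigma s' z] z by [].
rewrite (ten_total (W := [set z | sigma s z = sigma s' z]))//; last first.
  by move=> _ [x [y ->]]; exact: h.
split.
- apply/closedE => x hx /=; apply/eqP; rewrite -subr_eq0; apply/eqP/nrm_eq0/eqP.
  rewrite eq_le nrm_ge0 andbT.
  apply/ler_addgt0Pr => e e0; rewrite add0r.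
  have e2 : 0 < e / 2%:R by rewrite divr_gt0.
  have [r r0 hr] := continuous_nrm cs x e2.
  have [r' r0' hr'] := continuous_nrm cs' x e2.
  have [|y Wy xy] := hx (Num.min r r'); first by rewrite lt_min r0.
  move: xy; rewrite lt_min => /andP[/hr /= h1 /hr' /= h2].
  apply: le_trans (nrm_tri _ (sigma s y) _) _.
  by rewrite {2}Wy (nrmBC (sigma s' y)); lra.
- by rewrite /= !linear_fun0.
- by move=> a x y /= hx hy; rewrite ls ls' hx hy.
Qed.

Lemma tensor_linL b : linear (t^~ b).
Proof.
case: sigmaF => [[sc slin _ _] _]; case: piF => [[_ plin _ _] _].
move=> c a a'; apply: sigma_ext => x y.
by rewrite sigma_t slin// !sigma_t plin// tenL.
Qed.

Lemma tensor_linR a : linear (t a).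
Proof.
case: sigmaF => [[sc slin _ _] _]; case: rhoF => [[_ plin _ _] _].
move=> c b b'; apply: sigma_ext => x y.
by rewrite sigma_t slin// !sigma_t plin// tenR.
Qed.

Lemma tensorM a a' b b' : t a b * t a' b' = t (a * a') (b * b').
Proof.
case: sigmaF => [[_ _ sM _] _]; case: piF => [[_ _ pM _] _].
case: rhoF => [[_ _ rM _] _].
by apply: sigma_ext => x y; rewrite sM// !sigma_t pM// rM.
Qed.

Lemma tensor_star a b : cstar (t a b) = t (cstar a) (cstar b).
Proof.
case: sigmaF => [[_ _ _ sS] _]; case: piF => [[_ _ _ pS] _].
case: rhoF => [[_ _ _ rS] _].
apply: sigma_ext => x y; apply/eqP; rewrite -subr_eq0; apply/eqP.
apply: (total_orth ten_total) => _ [x' [y' ->]].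
rewrite linearBr /= -sS// !sigma_t !ten_dot pS// rS//.
by rewrite subrr.
Qed.

(** The representations may be degenerate, so [pi 1] need not be the identity. The unit is
    recognized algebraically: [t 1 1] is a left unit on a total set, hence on 1. *)
Lemma tensor1 : t 1 1 = 1.
Proof.
rewrite -[LHS]mulr1.
suff : [set s | t 1 1 * s = s] 1 by [].
rewrite (t_total (W := [set s | t 1 1 * s = s]))//; last first.
  by move=> _ [a [b ->]] /=; rewrite tensorM !mul1r.
split.
- apply/closedE => x hx /=; apply/eqP; rewrite -subr_eq0; apply/eqP/nrm_eq0/eqP.
  rewrite eq_le nrm_ge0 andbT; apply/ler_addgt0Pr => r r0; rewrite add0r.
  pose k := nrm (t 1 1) + 1; have k0 : 0 < k by have := nrm_ge0 (t 1 1); rewrite /k; lra.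
  have [|y Wy xy] := hx (r / k); first exact: divr_gt0.
  have -> : t 1 1 * x - x = t 1 1 * (x - y) - (x - y).
    by rewrite mulrBr Wy; ncring.
  apply: le_trans (nrmB _ _) _; have := nrmM (t 1 1) (x - y).
  by move: xy; rewrite ltr_pdivlMr// /k; lra.
- by rewrite /= mulr0.
- by move=> a x y /= hx hy; rewrite mulrDr scAr hx hy.
Qed.

End Operations.

(** The form in which the tensor product enters the proof: two commuting homomorphisms whose
    products are total. *)
Lemma tensor_homs : exists (Phi : A -> T) (Psi : B -> T),
  [/\ unital_star_hom Phi, unital_star_hom Psi, forall a b, Phi a * Psi b = Psi b * Phi a &
    total_set [set z | exists a b, z = Phi a * Psi b]].
Proof.
have [H [K [L [ten [pi [rho [sigma [[tL tR td tt] [pF rF sF] st ttot]]]]]]]] := T_tensor.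
have tM := tensorM tt pF rF sF st.
have t1 := tensor1 tt pF rF sF st ttot.
have tS := tensor_star td tt pF rF sF st.
exists (t^~ 1), (t 1); split.
- split; first exact: (tensor_linL tL tt pF sF st).
    by split => // a a'; rewrite tM mulr1.
  by move=> a; rewrite tS star1.
- split; first exact: (tensor_linR tR tt rF sF st).
    by split => // b b'; rewrite tM mulr1.
  by move=> b; rewrite tS star1.
- by move=> a b; rewrite !tM !mulr1 !mul1r.
- move=> W Wc hW; apply: ttot => // _ [a [b ->]]; apply: hW; exists a, b.
  by rewrite tM mulr1 mul1r.
Qed.

End Tensor.

(** * Reduction of the approximation problem to generators *)

Section Approximation.
Variables (R : realType) (T : cstarType R).
Variables (I : Type) (sat : I -> set T -> Prop) (i0 : I) (join : I -> I -> I).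
Hypothesis sat_join : forall i j S, sat (join i j) S -> sat i S /\ sat j S.

Definition close (S : set T) (e : R) (a : T) := exists2 s, S s & nrm (a - s) < e.

(* [a] is approximated by every C*-subalgebra satisfying a suitable condition. *)
Definition approximable (a : T) := forall e : R, 0 < e ->
  exists i, forall S, cstar_subalgebra S -> sat i S -> close S e a.

Lemma approximable_closed : closed approximable.
Proof.
apply/closedE => a h e e0; have e2 : 0 < e / 2%:R by rewrite divr_gt0.
have [b hb ab] := h _ e2; have [i hi] := hb _ e2.
exists i => S SA Si; have [s Ss bs] := hi S SA Si; exists s => //.
by have := nrm_tri a b s; lra.
Qed.

(** Consequently it suffices to approximate generators. Two requirements are combined by [join],
    which works because a condition constrains the subalgebra and not the element. *)
Lemma approximable_cstar : cstar_subalgebra approximable.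
Proof.
split; first split.
- exact: approximable_closed.
- move=> e e0; exists i0 => S [[_ S0 _] _ _] _; exists 0 => //.
  by rewrite subrr nrm0.
- move=> c a b ha hb e e0.
  have c0 := Re_norm_ge0 c; have c1 : 0 < complex.Re `|c| + 1 by lra.
  have e2 : 0 < e / 2%:R by rewrite divr_gt0.
  have [i hi] := ha _ (divr_gt0 e2 c1); have [j hj] := hb _ e2.
  exists (join i j) => S SA /sat_join[/hi[//|s Ss as_] /hj[//|s' Ss' bs]].
  have [[_ _ Slin] _ _] := SA.
  exists (c *: s + s'); first exact: Slin.
  have -> : c *: a + b - (c *: s + s') = c *: (a - s) + (b - s').
    by rewrite scalerBr opprD addrACA.
  apply: le_lt_trans (nrmD _ _) _; rewrite nrmZ.
  move: as_; rewrite ltr_pdivlMr//; have := nrm_ge0 (a - s); nra.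
- move=> a b ha hb e e0.
  have a0 := nrm_ge0 a; have b0 := nrm_ge0 b.
  pose k := nrm a + nrm b + 1; have k0 : 0 < k by rewrite /k; lra.
  pose r := Num.min 1 (e / (2%:R * k)).
  have r0 : 0 < r by rewrite lt_min ltr01 divr_gt0// mulr_gt0.
  have r1 : r <= 1 by rewrite ge_min lexx.
  have rk : 2%:R * (r * k) <= e.
    have : r <= e / (2%:R * k) by rewrite ge_min lexx orbT.
    by rewrite ler_pdivlMr ?mulr_gt0//; lra.
  have [i hi] := ha _ r0; have [j hj] := hb _ r0.
  exists (join i j) => S SA /sat_join[/hi[//|s Ss as_] /hj[//|s' Ss' bs]].
  have [_ SM _] := SA.
  exists (s * s'); first exact: SM.
  have -> : a * b - s * s' = (a - s) * b + s * (b - s') by ncring.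
  apply: le_lt_trans (nrmD _ _) _.
  have sa : nrm s <= nrm a + r.
    by have := nrm_tri s a 0; rewrite !subr0 (nrmBC s); lra.
  have h1 := nrmM (a - s) b; have h2 := nrmM s (b - s').
  have h3 : nrm (a - s) * nrm b <= r * nrm b by apply: ler_wpM2r => //; exact: ltW.
  have h4 : nrm s * nrm (b - s') <= (nrm a + 1) * r.
    by apply: ler_pM; [exact: nrm_ge0|exact: nrm_ge0|lra|exact: ltW].
  have : r * k = r * nrm a + r * nrm b + r by rewrite /k; ring.
  have rn : 0 < r * k by exact: mulr_gt0.
  by lra.
- move=> a ha e e0; have [i hi] := ha _ e0.
  exists i => S SA Si; have [s Ss as_] := hi S SA Si.
  have [_ _ SS] := SA; exists (cstar s); first exact: SS.
  by rewrite -starB nrm_star.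
Qed.

Lemma approximable_finite (F : set T) (e : R) : finite_set F -> 0 < e ->
  F `<=` approximable ->
  exists i, forall S, cstar_subalgebra S -> sat i S -> forall a, F a -> close S e a.
Proof.
move=> /finite_seqP[s ->] e0; elim: s => [|a s ih] h.
  by exists i0 => S _ _ a.
have [|i hi] := ih; first by move=> x xs; apply: h => /=; rewrite inE; apply/orP; right.
have [|j hj] := h a _ e e0; first by rewrite /= mem_head.
exists (join i j) => S SA /sat_join[/hi his /hj hjs] x /=.
by rewrite inE => /orP[/eqP ->|xs]; [exact: hjs|exact: his].
Qed.

End Approximation.

Lemma preimage_closed_subspace (R : realType) (A T : cstarType R) (Phi : A -> T) (W : set T) :
  unital_star_hom Phi -> closed_subspace W -> closed_subspace (Phi @^-1` W).
Proof.
move=> hP [Wcl W0 Wlin]; have [Plin _ _] := hP; split.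
- apply/closedE => x hx; move/closedE: Wcl; apply => e /hx[y Wy xy].
  exists (Phi y) => //; apply: le_lt_trans xy.
  have -> : Phi x - Phi y = Phi (x - y).
    by rewrite addrC -scaleN1r -Plin scaleN1r addrC.
  exact: star_hom_contract.
- by rewrite /= (linear_fun0 Plin).
- by move=> a x y hx hy; rewrite /= Plin; exact: Wlin.
Qed.

Lemma preimage_cstar_subalgebra (R : realType) (A T : cstarType R) (Phi : A -> T) (W : set T) :
  unital_star_hom Phi -> cstar_subalgebra W -> cstar_subalgebra (Phi @^-1` W).
Proof.
move=> hP [Wc WM WS]; have [_ [_ PM] PS] := hP; split.
- exact: preimage_closed_subspace.
- by move=> x y hx hy; rewrite /= PM; exact: WM.
- by move=> x hx; rewrite /= PS; exact: WS.
Qed.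

Lemma hom_covariant (R : realType) (X : topologicalType) (al : X -> X) (A T : cstarType R)
    (phi : (X -> R[i]^o) -> A) (u : A) (Phi : A -> T) :
  unital_star_hom Phi -> covariant_pair al phi u ->
  covariant_pair al (fun f => Phi (phi f)) (Phi u).
Proof.
move=> [Plin [P1 PM] PS] [[c1 c2 c3 c4] [c5 c6] c7]; split.
- split => [a f g fc gc|f g fc gc||f fc].
  + by rewrite c1// Plin.
  + by rewrite c2// PM.
  + by rewrite c3.
  + by rewrite c4.
- by rewrite -PS -!PM c5 c6.
- by move=> f fc; rewrite -PS -!PM c7.
Qed.

Section MatrixImage.
Variables (R : realType) (U T : cstarType R) (n : nat) (th : 'M[R[i]]_n -> T).
Hypotheses (thlin : linear th) (thM : forall x y, th (x *m y) = th x * th y)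
  (th1 : th 1%:M = 1) (thS : forall x, th (madj x) = cstar (th x)).

Definition matrix_basis (i : 'I_#|{: 'I_n * 'I_n}|) : T :=
  th (delta_mx (enum_val i).1 (enum_val i).2).

Lemma span_matrix_basis x : span_set matrix_basis x <-> range th x.
Proof.
have th0 : th 0 = 0 by exact: linear_fun0.
have thD a b : th (a + b) = th a + th b by rewrite -[a]scale1r thlin !scale1r.
have thZ c a : th (c *: a) = c *: th a by rewrite -[_ *: a]addr0 thlin th0 addr0.
have thsum (F : 'I_#|{: 'I_n * 'I_n}| -> 'M[R[i]]_n) : th (\sum_i F i) = \sum_i th (F i).
  by apply: (big_morph th).
split=> [[c ->]|[M _ <-]].
  exists (\sum_i c i *: delta_mx (enum_val i).1 (enum_val i).2) => //.
  by rewrite thsum; apply: eq_bigr => i _; rewrite thZ.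
exists (fun i => M (enum_val i).1 (enum_val i).2).
under eq_bigr do rewrite /matrix_basis -thZ.
rewrite -thsum; congr th; rewrite {1}[M]matrix_sum_delta pair_bigA /=.
by rewrite (reindex (@enum_val _ {: 'I_n * 'I_n}))//=; exact/onW_bij/enum_val_bij.
Qed.

Lemma span_matrix_star : star_algebra (span_set matrix_basis).
Proof.
split.
- exact: span0.
- by move=> a x y; exact: span_lin.
- move=> _ _ /span_matrix_basis[M _ <-] /span_matrix_basis[N _ <-].
  by apply/span_matrix_basis; exists (M *m N).
- by move=> _ /span_matrix_basis[M _ <-]; apply/span_matrix_basis; exists (madj M).
Qed.

Lemma span_matrix1 : span_set matrix_basis 1.
Proof. by apply/span_matrix_basis; exists 1%:M. Qed.

End MatrixImage.

(** A finite request: the first [acc_size] functions of a sequence, a level of the UHF algebra and a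
    tolerance. The functions are indexed by all of [nat], so that two requests can be concatenated
    without dependent indices. *)
Record accuracy (R : realType) (X : topologicalType) := Accuracy {
  acc_size : nat;
  acc_fun : nat -> X -> R[i]^o;
  acc_cont : forall r, contC (acc_fun r);
  acc_level : nat;
  acc_dist : R;
  acc_gt0 : 0 < acc_dist
}.

Section Accuracy.
Variables (R : realType) (X : topologicalType).

Definition accuracy_fun (f : X -> R[i]^o) (fc : contC f) (d : R) (d0 : 0 < d) :=
  Accuracy 1 (fun _ : nat => fc) 0 d0.

Definition accuracy_level (m : nat) (d : R) (d0 : 0 < d) :=
  Accuracy 0 (fun _ : nat => contC_cst X (0 : R[i]^o)) m d0.

Lemma join_gt0 (i j : accuracy R X) : 0 < Num.min (acc_dist i) (acc_dist j).
Proof. by rewrite lt_min !acc_gt0. Qed.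

Definition join_fun (i j : accuracy R X) (r : nat) :=
  if (r < acc_size i)%N then acc_fun i r else acc_fun j (r - acc_size i).

Lemma join_cont (i j : accuracy R X) r : contC (join_fun i j r).
Proof. by rewrite /join_fun; case: ifP => _; exact: acc_cont. Qed.

Definition join_accuracy (i j : accuracy R X) := Accuracy (acc_size i + acc_size j)
  (@join_cont i j) (maxn (acc_level i) (acc_level j)) (join_gt0 i j).

End Accuracy.

Theorem theorem4p1 (R : realType)
    (X : topologicalType) (X_compact : compact [set: X])
    (X_metrizable : metrizable R X)
    (alpha : X -> X) (alpha_homeo : homeomorphism alpha)
    (alpha_minimal : minimal alpha)
    (A : cstarType R) (phi : (X -> R[i]^o) -> A) (u : A)
    (A_crossed : is_crossed_product alpha phi u)
    (U : cstarType R) (U_UHF : is_UHF U)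
    (U_infinite : infinite_dimensional U)
    (T : cstarType R) (t : A -> U -> T)
    (T_tensor : is_tensor_product t) :
  locally_subhomogeneous T.
Proof.
have [cov gen _] := A_crossed.
have [k [psi [k0 psiP psi_range psi_dense]]] := U_UHF.
have [Phi [Psi [PhiH PsiH comm tot]]] := tensor_homs T_tensor.
have covT := hom_covariant PhiH cov.
have [Psilin [Psi1 PsiM] PsiS] := PsiH.
(* The unitary and the functions are to be approximated, whereas the matrix level is to be contained
   exactly. *)
pose sat (i : accuracy R X) (S : set T) := [/\ close S (acc_dist i) (Phi u),
    forall r, (r < acc_size i)%N -> close S (acc_dist i) (Phi (phi (acc_fun i r))) &
    forall M, S (Psi (psi (acc_level i) M))].
have close_le S (d d' : R) a : d <= d' -> close S d a -> close S d' a.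
  by move=> dd [s Ss hs]; exists s => //; exact: lt_le_trans dd.
have psi_sub m n : (m <= n)%N -> forall M, exists N, psi m M = psi n N.
  move=> mn M; have [|N _ <-] := uhf_range_le psi_range mn (t := psi m M); last by exists N.
  by exists M.
have sat_join i j S : sat (join_accuracy i j) S -> sat i S /\ sat j S.
  move=> [h1 h2 h3].
  have dl : acc_dist (join_accuracy i j) <= acc_dist i by rewrite ge_min lexx.
  have dr : acc_dist (join_accuracy i j) <= acc_dist j by rewrite ge_min lexx orbT.
  split; split.
  - exact: close_le dl h1.
  - move=> r ri; apply: close_le dl _.
    by have := h2 r (ltn_addr _ ri); rewrite /= /join_fun ri.
  - by move=> M; have [N ->] := psi_sub _ _ (leq_maxl (acc_level i) (acc_level j)) M; exact: h3.
  - exact: close_le dr h1.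
  - move=> r rj; apply: close_le dr _.
    have := h2 (acc_size i + r)%N; rewrite /= /join_fun ltn_add2l => /(_ rj).
    by rewrite ltnNge leq_addr /= addKn.
  - by move=> M; have [N ->] := psi_sub _ _ (leq_maxr (acc_level i) (acc_level j)) M; exact: h3.
pose i0 := accuracy_level X 0 (ltr01 : (0 : R) < 1).
(* The products [Phi a * Psi b] are total, so the two factors can be treated separately: [Phi a]
   through the generators of the crossed product, [Psi b] through the dense union of matrix
   algebras. *)
have all_app : approximable sat = [set: T].
  have appA := approximable_cstar i0 sat_join; have [appc appM _] := appA.
  apply: tot => // _ [a [b ->]]; apply: appM.
  - have genA : Phi @^-1` approximable sat = [set: A].
      apply: gen; first exact: preimage_cstar_subalgebra.
        move=> f fc e e0; exists (accuracy_fun (ContC fc) e0) => S _ [_ h _].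
        exact: (h 0%N).
      by move=> e e0; exists (accuracy_level X 0 e0) => S _ [].
    by have : (Phi @^-1` approximable sat) a by rewrite genA.
  - have [clP _ _] := preimage_closed_subspace PsiH appc.
    suff : closure (Psi @^-1` approximable sat) b by rewrite -(closure_id _).1.
    have : closure (\bigcup_m range (psi m)) b by rewrite psi_dense.
    apply: closureS => _ [m _ [M _ <-]] e e0.
    exists (accuracy_level X m e0) => S _ [_ _ h]; exists (Psi (psi m M)) => //.
    by rewrite subrr nrm0.
move=> F e Ffin e0.
have [|i hi] := approximable_finite i0 sat_join Ffin e0; first by rewrite all_app.
pose f (r : 'I_(acc_size i)) := acc_fun i r.
have [n0 hn0] := local_algebra X_compact X_metrizable alpha_homeo alpha_minimal covT
  (f := f) (fun r => acc_cont i r) (acc_gt0 i).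
(* The matrix units commute with the requested level [acc_level i] and lie in a larger level [m];
   the images of these two levels are the algebras spanned by [g] and [hb] in [local_algebra]. *)
have [l [m [E [[nl lm Em] [EE Es E1 Ec]]]]] := uhf_commutant_units k0 psiP psi_range psi_dense
  U_infinite (acc_level i) n0.
pose th n M := Psi (psi n M).
have thlin n : linear (th n) by move=> a x y; rewrite /th (uhf_lin psiP) Psilin.
have thM n x y : th n (x *m y) = th n x * th n y by rewrite /th (uhfM psiP) PsiM.
have th1 n : th n 1%:M = 1 by rewrite /th (uhf1 psiP).
have thS n x : th n (madj x) = cstar (th n x) by rewrite /th (uhf_star psiP) PsiS.
have comm_phi n x g : span_set (matrix_basis (th n)) x -> contC g ->
    x * Phi (phi g) = Phi (phi g) * x.
  by move=> /(span_matrix_basis (thlin n))[M _ <-] _; rewrite comm.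
have comm_u n x : span_set (matrix_basis (th n)) x -> x * Phi u = Phi u * x.
  by move=> /(span_matrix_basis (thlin n))[M _ <-]; rewrite comm.
have Psi0 : Psi 0 = 0 by exact: linear_fun0.
have PsiD a b : Psi (a + b) = Psi a + Psi b by rewrite -[a]scale1r Psilin !scale1r.
have gG : span_set (matrix_basis (th (acc_level i))) `<=` span_set (matrix_basis (th m)).
  move=> x /(span_matrix_basis (thlin _))[M _ <-]; apply/(span_matrix_basis (thlin m)).
  by have [N MN] := psi_sub _ _ lm M; exists N; rewrite // /th MN.
have PEG a b : span_set (matrix_basis (th m)) (Psi (E a b)).
  by apply/(span_matrix_basis (thlin m)); have [M _ <-] := Em a b; exists M.
have PEE a b a' b' : Psi (E a b) * Psi (E a' b') = if b == a' then Psi (E a b') else 0.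
  by rewrite -PsiM EE; case: eqP.
have PEs a b : cstar (Psi (E a b)) = Psi (E b a) by rewrite -PsiS Es.
have PE1 : \sum_a Psi (E a a) = 1 by rewrite -Psi1 -E1 (big_morph Psi PsiD Psi0).
have PEc x a b : span_set (matrix_basis (th (acc_level i))) x ->
    x * Psi (E a b) = Psi (E a b) * x.
  move=> /(span_matrix_basis (thlin _))[M _ <-]; rewrite /th -!PsiM; congr Psi.
  by apply: Ec; exists M.
have [S [SA Ssub gS Su Sf]] := hn0 l nl _ _
  (span_matrix_star (thlin m) (thM m) (thS m)) (span_matrix1 (thlin m) (th1 m))
  (comm_phi m) (comm_u m) _ _ (span_matrix_star (thlin _) (thM _) (thS _))
  (span_matrix1 (thlin _) (th1 _)) gG _ PEG PEE PEs PE1 PEc.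
exists S; split => // a Fa.
have [|c Sc ac] := hi S SA _ a Fa.
  split => //; first by move=> r ri; exact: (Sf (Ordinal ri)).
  by move=> M; apply: gS; apply/(span_matrix_basis (thlin _)); exists M.
by exists c => //; rewrite nrmE ltcR.
Qed.
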